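(* Let $S:\ y=F(a,b,x)$ be a regular para-CR hypersurface in $\mathbb R^4$. For every $\ell\ge 2$ there is a polynomial mapping (a product change of coordinates near the origin) that takes the weighted $\ell$-jet $F_\ell$ into jet normal form of order $\ell$. Moreover, if $F_\ell$ is in jet normal form of order $\ell$, then $F_{\ell+1}$ may be taken into jet normal form of order $\ell+1$ by a mapping $\Phi_{\ell+1}$ defined component-wise by $$X=x+\xi_\ell(x,y),\quad Y=y+\eta_{\ell+1}(x,y),\quad A=a+\alpha_{\ell+1}(a,b),\quad B=b+\beta_\ell(a,b),$$ where $\xi_\ell$ and $\beta_\ell$ are polynomials of weight $\ell$ and $\eta_{\ell+1}$ and $\alpha_{\ell+1}$ are polynomials of weight $\ell+1$. The mapping $\Phi_{\ell+1}$ is unique if $\ell>4$.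
   Context: Coordinates on $\mathbb R^4=\mathbb R^2_{xy}\times\mathbb R^2_{ab}$ are $(x,y,a,b)$. Everything is local near the origin. A para-CR hypersurface is a smooth hypersurface $S:\ y=F(a,b,x)$ with $F(0,0,0)=0$ and $\frac{\partial F}{\partial a}(0,0,0)\ne 0$, equipped with the two direction fields $TS\cap T\mathbb R^2_{xy}$ and $TS\cap T\mathbb R^2_{ab}$, spanned in the local coordinates $(x,a,b)$ on $S$ by $\partial_x$ and $F_a\partial_b-F_b\partial_a$ respectively. $S$ is regular if the two direction fields together with their commutator span $TS$ at each point. Admissible changes of coordinates respect the product structure: $(x,y)\mapsto (X,Y)$ depends only on $(x,y)$, $(a,b)\mapsto(A,B)$ depends only on $(a,b)$, and both are local diffeomorphisms fixing the origin. The image of $S$ is then written $Y=F^*(A,B,X)$; ''taking $F_\ell$ into jet normal form'' means that the weighted $\ell$-jet of $F^*$ is in jet normal form of order $\ell$. Weights: $x,b$ have weight $1$ and $y,a$ have weight $2$; a polynomial in these variables has weight $\nu$ if it is homogeneous of degree $\nu$ with respect to these weights (e.g. $P(t^2a,tb,tx)=t^\nu P(a,b,x)$). The weighted $\ell$-jet $F_\ell$ of $F$ is the polynomial, consisting of terms of weight $\le \ell$, such that $F(t^2a,tb,tx)=F_\ell(t^2a,tb,tx)+o(t^\ell)$ as $t\to0$. Write $P_\nu$ for the weight-$\nu$ homogeneous component of $F_\ell$. $F_\ell$ (or $S$) is in jet normal form of order $\ell\ge2$ if $F_2=P_2=a+bx$ and, for every $2<\nu\le\ell$, $P_\nu$ contains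 no monomials (of weight $\nu$, with $i,j\ge 0$ integers) of the types $$a^ix^j,\ a^ib^j\ (2i+j=\nu);\qquad a^ibx^j,\ a^ib^jx\ (2i+j+1=\nu);\qquad a^ib^2x^2,\ a^ib^2x^3,\ a^ib^3x^2,\ a^ib^3x^3 .$$ *)

(* Defs.v *)
From HB Require Import structures.
From mathcomp Require Import all_boot all_order all_algebra.
From mathcomp Require Import all_classical all_reals all_analysis.
(* The notations of mpoly clash with those of mathcomp-analysis. *)
From mathcomp Require Import -(notations) mpoly.
Import Order.TTheory GRing.Theory Num.Theory.
Import numFieldNormedType.Exports.

Set Implicit Arguments.
Unset Strict Implicit.
Unset Printing Implicit Defensive.

Local Open Scope classical_set_scope.
Local Open Scope ring_scope.

(* Conventions: a point of R^2_xy is p : 'rV_2 = (x, y), a point of R^2_ab is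
   q : 'rV_2 = (a, b), and the arguments of F are v : 'rV_3 = (a, b, x).
   Polynomials number their variables accordingly, from 0. *)

Definition row2 {R : Type} (u v : R) : 'rV[R]_2 :=
  \row_i (if i == 0 then u else v).

Definition row3 {R : Type} (u v w : R) : 'rV[R]_3 :=
  \row_i (if i == 0 then u else if i == 1 then v else w).

Section Smooth.
Variables (R : realType) (n : nat).

Definition partial (i : 'I_n.+1) (f : 'rV[R]_n.+1 -> R) : 'rV[R]_n.+1 -> R :=
  fun p => 'D_(delta_mx 0 i) f p.

Definition iter_partial (s : seq 'I_n.+1) (f : 'rV[R]_n.+1 -> R) :
    'rV[R]_n.+1 -> R :=
  foldr partial f s.

(* C^infinity on a neighbourhood of the origin, the same for all orders of
   differentiation. *)
Definition smooth_near0 (f : 'rV[R]_n.+1 -> R) : Prop :=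
  \forall p \near (0 : 'rV[R]_n.+1), forall s : seq 'I_n.+1,
    {for p, continuous (iter_partial s f)} /\
    forall i, derivable (iter_partial s f) p (delta_mx 0 i).

Definition smooth_map_near0 m (f : 'rV[R]_n.+1 -> 'rV[R]_m) : Prop :=
  forall j, smooth_near0 (fun p => f p 0 j).

Definition local_diffeo0 (f : 'rV[R]_n.+1 -> 'rV[R]_n.+1) : Prop :=
  [/\ smooth_map_near0 f, f 0 = 0 &
   exists g : 'rV[R]_n.+1 -> 'rV[R]_n.+1,
     [/\ smooth_map_near0 g, g 0 = 0,
         \forall p \near (0 : 'rV[R]_n.+1), g (f p) = p &
         \forall p \near (0 : 'rV[R]_n.+1), f (g p) = p]].

Definition lie_bracket (U V : 'rV[R]_n.+1 -> 'rV[R]_n.+1) :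
    'rV[R]_n.+1 -> 'rV[R]_n.+1 :=
  fun p => 'D_(U p) V p - 'D_(V p) U p.

End Smooth.

Section ParaCR.
Variable R : realType.
Implicit Types F : 'rV[R]_3 -> R.

Definition para_CR F : Prop :=
  [/\ smooth_near0 F, F 0 = 0 & partial 0 F 0 != 0].

(* In the chart (a, b, x) of S, the generators d/dx of the first direction
   field and F_a d/db - F_b d/da of the second one. *)
Definition xy_field : 'rV[R]_3 -> 'rV[R]_3 := fun=> row3 0 0 1.

Definition ab_field F : 'rV[R]_3 -> 'rV[R]_3 :=
  fun v => row3 (- partial 1 F v) (partial 0 F v) 0.

Definition regular F : Prop :=
  \forall v \near (0 : 'rV[R]_3),
    row_full (xy_field v + ab_field F v
              + lie_bracket xy_field (ab_field F) v)%MS.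

Definition on_hypersurface F (p q : 'rV[R]_2) : Prop :=
  p 0 1 = F (row3 (q 0 0) (q 0 1) (p 0 0)).

(* The product map f x g sends the germ at the origin of y = F(a, b, x)
   onto that of Y = Fs(A, B, X). *)
Definition maps_onto (f g : 'rV[R]_2 -> 'rV[R]_2) F Fs : Prop :=
  \forall p \near (0 : 'rV[R]_2) & q \near (0 : 'rV[R]_2),
    on_hypersurface F p q <-> on_hypersurface Fs (f p) (g q).

End ParaCR.

Section Weights.
Variables (R : realType) (n : nat).
(* The i-th variable has weight ws`_i. *)
Variable ws : seq nat.

Definition weight (m : multinom n) : nat := (\sum_(i < n) nth 0 ws i * m i)%N.

Definition whomog (nu : nat) (P : mpoly n R) : Prop :=
  forall m, m \in msupp P -> weight m = nu.

Definition wcomp (nu : nat) (P : mpoly n R) : mpoly n R :=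
  \sum_(m <- msupp P | weight m == nu) mcoeff m P *: mpolyX R m.

Definition wtrunc (l : nat) (P : mpoly n R) : mpoly n R :=
  \sum_(nu < l.+1) wcomp nu P.

Definition wdil (t : R) (v : 'rV[R]_n) : 'rV[R]_n :=
  \row_i (t ^+ nth 0%N ws i * v 0 i).

Definition peval (P : mpoly n R) (v : 'rV[R]_n) : R :=
  meval (fun i => v 0 i) P.

End Weights.

Notation w_abx := [:: 2; 1; 1]%N.
Notation w_xy := [:: 1; 2]%N.
Notation w_ab := [:: 2; 1]%N.

Definition pvar (R : realType) n (i : 'I_n) : mpoly n R := mpolyX R (mnm1 i).
Arguments pvar R {n} i.

Section NormalForm.
Variable R : realType.
Implicit Types (F : 'rV[R]_3 -> R) (P : mpoly 3 R).

Definition is_wjet (l : nat) F P : Prop :=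
  (forall m, m \in msupp P -> (weight w_abx m <= l)%N) /\
  forall v : 'rV[R]_3,
    (fun t : R => F (wdil w_abx t v) - peval P (wdil w_abx t v))
      =o_ ((0 : R)^') (fun t : R => t ^+ l).

(* The monomial a^i b^k x^j. *)
Definition excluded (m : multinom 3) : bool :=
  let k := m 1 in let j := m (2 : 'I_3) in
  [|| k == 0, j == 0, k == 1, j == 1
    | (k, j) \in [:: (2, 2); (2, 3); (3, 2); (3, 3)]]%N.

Definition jet_normal_form (l : nat) P : Prop :=
  [/\ wtrunc w_abx 2 P = wcomp w_abx 2 P,
      wcomp w_abx 2 P = pvar R 0 + pvar R 1 * pvar R (2 : 'I_3) &
      forall nu : nat, (2 < nu <= l)%N ->
        forall m, excluded m -> m \notin msupp (wcomp w_abx nu P)].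

Definition jet_in_normal_form (l : nat) F : Prop :=
  exists2 P, is_wjet l F P & jet_normal_form l P.

Record product_polymap := ProductPolymap {
  polX : mpoly 2 R;
  polY : mpoly 2 R;
  polA : mpoly 2 R;
  polB : mpoly 2 R
}.

Definition xy_map (Phi : product_polymap) (p : 'rV[R]_2) : 'rV[R]_2 :=
  row2 (peval (polX Phi) p) (peval (polY Phi) p).

Definition ab_map (Phi : product_polymap) (q : 'rV[R]_2) : 'rV[R]_2 :=
  row2 (peval (polA Phi) q) (peval (polB Phi) q).

Definition admissible (Phi : product_polymap) : Prop :=
  local_diffeo0 (xy_map Phi) /\ local_diffeo0 (ab_map Phi).

Definition takes_to_normal_form (l : nat) F (Phi : product_polymap) : Prop :=
  admissible Phi /\
  exists Fs, [/\ para_CR Fs, maps_onto (xy_map Phi) (ab_map Phi) F Fs &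
                 jet_in_normal_form l Fs].

Definition elementary (l : nat) (Phi : product_polymap) : Prop :=
  exists xi eta alpha beta : mpoly 2 R,
    [/\ whomog w_xy l xi /\ whomog w_xy l.+1 eta,
        whomog w_ab l.+1 alpha /\ whomog w_ab l beta &
        Phi = ProductPolymap (pvar R 0 + xi) (pvar R 1 + eta)
                             (pvar R 0 + alpha) (pvar R 1 + beta)].

End NormalForm.

(* Main.v *)
From HB Require Import structures.
Require Import Defs.
From mathcomp Require Import all_boot all_order all_algebra.
From mathcomp Require Import all_classical all_reals all_analysis.
From mathcomp Require Import -(notations) mpoly.
From mathcomp Require Import ring lra zify.

(** The proof has an algebraic core and an analytic frame.

    Algebra.  Let [F = P + ...] be in normal form up to weight [l], so that [P]
    starts with [a + b x].  An elementary map moves every variable by terms of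
    weight [l - 1] more than its own.  Substituting it into the equation of the
    image shows that it does not change the jet up to weight [l], and that in
    weight [l + 1] it adds
      [eta (x, a + b x) - al (a, b) - x be (a, b) - b xi (x, a + b x)]
    ([transformed_jet]).  Normalizing in weight [l + 1] is therefore a linear
    problem: the coefficients of this expression at the excluded monomials have
    to take prescribed values.  The expression respects the grading by the
    difference [d] of the exponents of [x] and [b], and splits into systems with
    at most four unknowns.  They can always be solved ([inf_coef_solve]), and
    the solution is unique when the weight exceeds 5 ([inf_coef_inj]).  The
    excluded monomials outside the four families, [b^2 x^2] and its companions,
    are exactly what removes the extra freedom for [|d| <= 1].

    Start.  The weight-two jet is normalized by explicit maps with polynomial
    inverses ([quadratic_normalization]).  In the linear coordinates that remove
    the [b]-term, regularity says that the coefficient of [b x] is nonzero.  The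
    first statement then follows by composing this map with elementary maps.

    Analysis.  The image of a smooth graph must be a smooth graph, which needs
    the inverse function theorem in the class C^infinity ([inverse_function]);
    the image is constructed in [image_hypersurface], and the Jacobian condition
    for elementary maps follows from weights alone ([weighted_local_diffeo]).
    Jets of the image are computed from its functional equation.  To allow
    substitutions, the pointwise remainders of weighted jets are replaced by
    the uniform estimates [wbigO]; smooth functions have jets with such
    remainders ([smooth_wjet]), and jets are unique ([small_peval_weight]),
    whence the equivalence [is_wjet_bigO]. *)

Import Order.TTheory GRing.Theory Num.Theory.
Import numFieldNormedType.Exports.

Set Implicit Arguments.
Unset Strict Implicit.
Unset Printing Implicit Defensive.

Local Open Scope classical_set_scope.
Local Open Scope ring_scope.

(** * The mean value theorem in several variables *)
Section Partials.
Variables (R : realType) (n : nat).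
Implicit Types (f g : 'rV[R]_n.+1 -> R) (p q : 'rV[R]_n.+1) (i j : 'I_n.+1).

Local Notation e_ := (@delta_mx R 1 n.+1 0).

Lemma coord_le_norm p i : `|p 0 i| <= `|p|.
Proof. by rewrite [leRHS]/Num.Def.normr/= mx_normrE (le_bigmax _ _ (0, i)). Qed.

Lemma norm_le_coord p (M : R) : 0 <= M -> (forall i, `|p 0 i| <= M) -> `|p| <= M.
Proof.
move=> M0 pM; rewrite [leLHS]/Num.Def.normr/= mx_normrE.
by apply: bigmax_le => // -[k i] _ /=; rewrite ord1.
Qed.

Lemma is_derive_line f p v (s : R) : derivable f (p + s *: v) v ->
  is_derive s 1 (fun t : R => f (p + t *: v)) ('D_v f (p + s *: v)).
Proof.
move=> df; have E : (fun h : R => h^-1 *: (f (p + (h *: 1 + s) *: v) - f (p + s *: v)))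
   = (fun h : R => h^-1 *: (f (h *: v + (p + s *: v)) - f (p + s *: v))).
  by apply/funext => h; rewrite [h%:A]mulr1 scalerDl addrCA.
by split; rewrite /derivable /derive /= E.
Qed.

Lemma mean_value_line f p i (a : R) :
    (forall s : R, 0 <= s <= 1 -> derivable f (p + (s * a) *: e_ i) (e_ i)) ->
  exists2 s, 0 <= s <= 1 &
    f (p + a *: e_ i) - f p = a * partial i f (p + (s * a) *: e_ i).
Proof.
move=> df; pose g (s : R) := f (p + (s * a) *: e_ i).
have dg (s : R) : 0 <= s <= 1 ->
    is_derive s 1 g (a * partial i f (p + (s * a) *: e_ i)).
  move=> s01; have := is_derive_line (df s s01) => d1.
  have d2 : is_derive s 1 (fun t : R => t * a) a.
    apply: (@is_derive_eq _ _ _ (id * cst a)).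
    by rewrite /GRing.scale /= mulr0 mulr1 add0r.
  have := @is_derive1_comp R (fun t : R => f (p + t *: e_ i)) (fun t => t * a) s
    _ _ d1 d2.
  by rewrite mulrC.
have [||s s01 E] := @MVT_segment R g (fun s => a * partial i f (p + (s * a) *: e_ i))
  0 1 ler01.
- by move=> x /[!in_itv]/= /andP[x0 x1]; apply: dg; rewrite !ltW.
- apply: derivable_within_continuous => x /[!in_itv]/= x01.
  by apply: ex_derive; exact: dg.
exists s; first by move: s01; rewrite in_itv.
by move: E; rewrite /g mul1r mul0r scale0r addr0 subr0 mulr1.
Qed.

(** The path from [q] to [q'] that changes one coordinate at a time stays, for
    the sup norm, in the ball of centre [q] through [q'], so the one-variable
    theorem applies on each of its edges.  Having the intermediate points no
    further from [q] than [q'] lets them converge to [q] together with [q']: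
    this is how continuity of the partial derivatives enters the chain rule and
    the inverse function theorem. *)
Lemma mean_value_rV f q q' :
    (forall x i, `|x - q| <= `|q' - q| -> derivable f x (e_ i)) ->
  exists2 c : 'I_n.+1 -> 'rV[R]_n.+1,
    forall i, `|c i - q| <= `|q' - q| &
    f q' - f q = \sum_i (q' - q) 0 i * partial i f (c i).
Proof.
move=> df; pose w k : 'rV[R]_n.+1 := \row_i (if (i < k)%N then q' 0 i else q 0 i).
have wS i : w i.+1 = w i + (q' - q) 0 i *: e_ i.
  apply/rowP => j; rewrite !mxE /= ltnS leq_eqVlt -val_eqE /=.
  have [ji|ij|/val_inj ->] := ltngtP j i; rewrite ?mulr1 ?mulr0 ?addr0 //=.
  by rewrite addrC subrK.
have wB i (s : R) : 0 <= s <= 1 -> `|w i + (s * (q' - q) 0 i) *: e_ i - q| <= `|q' - q|.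
  move=> /andP[s0 s1]; apply: norm_le_coord => // j.
  have := coord_le_norm (q' - q) j; rewrite !mxE /= -val_eqE /=.
  have [ji|ij|/val_inj ->] := ltngtP j i; rewrite ?(mulr0, mulr1) ?addr0 ?subrr ?normr0 //.
  rewrite addrAC subrr add0r normrM (ger0_norm s0) => le1.
  by rewrite (le_trans _ le1) // ler_piMl.
have D i : exists x, `|x - q| <= `|q' - q| /\
    f (w i.+1) - f (w i) = (q' - q) 0 i * partial i f x.
  have [|s s01 E] := @mean_value_line f (w i) i ((q' - q) 0 i).
    by move=> s s01; apply: df; apply: wB.
  by exists (w i + (s * (q' - q) 0 i) *: e_ i); rewrite wS; split=> //; exact: wB.
have [c cP] := choice D; exists c; first by move=> i; have [] := cP i.
have wn : w n.+1 = q' by apply/rowP => i; rewrite mxE ltn_ord.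
have w0 : w 0%N = q by apply/rowP => i; rewrite mxE.
rewrite -[in f q']wn -[in f q]w0 -(telescope_sumr (f \o w) (leq0n n.+1)) big_mkord.
by apply: eq_bigr => i _; have [_ /= ->] := cP i.
Qed.

End Partials.

(** * The chain rule and functions of class C^k *)
Section ChainRule.
Variables (R : realType) (n : nat).

Lemma cvg_rV T (F : set_system T) (FF : Filter F) (g : T -> 'rV[R]_n.+1) (l : 'rV[R]_n.+1) :
  (forall j, g x 0 j @[x --> F] --> l 0 j) -> g x @[x --> F] --> l.
Proof.
move=> gl; apply/cvgrPdist_le => e e0.
have H : forall j, \forall x \near F, `|l 0 j - g x 0 j| <= e.
  by move=> j; move/cvgrPdist_le: (gl j); apply.
near=> x; apply: norm_le_coord; first exact: ltW.
move=> j; rewrite !mxE; move: j; near: x; exact: filter_forall.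
Unshelve. all: by end_near. Qed.

Lemma continuous_rV (T : topologicalType) (g : T -> 'rV[R]_n.+1) p :
  (forall j, {for p, continuous (fun x => g x 0 j)}) -> {for p, continuous g}.
Proof. by move=> gc; apply: cvg_rV => j; exact: gc. Qed.

(** The increment of [f] along [g (h *: v + p)] is a sum of increments of the
    coordinates of [g] times partial derivatives of [f] at points that tend to
    [g p]; continuity of these partial derivatives gives the limit. *)
Lemma is_derive_comp_rV (V : normedModType R) (f : 'rV[R]_n.+1 -> R)
    (g : V -> 'rV[R]_n.+1) p v :
    (\forall x \near g p, forall i, derivable f x (delta_mx 0 i)) ->
    (forall i, {for g p, continuous (partial i f)}) ->
    (forall j, derivable (fun x => g x 0 j) p v) ->
  is_derive p v (f \o g) (\sum_j 'D_v (fun x => g x 0 j) p * partial j f (g p)).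
Proof.
move=> df cf dg; pose y h := g (h *: v + p).
have y0 : y 0 = g p by rewrite /y scale0r add0r.
have ycvg : y h @[h --> (0 : R)^'] --> g p.
  apply: cvg_rV => j.
  have /derivable1P/derivable1_diffP/differentiable_continuous H := dg j.
  have {}H : y h 0 j @[h --> (0 : R)] --> g p 0 j by rewrite -y0.
  by apply: cvg_trans H; apply: cvg_app; exact: cvg_within.
have [r /= r0 rP] : exists2 r : R, 0 < r &
    forall x, `|x - g p| < r -> forall i, derivable f x (delta_mx 0 i).
  have /nbhs_ballP[r /= r0 H] := df.
  exists r; first exact: r0.
  by move=> x xr i; apply: H; rewrite -ball_normE /= distrC.
have Hc (h : R) : exists c : 'I_n.+1 -> 'rV[R]_n.+1, `|y h - g p| < r ->
     (forall i, `|c i - g p| <= `|y h - g p|) /\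
     f (y h) - f (g p) = \sum_i (y h - g p) 0 i * partial i f (c i).
  have [yr|nyr] := pselect (`|y h - g p| < r); last first.
    by exists (fun=> 0 : 'rV[R]_n.+1) => /nyr.
  have [c c1 c2] := @mean_value_rV R n f (g p) (y h)
    (fun x i xle => rP x (le_lt_trans xle yr) i).
  by exists c.
have [c cP] := choice Hc.
have near_r : \forall h \near (0 : R)^', `|y h - g p| < r.
  by move/cvgrPdist_lt: ycvg => /(_ r r0); apply: filterS => h; rewrite distrC.
have ccvg i : c h i @[h --> (0 : R)^'] --> g p.
  apply/cvgrPdist_le => e e0; move/cvgrPdist_le: ycvg => /(_ e e0) ye.
  near=> h; have [|H _] := cP h; first by near: h.
  by rewrite distrC (le_trans (H i)) // distrC; near: h.
have L : h^-1 *: (((f \o g) \o shift p) (h *: v) - (f \o g) p) @[h --> 0^'] -->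
    \sum_j 'D_v (fun x => g x 0 j) p * partial j f (g p).
  have : \sum_j (h^-1 *: (y h 0 j - g p 0 j)) * partial j f (c h j) @[h --> (0:R)^'] -->
       \sum_j 'D_v (fun x => g x 0 j) p * partial j f (g p).
    apply: cvg_big => [|j _]; first exact: add_continuous.
    apply: cvgM; first exact: dg.
    by apply: continuous_cvg (ccvg j); exact: cf.
  apply: cvg_trans; apply: near_eq_cvg; near=> h.
  have [|_ /= E] := cP h; first by near: h.
  rewrite -/(y h) E scaler_sumr; apply: eq_bigr => j _.
  by rewrite scalerAl !mxE.
by split; [apply/cvg_ex; eexists; exact: L | exact: cvg_lim L].
Unshelve. all: by end_near. Qed.

End ChainRule.

Section Ck.
Variables (R : realType).

(** A recursive form of the class C^k, so that stability under the usual
    operations follows by induction on [k] from the formula for one partial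
    derivative.  On an open set it depends only on the values there. *)
Fixpoint Ck n (U : set 'rV[R]_n.+1) k (f : 'rV[R]_n.+1 -> R) : Prop :=
  {in U, continuous f} /\
  if k is k'.+1 then
    forall i, {in U, forall p, derivable f p (delta_mx 0 i)} /\ Ck U k' (partial i f)
  else True.

Lemma Ck_cont n (U : set 'rV[R]_n.+1) k f : Ck U k f -> {in U, continuous f}.
Proof. by case: k => [|k] []. Qed.

Lemma CkS n (U : set 'rV[R]_n.+1) k f : Ck U k.+1 f -> Ck U k f.
Proof.
elim: k f => [|k IH] f; first by case.
by move=> [cf df]; split=> // i; have [d1 d2] := df i; split=> //; apply: IH.
Qed.

Lemma Ck_sub n (U V : set 'rV[R]_n.+1) k f : V `<=` U -> Ck U k f -> Ck V k f.
Proof.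
move=> VU; elim: k f => [|k IH] f [cf df]; split=> //.
- by move=> p /[1!inE] Vp; apply: cf; rewrite inE; exact: VU.
- by move=> p /[1!inE] Vp; apply: cf; rewrite inE; exact: VU.
move=> i; have [d1 d2] := df i; split; last exact: IH.
by move=> p /[1!inE] Vp; apply: d1; rewrite inE; exact: VU.
Qed.

Section FixedOpen.
Variables (n : nat) (U : set 'rV[R]_n.+1) (Uo : open U).
Implicit Types f g : 'rV[R]_n.+1 -> R.

Lemma open_near p : U p -> \forall x \near p, U x.
Proof. by move: Uo; rewrite openE => /[apply]. Qed.

Lemma eq_Ck k f g : {in U, f =1 g} -> Ck U k f -> Ck U k g.
Proof.
elim: k f g => [|k IH] f g fg [cf df].
all: have nfg p : p \in U -> {near p, f =1 g}
  by move=> /[1!inE] /open_near; apply: filterS => x Ux; rewrite fg ?inE.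
all: split=> //.
- move=> p Up; rewrite /continuous_at -(fg _ Up).
  by apply: cvg_trans (cf p Up); exact: (@near_eq_cvg _ _ (nbhs p) _ f g (nfg p Up)).
- move=> p Up; rewrite /continuous_at -(fg _ Up).
  by apply: cvg_trans (cf p Up); exact: (@near_eq_cvg _ _ (nbhs p) _ f g (nfg p Up)).
move=> i; have [d1 d2] := df i; split.
  by move=> p Up; apply: near_eq_derivable (d1 p Up); exact: nfg.
apply: IH d2 => p Up; rewrite /partial; apply: near_eq_derive.
exact: nfg.
Qed.

Lemma Ck_cst k (c : R) : Ck U k (fun=> c).
Proof.
have zero m : Ck U m (fun=> 0 : R).
  elim: m => [|m IH]; split=> //; first by move=> p _; exact: cst_continuous.
    by move=> p _; exact: cst_continuous.
  move=> i; split; first by move=> p _; exact: derivable_cst.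
  by apply: eq_Ck IH => p _; rewrite /partial (derive_cst (0 : R)).
case: k => [|k]; split=> //; first by move=> p _; exact: cst_continuous.
  by move=> p _; exact: cst_continuous.
move=> i; split; first by move=> p _; exact: derivable_cst.
by apply: eq_Ck (zero k) => p _; rewrite /partial (derive_cst (c : R)).
Qed.

Lemma is_derive_coord p v j :
  is_derive p v (fun x : 'rV[R]_n.+1 => x 0 j : R) (v 0 j).
Proof.
have d : differentiable (fun x : 'rV[R]_n.+1 => x 0 j : R) p.
  exact: differentiable_coord.
split; first exact: diff_derivable.
have H : derivable (id : 'rV[R]_n.+1 -> 'rV[R]_n.+1) p v by exact: derivable_id.
have := derive_mx H; rewrite derive_id.
by move=> /(congr1 (fun M : 'rV_n.+1 => M 0 j)); rewrite mxE => <-.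
Qed.

Lemma Ck_coord k j : Ck U k (fun x => x 0 j).
Proof.
have cc : {in U, continuous (fun x : 'rV[R]_n.+1 => x 0 j)}.
  by move=> p _; exact: coord_continuous.
case: k => [|k]; split=> //.
move=> i; split; first by move=> p _; apply: ex_derive; exact: is_derive_coord.
apply: eq_Ck (Ck_cst k ((delta_mx 0 i : 'rV[R]_n.+1) 0 j)) => p _.
by rewrite /partial; have [_ ->] := is_derive_coord p (delta_mx 0 i) j.
Qed.

Lemma CkD k f g : Ck U k f -> Ck U k g -> Ck U k (fun x => f x + g x).
Proof.
elim: k f g => [|k IH] f g [cf df] [cg dg]; split=> //.
- by move=> p Up; exact: (cvgD (cf p Up) (cg p Up)).
- by move=> p Up; exact: (cvgD (cf p Up) (cg p Up)).
move=> i; have [d1 d2] := df i; have [d3 d4] := dg i; split.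
  by move=> p Up; apply: derivableD; [exact: d1|exact: d3].
apply: eq_Ck (IH _ _ d2 d4) => p Up.
by rewrite /partial -deriveD //; [exact: d1|exact: d3].
Qed.

Lemma CkM k f g : Ck U k f -> Ck U k g -> Ck U k (fun x => f x * g x).
Proof.
elim: k f g => [|k IH] f g Hf Hg; move: (Hf) (Hg) => [cf df] [cg dg]; split=> //.
- by move=> p Up; exact: (cvgM (cf p Up) (cg p Up)).
- by move=> p Up; exact: (cvgM (cf p Up) (cg p Up)).
move=> i; have [d1 d2] := df i; have [d3 d4] := dg i; split.
  by move=> p Up; apply: derivableM; [exact: d1|exact: d3].
apply: eq_Ck (CkD (IH _ _ (CkS Hf) d4) (IH _ _ (CkS Hg) d2)) => p Up.
by rewrite /partial [RHS](deriveM (d1 p Up) (d3 p Up)).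
Qed.

Lemma CkV k f : {in U, forall p, f p != 0} -> Ck U k f ->
  Ck U k (fun x => (f x)^-1).
Proof.
move=> f0; elim: k => [|k IH] Hf; move: (Hf) => [cf df]; split=> //.
- by move=> p Up; exact: (cvgV (f0 p Up) (cf p Up)).
- by move=> p Up; exact: (cvgV (f0 p Up) (cf p Up)).
move=> i; have [d1 d2] := df i; split.
  by move=> p Up; apply: derivableV; [exact: f0|exact: d1].
have {}IH := IH (CkS Hf).
apply: eq_Ck (CkM (Ck_cst k (-1)) (CkM (CkM IH IH) d2)) => p Up.
rewrite /partial [RHS](deriveV (f0 p Up) (d1 p Up)).
by rewrite /GRing.scale /= mulN1r -invfM mulNr.
Qed.

Lemma CkN k f : Ck U k f -> Ck U k (fun x => - f x).
Proof.
move=> Hf; apply: eq_Ck (CkM (Ck_cst k (-1)) Hf) => p _; exact: mulN1r.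
Qed.

Lemma Ck_sum k I (r : seq I) (P : pred I) (F : I -> 'rV[R]_n.+1 -> R) :
  (forall i, P i -> Ck U k (F i)) -> Ck U k (fun x => \sum_(i <- r | P i) F i x).
Proof.
move=> H; elim: r => [|i r IH].
  by apply: eq_Ck (Ck_cst k 0) => p _; rewrite big_nil.
have [Pi|nPi] := boolP (P i).
  by apply: eq_Ck (CkD (H i Pi) IH) => p _; rewrite big_cons Pi.
by apply: eq_Ck IH => p _; rewrite big_cons (negbTE nPi).
Qed.

Lemma Ck_prod k I (r : seq I) (P : pred I) (F : I -> 'rV[R]_n.+1 -> R) :
  (forall i, P i -> Ck U k (F i)) -> Ck U k (fun x => \prod_(i <- r | P i) F i x).
Proof.
move=> H; elim: r => [|i r IH].
  by apply: eq_Ck (Ck_cst k 1) => p _; rewrite big_nil.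
have [Pi|nPi] := boolP (P i).
  by apply: eq_Ck (CkM (H i Pi) IH) => p _; rewrite big_cons Pi.
by apply: eq_Ck IH => p _; rewrite big_cons (negbTE nPi).
Qed.

Lemma CkX k f m : Ck U k f -> Ck U k (fun x => f x ^+ m).
Proof.
move=> Hf; elim: m => [|m IH].
  by apply: eq_Ck (Ck_cst k 1) => p _; rewrite expr0.
by apply: eq_Ck (CkM Hf IH) => p _; rewrite exprS.
Qed.

Lemma Ck_peval k (P : mpoly n.+1 R) : Ck U k (peval P).
Proof.
apply: (@eq_Ck _ (fun x => \sum_(m <- msupp P) mcoeff m P * \prod_i x 0 i ^+ m i)).
  by move=> p _; rewrite /peval mevalE.
apply: Ck_sum => m _; apply: CkM; first exact: Ck_cst.
by apply: Ck_prod => i _; apply: CkX; exact: Ck_coord.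
Qed.

End FixedOpen.

Lemma Ck_comp n m (U : set 'rV[R]_n.+1) (V : set 'rV[R]_m.+1) k
    (f : 'rV[R]_m.+1 -> R) (g : 'rV[R]_n.+1 -> 'rV[R]_m.+1) :
    open U -> open V -> (forall p, U p -> V (g p)) ->
    Ck V k f -> (forall j, Ck U k (fun x => g x 0 j)) ->
  Ck U k (f \o g).
Proof.
move=> Uo Vo UV; elim: k f => [|k IH] f Hf Hg.
all: have cfg : {in U, continuous (f \o g)}
  by (move=> p Up; apply: continuous_comp;
     [apply: continuous_rV => j; exact: (Ck_cont (Hg j))
     |apply: (Ck_cont Hf); move: Up; rewrite !inE; exact: UV]).
all: split=> // i.
have Vg p : p \in U -> g p \in V by rewrite !inE; exact: UV.
have D p : p \in U -> is_derive p (delta_mx 0 i) (f \o g)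
    (\sum_j partial i (fun x => g x 0 j) p * partial j f (g p)).
  move=> Up; apply: is_derive_comp_rV.
  - have := open_near Vo (UV p (set_mem Up)); apply: filterS => x Vx j.
    by have [_ /(_ j)[+ _]] := Hf; apply; rewrite inE.
  - by move=> j; have [_ /(_ j)[_ H]] := Hf; apply: (Ck_cont H); exact: Vg.
  - by move=> j; have [_ /(_ i)[+ _]] := Hg j; exact.
split; first by move=> p Up; apply: ex_derive; exact: D.
apply: (@eq_Ck _ _ Uo k
   (fun p => \sum_j partial i (fun x => g x 0 j) p * partial j f (g p))).
  by move=> p Up; have [_ <-] := D p Up.
apply: Ck_sum => // j _; apply: CkM => //.
  by have [_ /(_ i)[_ +]] := Hg j; exact.
apply: (IH (partial j f)); last by move=> j'; exact: CkS.
by have [_ /(_ j)[_ +]] := Hf; exact.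
Qed.

End Ck.

(** * Smooth germs and the inverse function theorem *)
Section SmoothNear0.
Variable R : realType.

Lemma Ck_iter_partial n (U : set 'rV[R]_n.+1) f :
  (forall k, Ck U k f) -> forall s k, Ck U k (iter_partial s f).
Proof. by move=> Hf; elim=> [|i s IH] k //=; have [_ /(_ i)[]] := IH k.+1. Qed.

(** Smoothness of a germ amounts to being of all classes C^k on one common
    open neighbourhood, where the stability lemmas apply. *)
Lemma smooth_map_near0P n m (f : 'rV[R]_n.+1 -> 'rV[R]_m) :
  smooth_map_near0 f <-> exists U : set 'rV[R]_n.+1,
    [/\ open U, U 0 & forall j k, Ck U k (fun x => f x 0 j)].
Proof.
split=> [H|[U [Uo U0 H]] j]; last first.
  have := open_near Uo U0; apply: filterS => p Up s.
  have Hs k := Ck_iter_partial (H j) s k.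
  split=> [|i]; first by apply: (Ck_cont (Hs 0%N)); rewrite inE.
  by have [_ /(_ i)[+ _]] := Hs 1%N; apply; rewrite inE.
have {}H := filter_forall _ H.
exists (interior [set p | forall j, forall s : seq 'I_n.+1,
    {for p, continuous (iter_partial s (fun x => f x 0 j))} /\
    forall i, derivable (iter_partial s (fun x => f x 0 j)) p (delta_mx 0 i)]).
split; [exact: open_interior | exact: H |].
set U : set 'rV[R]_n.+1 := interior _; move=> j k.
have : {in U, forall p, forall s : seq 'I_n.+1,
    {for p, continuous (iter_partial s (fun x => f x 0 j))} /\
    forall i, derivable (iter_partial s (fun x => f x 0 j)) p (delta_mx 0 i)}.
  by move=> p; rewrite inE => /interior_subset; apply.
move: (fun x => f x 0 j) => {H} h; elim: k h => [|k IH] h Hh; split=> //.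
- by move=> p Up; have [] := Hh p Up [::].
- by move=> p Up; have [] := Hh p Up [::].
move=> i; split; first by move=> p Up; have [_] := Hh p Up [::]; apply.
by apply: IH => p Up s; have := Hh p Up (rcons s i); rewrite /iter_partial foldr_rcons.
Qed.

Lemma smooth_near0P n (f : 'rV[R]_n.+1 -> R) :
  smooth_near0 f <-> exists U : set 'rV[R]_n.+1,
    [/\ open U, U 0 & forall k, Ck U k f].
Proof.
have fE j : (fun x => (const_mx (f x) : 'rV[R]_1) 0 j) = f.
  by apply/funext => x; rewrite mxE.
have [H1 H2] := smooth_map_near0P (fun x => const_mx (f x) : 'rV[R]_1).
split=> [sf|[U [Uo U0 H]]].
  have [|U [Uo U0 H]] := H1; first by move=> j; rewrite fE.
  by exists U; split=> // k; have := H 0 k; rewrite fE.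
by rewrite -(fE 0); apply: H2; exists U; split=> // j k; rewrite fE.
Qed.

End SmoothNear0.

(** Row vectors are both complete and normed; the fixed point theorem asks for
    the join of the two structures. *)
HB.instance Definition _ (R : realType) n := Complete.on 'rV[R]_n.+1.

Section InverseFunction.
Variables (R : realType) (n : nat).
Implicit Types (f : 'rV[R]_n.+1 -> 'rV[R]_n.+1) (M N : 'M[R]_n.+1).

Definition partial_mx f p : 'M[R]_n.+1 :=
  \matrix_(i, j) partial i (fun x => f x 0 j) p.

Lemma norm_mulmx_le (v : 'rV[R]_n.+1) M (b : R) :
  (forall i j, `|M i j| <= b) -> `|v *m M| <= n.+1%:R * b * `|v|.
Proof.
move=> Mb; have b0 : 0 <= b := le_trans (normr_ge0 _) (Mb 0 0).
apply: norm_le_coord => [|j]; first by rewrite !mulr_ge0.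
rewrite mxE (le_trans (ler_norm_sum _ _ _)) //.
apply: (@le_trans _ _ (\sum_(i < n.+1) b * `|v|)).
  by apply: ler_sum => i _; rewrite normrM mulrC ler_pM // coord_le_norm.
by rewrite sumr_const card_ord -mulrA mulr_natl.
Qed.

Lemma entry_bound M : exists2 b : R, 0 < b & forall i j, `|M i j| <= b.
Proof.
exists (1 + \sum_i \sum_j `|M i j|) => [|i j].
  by rewrite ltr_wpDr // sumr_ge0 // => i _; rewrite sumr_ge0.
rewrite (bigD1 i) //= (bigD1 j) //=.
have S1 : 0 <= \sum_(j0 < n.+1 | j0 != j) `|M i j0| by rewrite sumr_ge0.
have S2 : 0 <= \sum_(i0 < n.+1 | i0 != i) \sum_j0 `|M i0 j0|.
  by rewrite sumr_ge0 // => ? _; rewrite sumr_ge0.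
lra.
Qed.

Lemma mean_value_mx f q q' :
    (forall x i j, `|x - q| <= `|q' - q| ->
       derivable (fun x => f x 0 j) x (delta_mx 0 i)) ->
  exists2 c : 'I_n.+1 -> 'I_n.+1 -> 'rV[R]_n.+1,
    forall i j, `|c i j - q| <= `|q' - q| &
    f q' - f q = (q' - q) *m \matrix_(i, j) partial i (fun x => f x 0 j) (c i j).
Proof.
move=> df; have H j : exists c : 'I_n.+1 -> 'rV[R]_n.+1,
    (forall i, `|c i - q| <= `|q' - q|) /\
    f q' 0 j - f q 0 j = \sum_i (q' - q) 0 i * partial i (fun x => f x 0 j) (c i).
  have [c c1 c2] := mean_value_rV (fun x i => df x i j).
  by exists c.
have [c cP] := choice H; exists (fun i j => c j i) => [i j|].
  by have [] := cP j.
apply/rowP => j; rewrite !mxE; have [_ ->] := cP j.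
by apply: eq_bigr => i _; rewrite !mxE.
Qed.

Lemma contraction_fixpoint (X : completeNormedModType R) (U : set X) (T : X -> X) :
  closed U -> U !=set0 -> (forall x, U x -> U (T x)) ->
  (forall x y, U x -> U y -> `|T x - T y| <= 2^-1 * `|x - y|) ->
  exists2 p, U p & p = T p.
Proof.
move=> Uc U0 UT TT; pose T' := mkfun_fun UT.
suff C : is_contraction T' by have := banach_fixed_point C Uc U0.
have h0 : 0 <= 2^-1 :> R by rewrite invr_ge0.
exists (NngNum h0); split; first by rewrite /= invf_lt1 // ltr1n.
by move=> [x y] [/= Ux Uy]; exact: TT.
Qed.

Lemma Ck_det k (W : set 'rV[R]_n.+1) m (M : 'rV[R]_n.+1 -> 'M[R]_m) :
  open W -> (forall i j, Ck W k (fun p => M p i j)) -> Ck W k (fun p => \det (M p)).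
Proof.
move=> Wo HM; rewrite /determinant; apply: Ck_sum => // s _.
apply: CkM => //; first exact: Ck_cst.
by apply: Ck_prod.
Qed.

Lemma Ck_invmx k (W : set 'rV[R]_n.+1) (M : 'rV[R]_n.+1 -> 'M[R]_n.+1) i j :
  open W -> (forall i j, Ck W k (fun p => M p i j)) ->
  {in W, forall p, \det (M p) != 0} -> Ck W k (fun p => invmx (M p) i j).
Proof.
move=> Wo HM M0.
apply: (@eq_Ck _ _ _ Wo _ (fun p => (\det (M p))^-1 * cofactor (M p) j i)).
  by move=> p Wp; rewrite /invmx unitmxE unitfE M0 // !mxE.
apply: CkM => //; first by apply: CkV => //; exact: Ck_det.
rewrite /cofactor; apply: CkM => //; first exact: Ck_cst.
by apply: Ck_det => // i' j'; apply: eq_Ck (HM (lift j i') (lift i j')) => // p _;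
  rewrite !mxE.
Qed.

Lemma Ck_partial_mx k (U : set 'rV[R]_n.+1) f i j :
  (forall j k, Ck U k (fun x => f x 0 j)) -> open U ->
  Ck U k (fun p => partial_mx f p i j).
Proof.
move=> Hf Uo; have [_ /(_ i)[_ H]] := Hf j k.+1.
by apply: eq_Ck H => // p _; rewrite mxE.
Qed.

(** With [A] the Jacobian matrix at 0 (acting on row vectors from the right)
    and [B] its inverse, solving [f p = y] means finding a fixed point of
    [p |-> p - f p *m B + y *m B], a contraction near 0 because its Jacobian
    vanishes at 0.  The local inverse is Lipschitz for the same reason; the
    mean value theorem then shows that its Jacobian matrix is the inverse of
    the one of [f].  Since matrix inversion is a rational operation, the inverse
    is of class C^(k+1) as soon as it is of class C^k. *)
Theorem inverse_function f : smooth_map_near0 f -> f 0 = 0 ->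
  partial_mx f 0 \in unitmx -> local_diffeo0 f.
Proof.
move=> sf f0 uA; split=> //.
have [U [Uo U0 HU]] := (smooth_map_near0P f).1 sf.
set A := partial_mx f 0 in uA; pose B := invmx A.
have [b b0 bB] := entry_bound B.
pose N : R := n.+1%:R; have N0 : 0 < N by rewrite ltr0n.
(* If the partial derivatives vary by at most d, then p |-> p - f p *m B has
   Lipschitz constant N * b * (N * d) = 1/2: each product with a matrix costs a
   factor N times a bound of its entries. *)
pose d := (2 * N ^+ 2 * b)^-1; have d0 : 0 < d by rewrite invr_gt0 !mulr_gt0 ?exprn_gt0.
have dE : N * b * (N * d) = 2^-1.
  rewrite /d; move: (N) N0 => x x0; field.
  by rewrite (gt_eqF x0) (gt_eqF b0).
have cdet : {in U, continuous (fun p => \det (partial_mx f p))}.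
  by apply: (@Ck_cont _ _ _ 0); apply: Ck_det => // i j; exact: Ck_partial_mx.
have nearW : \forall p \near (0 : 'rV[R]_n.+1), U p /\
    \det (partial_mx f p) != 0 /\ forall i j, `|A i j - partial_mx f p i j| <= d.
  have n1 := open_near Uo U0.
  have n2 : \forall p \near (0 : 'rV[R]_n.+1), \det (partial_mx f p) != 0.
    apply: (@cvgr_neq0 _ _ _ (nbhs (0 : 'rV[R]_n.+1)) _ _ _ (cdet 0 (mem_set U0))).
    by move: uA; rewrite unitmxE unitfE.
  have n3 i : \forall p \near (0 : 'rV[R]_n.+1), forall j,
      `|A i j - partial_mx f p i j| <= d.
    have H j : \forall p \near (0 : 'rV[R]_n.+1), `|A i j - partial_mx f p i j| <= d.
      have C := Ck_cont (Ck_partial_mx 0 i j HU Uo) (mem_set U0).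
      by move/cvgrPdist_le: C; apply.
    exact: (filter_forall _ H).
  have {}n3 : \forall p \near (0 : 'rV[R]_n.+1), forall i j,
      `|A i j - partial_mx f p i j| <= d by exact: (filter_forall _ n3).
  by apply: filterS (filterI n1 (filterI n2 n3)) => p [? [? ?]].
have [r r0 rP] : exists2 r : R, 0 < r & forall p : 'rV[R]_n.+1, `|p| < 4 * r -> U p /\
    \det (partial_mx f p) != 0 /\ forall i j, `|A i j - partial_mx f p i j| <= d.
  have /nbhs_ballP[e /= e0 eP] := nearW.
  exists (e / 4) => [|p pe]; first by rewrite divr_gt0.
  apply: eP; rewrite -ball_normE /= sub0r normrN (lt_le_trans pe) //.
  by rewrite mulrCA divff ?mulr1.
(* For q and q' in the ball of radius r, the intermediate points of the mean
   value theorem stay in the ball of radius 3 r. *)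
have near4 (q q' x : 'rV[R]_n.+1) : `|q| <= r -> `|q'| <= r -> `|x - q| <= `|q' - q| -> `|x| < 4 * r.
  move=> qr qr' xq; rewrite -(subrK q x) (le_lt_trans (ler_normD _ _)) //.
  have := ler_normB q' q; have := r0; lra.
have MV (q q' : 'rV[R]_n.+1) : `|q| <= r -> `|q'| <= r -> exists2 c : 'I_n.+1 -> 'I_n.+1 -> 'rV[R]_n.+1,
    forall i j, `|c i j - q| <= `|q' - q| &
    f q' - f q = (q' - q) *m \matrix_(i, j) partial i (fun x => f x 0 j) (c i j).
  move=> qr qr'; apply: mean_value_mx => x i j xq.
  have [_ /(_ i)[+ _]] := HU j 1%N; apply; rewrite inE.
  by have [] := rP x (near4 q q' _ qr qr' xq).
have AB : A *m B = 1%:M by rewrite mulmxV.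
have contr (q q' : 'rV[R]_n.+1) : `|q| <= r -> `|q'| <= r ->
    `|(q' - f q' *m B) - (q - f q *m B)| <= 2^-1 * `|q' - q|.
  move=> qr qr'; have [c c1 c2] := MV q q' qr qr'.
  set M := (X in _ *m X) in c2.
  have -> : (q' - f q' *m B) - (q - f q *m B) = (q' - q) *m (A - M) *m B.
    rewrite -mulmxA [(A - M) *m B]mulmxBl AB mulmxBr mulmx1 mulmxA -c2 mulmxBl.
    by rewrite !opprD !opprK addrACA.
  apply: le_trans (norm_mulmx_le _ bB) _.
  have le1 : `|(q' - q) *m (A - M)| <= N * d * `|q' - q|.
    apply: norm_mulmx_le => i j; rewrite !mxE.
    have [_ [_ /(_ i j)]] := rP _ (near4 q q' _ qr qr' (c1 i j)).
    by rewrite !mxE.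
  apply: le_trans (ler_wpM2l _ le1) _; first by rewrite mulr_ge0 // ltW.
  by rewrite -/N mulrA dE.
have lip (q q' : 'rV[R]_n.+1) : `|q| <= r -> `|q'| <= r -> `|q' - q| <= 2 * `|(f q' - f q) *m B|.
  move=> qr qr'; have := contr q q' qr qr'.
  have := ler_normD ((q' - f q' *m B) - (q - f q *m B)) ((f q' - f q) *m B).
  have -> : (q' - f q' *m B) - (q - f q *m B) + (f q' - f q) *m B = q' - q.
    rewrite mulmxBl; move: (f q' *m B) (f q *m B) => F' F.
    by apply/rowP => k; rewrite !mxE; ring.
  lra.
have ex_inv (y : 'rV[R]_n.+1) : exists p : 'rV[R]_n.+1, `|y *m B| < r / 2 -> f p = y /\ `|p| <= 2 * `|y *m B|.
  have [yr|] := pselect (`|y *m B| < r / 2); last by exists 0.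
  have [||||p pr pE] := @contraction_fixpoint 'rV[R]_n.+1
      [set p | `|p| <= r] (fun p => p - f p *m B + y *m B).
  - have -> : [set p : 'rV[R]_n.+1 | `|p| <= r] = closed_ball 0 r.
      by rewrite closed_ballE //; apply/seteqP; split=> x /=;
        rewrite /closed_ball_ /= sub0r normrN.
    exact: closed_ball_closed.
  - by exists 0 => /=; rewrite normr0 ltW.
  - move=> p /= pr; have := @contr 0 p; rewrite normr0 f0 mul0mx !subr0.
    move=> /(_ (ltW r0) pr) le1; apply: (le_trans (ler_normD _ _)).
    have := pr; lra.
  - move=> x y' /= xr yr'; rewrite opprD addrACA subrr addr0; exact: contr.
  exists p => _; have fpy : f p = y.
    have : f p *m B = y *m B.
      move: pE; move: (f p *m B) (y *m B) => u w E; apply: (@addIr _ (p - u)).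
      by rewrite subrKC [in LHS]E addrC.
    move=> /(congr1 (fun z => z *m A)).
    by rewrite -!mulmxA mulVmx // !mulmx1.
  split=> //; have := @lip 0 p; rewrite normr0 f0 !subr0 fpy; apply=> //.
  exact: ltW.
have [g gP] := choice ex_inv.
pose V := [set y : 'rV[R]_n.+1 | `|y *m B| < r / 2].
have cB : continuous (fun y : 'rV[R]_n.+1 => y *m B).
  move=> y; apply: continuous_rV => j.
  apply: (@Ck_cont _ _ setT 0); last by rewrite inE.
  apply: (@eq_Ck _ _ _ openT _ (fun y => \sum_i y 0 i * B i j)).
    by move=> p _; rewrite mxE.
  apply: Ck_sum => [|i _]; first exact: openT.
  exact: (CkM openT (Ck_coord openT 0 i) (Ck_cst openT 0 (B i j))).
have Vo : open V.
  rewrite (_ : V = (fun y => `|y *m B|) @^-1` [set t | t < r / 2]) //.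
  apply: open_comp (@open_lt R _) => y _ /=.
  by apply: continuous_comp (cB y) _; exact: norm_continuous.
have gV y : V y -> [/\ f (g y) = y, `|g y| <= 2 * `|y *m B| & `|g y| <= r].
  move=> Vy; have [-> le2] := gP y Vy; split=> //.
  by move: Vy; rewrite /V /=; lra.
have V0 : V 0 by rewrite /V /= mul0mx normr0 divr_gt0.
have g0 : g 0 = 0.
  have [_ + _] := gV 0 V0; rewrite mul0mx normr0 mulr0 normr_le0.
  by move/eqP.
have fgV y y' : V y -> V y' -> `|g y' - g y| <= 2 * `|(y' - y) *m B|.
  move=> /gV[E _ yr] /gV[E' _ yr']; rewrite -{2}E -{2}E'; exact: lip.
pose N' : R := 2 * N * b; have N'0 : 0 < N' by rewrite !mulr_gt0.
have fgV' y y' : V y -> V y' -> `|g y' - g y| <= N' * `|y' - y|.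
  move=> Vy Vy'; apply: le_trans (fgV _ _ Vy Vy') _.
  by rewrite /N' -2!mulrA ler_wpM2l // mulrA norm_mulmx_le.
have cg y : V y -> {for y, continuous g}.
  move=> Vy; apply: (cvgrPdist_le (F := nbhs y) g (g y)).2 => e e0.
  have eN : 0 < e / N' by rewrite divr_gt0.
  have n1 := open_near Vo Vy; have n2 := near_ball (y : 'rV[R]_n.+1) _ eN.
  have n12 : \forall y' \near y, V y' /\ ball y (e / N') y' by exact: filterI n1 n2.
  apply: (filterS _ n12) => y' [Vy'].
  rewrite -ball_normE /= distrC => yy'; rewrite distrC.
  by apply: (le_trans (fgV' _ _ Vy Vy')); rewrite -ler_pdivlMl // mulrC ltW.
pose W := [set p : 'rV[R]_n.+1 | `|p| < 4 * r].
have Wo : open W.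
  rewrite (_ : W = (fun p => `|p|) @^-1` [set t | t < 4 * r]) //.
  by apply: open_comp (@open_lt R _) => p _ /=; exact: norm_continuous.
have WU : W `<=` U by move=> p /rP[].
have gW y : V y -> W (g y).
  by move=> /gV[_ _ gr]; rewrite /W /= (le_lt_trans gr) //; have := r0; lra.
have dg i j y : V y -> is_derive y (delta_mx 0 i) (fun x => g x 0 j)
    (invmx (partial_mx f (g y)) i j).
  move=> Vy; set p := g y; set Q := invmx _.
  have [pU [detp _]] := rP p (gW _ Vy).
  have uJ : partial_mx f p \in unitmx by rewrite unitmxE unitfE.
  have [q0 q0_gt0 qB] := entry_bound Q.
  suff L : h^-1 *: (g (h *: delta_mx 0 i + y) 0 j - g y 0 j) @[h --> 0^'] --> Q i j.
    by split; [apply/cvg_ex; eexists; exact: L | exact: cvg_lim L].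
  apply/cvgrPdist_le => e e0.
  pose e' := e / (N * q0 * (N * N')).
  have e'0 : 0 < e' by rewrite divr_gt0 // !mulr_gt0.
  have nearJ : \forall x \near p, forall i j,
      `|partial_mx f p i j - partial_mx f x i j| <= e'.
    have H i1 j1 : \forall x \near p, `|partial_mx f p i1 j1 - partial_mx f x i1 j1| <= e'.
      have C := Ck_cont (Ck_partial_mx 0 i1 j1 HU Uo) (mem_set pU).
      by move/cvgrPdist_le: C; apply.
    have H' i1 : \forall x \near p, forall j1,
      `|partial_mx f p i1 j1 - partial_mx f x i1 j1| <= e' by exact: (filter_forall _ (H i1)).
    exact: (filter_forall _ H').
  have /nbhs_ballP[s /= s0 sP] := nearJ.
  have yh : (h *: delta_mx 0 i + y : 'rV[R]_n.+1) @[h --> (0:R)^'] --> y.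
    rewrite -[X in _ --> X]add0r; apply: cvgD; last exact: cvg_cst.
    rewrite -(scale0r (delta_mx 0 i : 'rV[R]_n.+1)); apply: cvgZr_tmp.
    exact: cvg_within.
  have gyh : g (h *: delta_mx 0 i + y : 'rV[R]_n.+1) @[h --> (0:R)^'] --> p.
    exact: (cvg_comp _ _ yh (cg y Vy)).
  have nV : \forall h \near (0 : R)^', V (h *: delta_mx 0 i + y).
    exact: (yh _ (open_near Vo Vy)).
  have ns : \forall h \near (0 : R)^', `|g (h *: delta_mx 0 i + y) - p| < s.
    by move/cvgrPdist_lt: gyh => /(_ s s0); apply: filterS => h; rewrite distrC.
  near=> h.
  have h0 : h != 0 by near: h; exact: nbhs_dnbhs_neq.
  set y' := h *: delta_mx 0 i + y; set q := g y'.
  have Vy' : V y' by rewrite /y'; near: h.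
  have qs : `|q - p| < s.
    by rewrite /q /y'; near: h.
  have [_ _ pr] := gV _ Vy; have [fq _ qr] := gV _ Vy'.
  have [c c1 c2] := MV p q pr qr.
  set M := (X in _ *m X) in c2.
  have [fp _ _] := gV _ Vy.
  have dy : y' - y = h *: delta_mx 0 i by rewrite /y' addrK.
  (* The mean value theorem gives q - p only up to the variation of the Jacobian
     matrix between p and the intermediate points. *)
  have E : (q - p) = h *: delta_mx 0 i *m Q + (q - p) *m (partial_mx f p - M) *m Q.
    rewrite -dy -fq -fp -/p -/q c2 -mulmxDl -mulmxDr subrKC.
    by rewrite -mulmxA mulmxV // mulmx1.
  have lhs : Q i j - h^-1 *: (q 0 j - p 0 j) =
      - h^-1 * ((q - p) *m (partial_mx f p - M) *m Q) 0 j.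
    have := congr1 (fun z : 'rV[R]_n.+1 => z 0 j) E.
    rewrite -scalemxAl -rowE !mxE /= => ->; rewrite /GRing.scale /=.
    by rewrite mulrDr mulrA mulVf // mul1r opprD addrA subrr add0r mulNr.
  rewrite -/p -/y' -/q lhs normrM normrN normfV.
  have hp : 0 < `|h| by rewrite normr_gt0.
  rewrite ler_pdivrMl //; apply: le_trans (coord_le_norm _ _) _.
  apply: le_trans (norm_mulmx_le _ qB) _.
  have le1 : `|(q - p) *m (partial_mx f p - M)| <= N * e' * `|q - p|.
    apply: norm_mulmx_le => i1 j1.
    have := sP (c i1 j1) _ i1 j1; rewrite -ball_normE /= !mxE; apply.
    by rewrite distrC (le_lt_trans (c1 i1 j1)).
  have le2 : `|q - p| <= N' * `|h|.
    have := fgV' _ _ Vy Vy'; rewrite dy => /le_trans; apply.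
    rewrite ler_wpM2l ?(ltW N'0) // normrZ ler_piMr //.
    apply: norm_le_coord => // k; rewrite mxE eqxx /=.
    by case: eqP => _; rewrite ?normr1 ?normr0.
  have Nq0 : 0 <= N * q0 by rewrite mulr_ge0 // ltW.
  apply: le_trans (ler_wpM2l Nq0 le1) _.
  have Ne' : 0 <= N * e' by rewrite mulr_ge0 // ltW.
  apply: le_trans (ler_wpM2l Nq0 (ler_wpM2l Ne' le2)) _.
  rewrite le_eqVlt; apply/orP; left; apply/eqP; rewrite /e'.
  move: (N) N0 (N') N'0 (`|h|) => x x0 x' x'0 z; field.
  by rewrite (gt_eqF x0) (gt_eqF x'0) (gt_eqF q0_gt0).
have Ckg k j : Ck V k (fun y => g y 0 j).
  elim: k j => [|k IH] j; split=> //.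
  - move=> y /set_mem Vy; apply: (@continuous_comp _ _ _ g (fun x : 'rV[R]_n.+1 => x 0 j)).
      exact: cg.
    exact: coord_continuous.
  - move=> y /set_mem Vy; apply: (@continuous_comp _ _ _ g (fun x : 'rV[R]_n.+1 => x 0 j)).
      exact: cg.
    exact: coord_continuous.
  move=> i; split; first by move=> y /set_mem Vy; apply: ex_derive; exact: dg.
  apply: (@eq_Ck _ _ _ Vo _ ((fun p => invmx (partial_mx f p) i j) \o g)).
    by move=> y /set_mem Vy; rewrite /partial; have [_ ->] := dg i j y Vy.
  apply: (Ck_comp Vo Wo gW) IH; apply: Ck_invmx => //.
    by move=> i1 j1; apply: Ck_sub WU _; exact: Ck_partial_mx.
  by move=> p /set_mem /rP[_ []].
exists g; split.
- by apply/smooth_map_near0P; exists V; split.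
- exact: g0.
- have cf : {for (0 : 'rV[R]_n.+1), continuous f}.
    by apply: continuous_rV => j; apply: (Ck_cont (HU j 0%N)); rewrite inE.
  have n1 : \forall p \near (0 : 'rV[R]_n.+1), V (f p).
    by apply: cf; rewrite f0; exact: open_near.
  have n2 : \forall p \near (0 : 'rV[R]_n.+1), `|p| <= r.
    have := nbhsx_ballx (0 : 'rV[R]_n.+1) _ r0; apply: filterS => p.
    by rewrite -ball_normE /= sub0r normrN => /ltW.
  apply: filterS2 n1 n2 => p Vfp pr; have [fg _ gr] := gV _ Vfp.
  apply/subr0_eq/eqP; rewrite -normr_le0; apply: le_trans (lip _ _ pr gr) _.
  by rewrite fg subrr mul0mx normr0 mulr0.
- by have := open_near Vo V0; apply: filterS => y /gV[].
Unshelve. all: by end_near. Qed.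

End InverseFunction.

(** * Weighted orders of vanishing *)
Section WeightedOrder.
Variables (R : realType) (n : nat) (ws : seq nat).
Hypothesis ws_gt0 : forall i : 'I_n.+1, (0 < nth 0 ws i)%N.
Implicit Types (f g : 'rV[R]_n.+1 -> R) (v : 'rV[R]_n.+1) (P : mpoly n.+1 R).

(** The dilation [wdil ws t] multiplies the i-th coordinate by [t ^+ ws`_i], so
    this says that [f] vanishes to weighted order [k].  Unlike the pointwise
    remainder of a weighted jet, the bound is uniform in the direction [v],
    which makes the notion stable under nonlinear substitutions. *)
Definition wbigO k f : Prop :=
  exists C : R, \forall t \near (0 : R),
    forall v, (forall i, `|v 0 i| <= 1) -> `|f (wdil ws t v)| <= C * `|t| ^+ k.

Lemma near_abs_lt (e : R) : 0 < e -> \forall t \near (0 : R), `|t| < e.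
Proof.
move=> e0; have := nbhsx_ballx (0 : R) _ e0; apply: filterS => t.
by rewrite -ball_normE /= sub0r normrN.
Qed.

Lemma wbigOP k f : wbigO k f -> exists C : R, 1 <= C /\ \forall t \near (0 : R),
    forall v, (forall i, `|v 0 i| <= 1) -> `|f (wdil ws t v)| <= C * `|t| ^+ k.
Proof.
move=> [C HC]; exists (Num.max 1 C); split; first by rewrite le_max lexx.
apply: filterS HC => t H v v1; apply: le_trans (H v v1) _.
by rewrite ler_wpM2r ?exprn_ge0 // le_max lexx orbT.
Qed.

Lemma wdil_small (e : R) : 0 < e -> \forall t \near (0 : R),
  forall v, (forall i, `|v 0 i| <= 1) -> `|wdil ws t v| < e.
Proof.
move=> e0; have e20 : 0 < e / 2 by rewrite divr_gt0.
near=> t => v v1.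
have t1 : `|t| <= 1 by apply: ltW; near: t; exact: near_abs_lt.
have te : `|t| <= e / 2 by apply: ltW; near: t; exact: near_abs_lt.
apply: (@le_lt_trans _ _ (e / 2)); last by rewrite ltr_pdivrMr // ltr_pMr // ltr1n.
apply: norm_le_coord => [|i]; first exact: ltW.
rewrite mxE normrM normrX -[leRHS]mulr1 ler_pM ?exprn_ge0 //.
apply: le_trans te; rewrite -[leRHS]expr1.
by apply: ler_wiXn2l => //; exact: ws_gt0.
Unshelve. all: by end_near. Qed.

Lemma wdil_near (A : set 'rV[R]_n.+1) : (\forall p \near (0 : 'rV[R]_n.+1), A p) ->
  \forall t \near (0 : R), forall v, (forall i, `|v 0 i| <= 1) -> A (wdil ws t v).
Proof.
move=> /nbhs_ballP[e /= e0 eA]; apply: filterS (wdil_small e0) => t H v v1.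
by apply: eA; rewrite -ball_normE /= sub0r normrN; exact: H.
Qed.

Lemma wbigO_near k f g : (\forall p \near (0 : 'rV[R]_n.+1), f p = g p) ->
  wbigO k f -> wbigO k g.
Proof.
move=> /wdil_near fg [C HC]; exists C; apply: filterS2 fg HC => t E H v v1.
by rewrite -E //; exact: H.
Qed.

Lemma wbigO_ext k f g : f =1 g -> wbigO k f -> wbigO k g.
Proof. by move=> /funext ->. Qed.

Lemma wbigO_le k k' f : (k <= k')%N -> wbigO k' f -> wbigO k f.
Proof.
move=> kk' /wbigOP[C [C1 HC]]; exists C.
near=> t => v v1; have H : `|f (wdil ws t v)| <= C * `|t| ^+ k'.
  by move: v v1; near: t.
apply: le_trans H _; rewrite ler_wpM2l ?(le_trans ler01) // ler_wiXn2l //.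
Unshelve. all: by end_near. Qed.

Lemma wbigO_cst (c : R) : wbigO 0 (fun=> c).
Proof. by exists `|c|; near=> t; move=> v _; rewrite expr0 mulr1.
Unshelve. all: by end_near. Qed.

Lemma wbigO0 k : wbigO k (fun=> 0).
Proof. by exists 0; near=> t; move=> v _; rewrite normr0 mul0r.
Unshelve. all: by end_near. Qed.

Lemma wbigOD k f g : wbigO k f -> wbigO k g -> wbigO k (fun p => f p + g p).
Proof.
move=> [C HC] [D HD]; exists (C + D); apply: filterS2 HC HD => t H H' v v1.
by rewrite mulrDl (le_trans (ler_normD _ _)) // lerD ?H ?H'.
Qed.

Lemma wbigON k f : wbigO k f -> wbigO k (fun p => - f p).
Proof.
by move=> [C HC]; exists C; apply: filterS HC => t H v v1; rewrite normrN H.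
Qed.

Lemma wbigOB k f g : wbigO k f -> wbigO k g -> wbigO k (fun p => f p - g p).
Proof. by move=> Hf Hg; apply: wbigOD => //; exact: wbigON. Qed.

Lemma wbigOM k k' f g : wbigO k f -> wbigO k' g -> wbigO (k + k') (fun p => f p * g p).
Proof.
move=> [C HC] [D HD]; exists (C * D); apply: filterS2 HC HD => t H H' v v1.
by rewrite normrM exprD mulrACA ler_pM ?H ?H'.
Qed.

Lemma wbigO_sum k I (r : seq I) (A : pred I) (F : I -> 'rV[R]_n.+1 -> R) :
  (forall i, A i -> wbigO k (F i)) -> wbigO k (fun p => \sum_(i <- r | A i) F i p).
Proof.
move=> H; elim: r => [|i r IH].
  by apply: wbigO_ext (wbigO0 k) => p; rewrite big_nil.
have [Ai|nAi] := boolP (A i).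
  by apply: wbigO_ext (wbigOD (H i Ai) IH) => p; rewrite big_cons Ai.
by apply: wbigO_ext IH => p; rewrite big_cons (negbTE nAi).
Qed.

Lemma wbigO_sumP k (T : eqType) (r : seq T) (F : T -> 'rV[R]_n.+1 -> R) :
  (forall i, i \in r -> wbigO k (F i)) -> wbigO k (fun p => \sum_(i <- r) F i p).
Proof.
move=> H; apply: wbigO_ext (wbigO_sum r (A := mem r) H) => p.
by rewrite [RHS]big_seq.
Qed.

Lemma wbigO_coord (i : 'I_n.+1) : wbigO (nth 0%N ws i) (fun p => p 0 i).
Proof.
exists 1; near=> t; move=> v v1.
by rewrite mxE normrM normrX mulrC ler_wpM2r ?exprn_ge0.
Unshelve. all: by end_near. Qed.

(** Perturbing factors of orders [a i] by terms that vanish [e] orders faster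
    perturbs their product by a term that vanishes [e] orders faster. *)
Lemma wbigO_prod_diff e I (r : seq I) (a : I -> nat) (F G : I -> 'rV[R]_n.+1 -> R) :
  (forall i, wbigO (a i) (G i)) -> (forall i, wbigO (a i + e) (fun p => F i p - G i p)) ->
  wbigO (\sum_(i <- r) a i) (fun p => \prod_(i <- r) G i p) /\
  wbigO (\sum_(i <- r) a i + e) (fun p => \prod_(i <- r) F i p - \prod_(i <- r) G i p).
Proof.
move=> HG HF; have HF' i : wbigO (a i) (F i).
  apply: wbigO_ext (wbigOD (HG i) (wbigO_le (leq_addr e _) (HF i))) => p.
  by rewrite addrC subrK.
elim: r => [|i r [IH1 IH2]].
  split; rewrite big_nil.
    by apply: wbigO_ext (wbigO_cst 1) => p; rewrite big_nil.
  by apply: wbigO_ext (wbigO0 _) => p; rewrite !big_nil subrr.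
rewrite big_cons; split.
  by apply: wbigO_ext (wbigOM (HG i) IH1) => p; rewrite big_cons.
have H1 := wbigOM (HF' i) IH2; have H2 := wbigOM (HF i) IH1.
rewrite addnA in H1; rewrite addnAC in H2.
by apply: wbigO_ext (wbigOD H1 H2) => p; rewrite !big_cons; ring.
Qed.

Lemma wbigO_pow_diff e a m (F G : 'rV[R]_n.+1 -> R) :
  wbigO a G -> wbigO (a + e) (fun p => F p - G p) ->
  wbigO (a * m) (fun p => G p ^+ m) /\
  wbigO (a * m + e) (fun p => F p ^+ m - G p ^+ m).
Proof.
move=> HG HF; have [] := @wbigO_prod_diff e _ (iota 0 m) (fun=> a) (fun=> F) (fun=> G).
- by [].
- by [].
rewrite big_const_seq count_predT size_iota iter_addn_0 => H1 H2; split.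
  apply: wbigO_ext H1 => p.
  by rewrite big_const_seq count_predT size_iota -Monoid.iteropE.
apply: wbigO_ext H2 => p.
by rewrite !big_const_seq count_predT size_iota -!Monoid.iteropE.
Qed.

Lemma wbigO_mono_diff e n' ws' (m : multinom n'.+1) (G H : 'I_n'.+1 -> 'rV[R]_n.+1 -> R) :
  (forall i : 'I_n'.+1, wbigO (nth 0%N ws' i) (H i)) ->
  (forall i : 'I_n'.+1, wbigO (nth 0%N ws' i + e) (fun p => G i p - H i p)) ->
  wbigO (weight ws' m) (fun p => \prod_i H i p ^+ m i) /\
  wbigO (weight ws' m + e) (fun p => \prod_i G i p ^+ m i - \prod_i H i p ^+ m i).
Proof.
move=> HH HG; apply: wbigO_prod_diff => i.
  by have [] := wbigO_pow_diff (m i) (HH i) (HG i).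
by have [] := wbigO_pow_diff (m i) (HH i) (HG i).
Qed.

Lemma wbigO_peval k P : (forall m, m \in msupp P -> (k <= weight ws m)%N) ->
  wbigO k (peval P).
Proof.
move=> H; rewrite /peval.
apply: (@wbigO_ext _ (fun p => \sum_(m <- msupp P) mcoeff m P * \prod_i p 0 i ^+ m i)).
  by move=> p; rewrite mevalE.
apply: wbigO_sumP => m /H km; apply: wbigO_le km _.
apply: (wbigOM (wbigO_cst _)).
have [||//] := @wbigO_mono_diff 0 n ws m (fun i p => p 0 i) (fun i p => p 0 i).
  exact: wbigO_coord.
by move=> i; apply: wbigO_ext (wbigO0 _) => p; rewrite subrr.
Qed.

(** This controls the effect on a polynomial of a change of variables that is
    close to a given one: if every component moves by [e] more than its weight,
    then terms of weight at least [k] move by terms of order [k + e]. *)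
Lemma wbigO_peval_comp e k n' ws' (P : mpoly n'.+1 R) (G H : 'rV[R]_n.+1 -> 'rV[R]_n'.+1) :
  (forall i : 'I_n'.+1, wbigO (nth 0%N ws' i) (fun p => H p 0 i)) ->
  (forall i : 'I_n'.+1, wbigO (nth 0%N ws' i + e) (fun p => G p 0 i - H p 0 i)) ->
  (forall m, m \in msupp P -> (k <= weight ws' m)%N) ->
  wbigO (k + e) (fun p => peval P (G p) - peval P (H p)).
Proof.
move=> HH HG HP; rewrite /peval.
apply: (@wbigO_ext _ (fun p => \sum_(m <- msupp P) mcoeff m P *
    (\prod_i G p 0 i ^+ m i - \prod_i H p 0 i ^+ m i))).
  by move=> p; rewrite !mevalE -sumrB; apply: eq_bigr => m _; rewrite mulrBr.
apply: wbigO_sumP => m /HP km.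
have [_ H2] := @wbigO_mono_diff e n' ws' m (fun i p => G p 0 i) (fun i p => H p 0 i) HH HG.
by have := wbigOM (wbigO_cst (mcoeff m P)) H2; apply: wbigO_le; rewrite leq_add2r.
Qed.

End WeightedOrder.

(** If every component of [h] vanishes to the order of the corresponding weight,
    then [h (wdil ws t v)] is a point of the dilated unit box with ratio
    [E * t], for one constant [E]. *)
Lemma wbigO_comp (R : realType) n n' ws ws' k (f : 'rV[R]_n'.+1 -> R)
    (h : 'rV[R]_n.+1 -> 'rV[R]_n'.+1) :
  (forall i : 'I_n'.+1, (0 < nth 0 ws' i)%N) ->
  wbigO ws' k f -> (forall j : 'I_n'.+1, wbigO ws (nth 0%N ws' j) (fun p => h p 0 j)) ->
  wbigO ws k (f \o h).
Proof.
move=> ws'0 /wbigOP[C [C1 HC]] Hh.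
have {}Hh j := wbigOP (Hh j); have {Hh}[D HD] := choice Hh.
pose E := \sum_j D j.
have D1 j : 1 <= D j by have [] := HD j.
have DE j : D j <= E.
  by rewrite /E (bigD1 j) //= lerDl sumr_ge0 // => i _; rewrite (le_trans ler01).
have E1 : 1 <= E := le_trans (D1 0) (DE 0).
have E0 : 0 < E := lt_le_trans ltr01 E1.
exists (C * E ^+ k).
have HD' : \forall t \near (0 : R), forall j (v : 'rV[R]_n.+1), (forall i, `|v 0 i| <= 1) ->
    `|h (wdil ws t v) 0 j| <= D j * `|t| ^+ nth 0%N ws' j.
  have H j : \forall t \near (0 : R), forall v : 'rV[R]_n.+1, (forall i, `|v 0 i| <= 1) ->
    `|h (wdil ws t v) 0 j| <= D j * `|t| ^+ nth 0%N ws' j by have [] := HD j.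
  exact: (filter_forall _ H).
have HC' : \forall t \near (0 : R), forall v : 'rV[R]_n'.+1, (forall i, `|v 0 i| <= 1) ->
    `|f (wdil ws' (E * t) v)| <= C * `|E * t| ^+ k.
  have cE : E * t @[t --> (0 : R)] --> (0 : R).
    rewrite -[X in _ --> X](mulr0 E).
    by apply: cvgM; [exact: cvg_cst | exact: cvg_id].
  exact: (cE _ HC).
apply: filterS2 HD' HC' => t HD' HC' v v1.
rewrite -mulrA -exprMn -[E in leRHS](ger0_norm (ltW E0)) -normrM.
pose u : 'rV[R]_n'.+1 := \row_j (h (wdil ws t v) 0 j / (E * t) ^+ nth 0%N ws' j).
have -> : (f \o h) (wdil ws t v) = f (wdil ws' (E * t) u).
  rewrite /=; congr f; apply/rowP => j; rewrite !mxE.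
  have [t0|t0] := eqVneq t 0.
    have := HD' j v v1; rewrite t0 normr0 mulr0 !expr0n -leqn0 leqNgt ws'0 /=.
    by rewrite mulr0 normr_le0 mul0r => /eqP ->.
  by rewrite mulrCA mulfV ?mulr1 // expf_neq0 // mulf_neq0 ?(gt_eqF E0).
apply: HC' => j; rewrite mxE normrM normfV normrX.
have [t0|t0] := eqVneq t 0.
  by rewrite t0 mulr0 normr0 expr0n -leqn0 leqNgt ws'0 /= invr0 mulr0.
have Et : 0 < `|E * t| by rewrite normr_gt0 mulf_neq0 ?(gt_eqF E0).
rewrite ler_pdivrMr ?exprn_gt0 // mul1r; apply: le_trans (HD' j v v1) _.
rewrite normrM exprMn ler_wpM2r ?exprn_ge0 // (ger0_norm (ltW E0)).
apply: le_trans (DE j) _; rewrite -[leLHS]expr1.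
by apply: ler_weXn2l => //; exact: ws'0.
Qed.

(** * Polynomials are determined by their germs *)
Section Uniqueness.
Variables (R : realType).

Lemma poly_small_coef (q : {poly R}) l :
  (forall e : R, 0 < e -> \forall t \near (0 : R)^', `|q.[t]| <= e * `|t| ^+ l) ->
  forall k, (k <= l)%N -> q`_k = 0.
Proof.
move=> Hq k; have [m] := ubnP k; elim: m k => // m IH k km kl.
apply/eqP/contraT => qk0; pose q' := drop_poly k q.
have qE t : q.[t] = q'.[t] * t ^+ k.
  rewrite -{1}(poly_take_drop k q) [take_poly k q](_ : _ = 0) ?add0r ?hornerE //.
  apply/polyP => i; rewrite coef_take_poly coef0; case: ifP => // ik.
  by apply: IH; [exact: leq_trans ik _|exact: leq_trans (ltnW ik) kl].
have q'0 : q'.[0] = q`_k by rewrite horner_coef0 coef_drop_poly.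
have e0 : 0 < `|q`_k| / 2 by rewrite divr_gt0 // normr_gt0.
have n1 : \forall t \near (0 : R)^', `|q`_k| / 2 < `|q'.[t]|.
  have cq : q'.[t] @[t --> (0 : R)^'] --> q`_k.
    have C : q'.[t] @[t --> (0 : R)] --> q'.[0] by exact: continuous_horner.
    by rewrite -q'0; apply: cvg_trans C; apply: cvg_app; exact: cvg_within.
  move/cvgrPdist_lt: cq => /(_ _ e0); apply: filterS => t H.
  by have := ler_normD (q`_k - q'.[t]) q'.[t]; rewrite subrK; move: H; lra.
have n3 : \forall t \near (0 : R)^', `|t| < 1.
  by apply: cvg_within; exact: near_abs_lt.
have : \forall t \near (0 : R)^', False.
  near=> t.
  have t0 : t != 0 by near: t; exact: nbhs_dnbhs_neq.
  have tp : 0 < `|t| ^+ k by rewrite exprn_gt0 ?normr_gt0.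
  have H1 : `|q`_k| / 2 < `|q'.[t]| by near: t.
  have H2 : `|q.[t]| <= `|q`_k| / 2 * `|t| ^+ l by near: t; exact: Hq.
  have H3 : `|t| <= 1 by apply: ltW; near: t.
  have {}H2 : `|q'.[t]| <= `|q`_k| / 2 * `|t| ^+ (l - k).
    by rewrite -(ler_pM2r tp) -[leRHS]mulrA -exprD subnK // -normrX -normrM -qE.
  have := lt_le_trans H1 H2.
  by rewrite ltNge ler_piMr ?(ltW e0) // exprn_ile1.
by move=> /filter_ex[].
Unshelve. all: by end_near. Qed.

(** Uniqueness of the expansion in base [B].  It turns distinct monomials with
    exponents below [B] into distinct powers of one variable. *)
Lemma kronecker_inj n (B : nat) (f g : 'I_n -> nat) :
  (forall i, f i < B)%N -> (forall i, g i < B)%N ->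
  (\sum_i f i * B ^ i = \sum_i g i * B ^ i)%N -> f =1 g.
Proof.
elim: n f g => [|n IH] f g fB gB E; first by case.
have B0 : (0 < B)%N by apply: leq_ltn_trans (fB ord0).
have S (h : 'I_n.+1 -> nat) : (\sum_i h i * B ^ i =
    (\sum_(i < n) h (lift ord0 i) * B ^ i) * B + h ord0)%N.
  rewrite big_ord_recl expn0 muln1 addnC; congr addn.
  rewrite big_distrl /=; apply: eq_bigr => i _.
  by rewrite /bump /= add1n expnSr mulnA.
rewrite !S in E.
have E0 : f ord0 = g ord0.
  by have := congr1 (modn^~ B) E; rewrite /= !modnMDl !modn_small.
have E1 : f \o lift ord0 =1 g \o lift ord0.
  apply: IH => [i|i|]; [exact: fB|exact: gB|].
  by have := congr1 (divn^~ B) E; rewrite /= !divnMDl // !divn_small // !addn0.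
by move=> i; case: (unliftP ord0 i) => [j ->|->] //; exact: E1.
Qed.

(** Kronecker substitution: the i-th variable is replaced by [t ^+ (B ^ i)] with
    [B] above all exponents, which reduces the claim to one variable. *)
Lemma peval_eq0 n (P : mpoly n R) : (forall v, peval P v = 0) -> P = 0.
Proof.
move=> P0; pose B := (\max_(m <- msupp P) \max_i m i).+1.
have mB m i : m \in msupp P -> (m i < B)%N.
  move=> mP; rewrite ltnS (leq_trans (leq_bigmax i)) //.
  by rewrite (big_rem m mP) /= leq_maxl.
pose K (m : multinom n) := (\sum_i m i * B ^ i)%N.
pose q : {poly R} := \sum_(m <- msupp P) mcoeff m P *: 'X^(K m).
have q0 t : q.[t] = 0.
  rewrite -(P0 (\row_i t ^+ (B ^ i))) /peval mevalE horner_sum.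
  apply: eq_bigr => m _; rewrite hornerZ hornerXn; congr (_ * _).
  rewrite expr_sum; apply: eq_bigr => i _.
  by rewrite mxE -exprM mulnC.
have qz k : q`_k = 0.
  apply: (@poly_small_coef q k) => // e e0; apply: nearW => t.
  by rewrite q0 normr0 mulr_ge0 ?exprn_ge0 // ltW.
apply: msuppnil0; case E: (msupp P) => [//|m0 s].
have m0P : m0 \in msupp P by rewrite E inE eqxx.
have := qz (K m0); rewrite coef_sum (big_rem m0 m0P) /= coefZ coefXn eqxx mulr1.
rewrite big_seq big1 ?addr0 => [/eqP|m].
  by rewrite mcoeff_eq0 m0P.
rewrite mem_rem_uniq ?msupp_uniq // => /andP[/= mm0 mP].
rewrite coefZ coefXn; case: eqP => [KK|_]; last by rewrite mulr0.
case/negP: mm0; apply/eqP/mnmP => i; apply: esym.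
by apply: (kronecker_inj (B := B)) KK _ => j; exact: mB.
Qed.

End Uniqueness.

Section WeightComponents.
Variables (R : realType) (n : nat) (ws : seq nat).
Implicit Types (P : mpoly n R).

Definition mfilter (A : pred (multinom n)) P : mpoly n R :=
  \sum_(m <- msupp P | A m) mcoeff m P *: mpolyX R m.

Lemma mcoeff_mfilter A P m : mcoeff m (mfilter A P) = if A m then mcoeff m P else 0.
Proof.
rewrite /mfilter raddf_sum /=.
under eq_bigr do rewrite mcoeffZ mcoeffX.
have [mP|mP] := boolP (m \in msupp P); last first.
  rewrite big_seq_cond big1 => [|i /andP[iP _]].
    by move: mP; rewrite -mcoeff_eq0 => /eqP ->; case: ifP.
  by case: eqP => [im|_]; [rewrite -im iP in mP|rewrite mulr0].
rewrite big_mkcond (big_rem m mP) /= eqxx mulr1 big_seq big1 ?addr0 // => i.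
rewrite mem_rem_uniq ?msupp_uniq // => /andP[/= /negPf -> _].
by rewrite mulr0; case: ifP.
Qed.

Lemma mcoeff_wcomp nu P m :
  mcoeff m (wcomp ws nu P) = if weight ws m == nu then mcoeff m P else 0.
Proof. exact: mcoeff_mfilter. Qed.

Lemma mcoeff_wtrunc l P m :
  mcoeff m (wtrunc ws l P) = if (weight ws m <= l)%N then mcoeff m P else 0.
Proof.
rewrite /wtrunc raddf_sum /=; under eq_bigr do rewrite mcoeff_wcomp.
have [wl|wl] := leqP.
  rewrite (bigD1 (Ordinal (wl : (_ < l.+1)%N))) //= eqxx big1 ?addr0 // => i.
  by rewrite -val_eqE /= eq_sym => /negPf ->.
by rewrite big1 // => i _; case: eqP => // E; have := ltn_ord i; rewrite -E ltnNge wl.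
Qed.

End WeightComponents.

Section Jets.
Variables (R : realType) (n : nat) (ws : seq nat).
Hypothesis ws_gt0 : forall i : 'I_n.+1, (0 < nth 0 ws i)%N.
Implicit Types (f g : 'rV[R]_n.+1 -> R) (v : 'rV[R]_n.+1) (P : mpoly n.+1 R).

Lemma peval_wdil P v t :
  peval P (wdil ws t v) =
  \sum_(m <- msupp P) mcoeff m P * (\prod_i v 0 i ^+ m i) * t ^+ weight ws m.
Proof.
rewrite /peval mevalE; apply: eq_bigr => m _; rewrite -mulrA; congr (_ * _).
rewrite /weight expr_sum -big_split /=; apply: eq_bigr => i _.
by rewrite mxE exprMn -exprM mulrC.
Qed.

(** On each line [t |-> wdil ws t v] the components of weight at most [l] give
    the coefficients of degree at most [l] of a polynomial in [t], which vanish;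
    as [v] is arbitrary the components themselves vanish.  This is the
    uniqueness of weighted jets. *)
Lemma small_peval_weight P l :
  (forall v (e : R), 0 < e -> \forall t \near (0 : R)^',
     `|peval P (wdil ws t v)| <= e * `|t| ^+ l) ->
  forall m, m \in msupp P -> (l < weight ws m)%N.
Proof.
move=> H m mP; rewrite ltnNge; apply/negP => ml.
suff W0 : wcomp ws (weight ws m) P = 0.
  have := mcoeff_wcomp ws (weight ws m) P m.
  by rewrite W0 mcoeff0 eqxx => /esym/eqP; rewrite mcoeff_eq0 mP.
apply: peval_eq0 => v.
pose q : {poly R} := \sum_(m <- msupp P)
  (mcoeff m P * (\prod_i v 0 i ^+ m i)) *: 'X^(weight ws m).
have qE t : q.[t] = peval P (wdil ws t v).
  rewrite peval_wdil horner_sum; apply: eq_bigr => k _.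
  by rewrite hornerZ hornerXn.
have <- : q`_(weight ws m) = 0.
  by apply: (@poly_small_coef R q l) ml => e e0; under eq_near do rewrite qE; exact: H.
rewrite coef_sum /peval /wcomp raddf_sum /= big_mkcond /=.
apply: eq_bigr => k _; rewrite coefZ coefXn mevalZ mevalX [in RHS]eq_sym.
by case: eqP => _; rewrite ?mulr1 ?mulr0.
Qed.

(** Rescaling by [D = 1 + |v|] brings an arbitrary direction [v] into the unit
    box; all weights being positive, one power [D] per coordinate suffices. *)
Lemma wbigO_small k f v (e : R) : wbigO ws k.+1 f -> 0 < e ->
  \forall t \near (0 : R)^', `|f (wdil ws t v)| <= e * `|t| ^+ k.
Proof.
move=> /wbigOP[C [C1 HC]] e0.
pose D := 1 + `|v|; have D0 : 0 < D by rewrite ltr_pwDl.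
have D1 : 1 <= D by rewrite lerDl.
have C0 : 0 < C := lt_le_trans ltr01 C1.
have {}HC : \forall t \near (0 : R), forall u : 'rV[R]_n.+1, (forall i, `|u 0 i| <= 1) ->
    `|f (wdil ws (D * t) u)| <= C * `|D * t| ^+ k.+1.
  have cD : D * t @[t --> (0 : R)] --> (0 : R).
    rewrite -[X in _ --> X](mulr0 D).
    by apply: cvgM; [exact: cvg_cst | exact: cvg_id].
  exact: (cD _ HC).
have e'0 : 0 < e / (C * D ^+ k.+1) by rewrite divr_gt0 // mulr_gt0 // exprn_gt0.
apply: cvg_within; apply: filterS2 HC (near_abs_lt e'0) => t HC te.
pose u : 'rV[R]_n.+1 := \row_j (v 0 j / D ^+ nth 0%N ws j).
have -> : wdil ws t v = wdil ws (D * t) u.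
  apply/rowP => j; rewrite !mxE exprMn.
  have Dj : D ^+ nth 0%N ws j != 0 by rewrite expf_neq0 // gt_eqF.
  by rewrite [D ^+ _ * _]mulrC -mulrA; congr (_ * _); rewrite mulrCA mulfV // mulr1.
apply: le_trans (HC u _) _.
  move=> j; rewrite mxE normrM normfV normrX (ger0_norm (ltW D0)).
  rewrite ler_pdivrMr ?exprn_gt0 // mul1r.
  apply: (@le_trans _ _ D); first by rewrite (le_trans (coord_le_norm _ _)) // lerDr.
  by rewrite -[leLHS]expr1; apply: ler_weXn2l => //; exact: ws_gt0.
rewrite normrM (ger0_norm (ltW D0)) exprMn mulrA [`|t| ^+ k.+1]exprS mulrA.
rewrite ler_wpM2r ?exprn_ge0 // mulrC -ler_pdivlMr ?ltW //.
by rewrite mulr_gt0 // exprn_gt0.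
Qed.

Lemma wbigO_peval_weight P k : wbigO ws k (peval P) ->
  forall m, m \in msupp P -> (k <= weight ws m)%N.
Proof.
case: k => [//|k] H m; apply: small_peval_weight => v e.
exact: wbigO_small.
Qed.

End Jets.

(** * Taylor polynomials and weighted jets *)
Section Taylor.
Variables (R : realType) (n : nat).
Implicit Types (f : 'rV[R]_n.+1 -> R) (p v : 'rV[R]_n.+1) (P : mpoly n.+1 R).

Lemma peval_ray P p t :
  peval P (t *: p) =
  \sum_(m <- msupp P) mcoeff m P * (\prod_i p 0 i ^+ m i) * t ^+ mdeg m.
Proof.
rewrite /peval mevalE; apply: eq_bigr => m _; rewrite -mulrA; congr (_ * _).
rewrite mdegE expr_sum -big_split /=; apply: eq_bigr => i _.
by rewrite mxE exprMn mulrC.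
Qed.

Lemma is_derive_ray (U : set 'rV[R]_n.+1) f p (t : R) : open U -> Ck U 1 f -> U (t *: p) ->
  is_derive t 1 (fun s : R => f (s *: p)) (\sum_i p 0 i * partial i f (t *: p)).
Proof.
move=> Uo [cf Hf] Ut; have dp j : is_derive t 1 (fun s : R => (s *: p) 0 j) (p 0 j).
  have -> : (fun s : R => (s *: p) 0 j) = (fun s => s * p 0 j).
    by apply/funext => s; rewrite mxE.
  apply: (@is_derive_eq _ _ _ (id * cst (p 0 j))).
  by rewrite /GRing.scale /= mulr0 mulr1 add0r.
have H : is_derive t 1 (f \o (fun s : R => s *: p))
    (\sum_j 'D_1 (fun s : R => (s *: p) 0 j) t * partial j f (t *: p)).
  apply: is_derive_comp_rV => [|i|j]; last by have [] := dp j.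
  - apply: filterS (open_near Uo Ut) => x Ux i.
    by have [+ _] := Hf i; apply; rewrite inE.
  - by have [_ [+ _]] := Hf i; apply; rewrite inE.
apply: is_derive_eq H _; apply: eq_bigr => j _.
by have [_ ->] := dp j.
Qed.

(** Induction on [N].  If [P_i] is a Taylor polynomial of the i-th partial
    derivative of [f], then the derivative of [t |-> f (t *: p)] is close to
    [t^-1 * Q (t *: p)] with [Q = \sum_i X_i * P_i].  Dividing every monomial of
    [Q] by its degree integrates this along rays, and the mean value theorem on
    the segment from 0 to [p] bounds the error. *)
Lemma taylor (U : set 'rV[R]_n.+1) f N : open U -> U 0 -> (forall k, Ck U k f) ->
  exists P, exists C : R, \forall p \near (0 : 'rV[R]_n.+1),
    `|f p - peval P p| <= C * `|p| ^+ N.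
Proof.
move=> Uo U0; elim: N f => [|N IH] f Hf.
  exists 0, (`|f 0| + 1).
  have cf : {for 0, continuous f} by apply: (Ck_cont (Hf 0%N)); rewrite inE.
  move/cvgrPdist_le: cf => /(_ 1 ltr01); apply: filterS => p H.
  rewrite /peval meval0 subr0 expr0 mulr1.
  by have := ler_normB (f 0) (f 0 - f p); rewrite subKr; move: H; lra.
have {}IH i : exists PC : mpoly n.+1 R * R, \forall p \near (0 : 'rV[R]_n.+1),
    `|partial i f p - peval PC.1 p| <= PC.2 * `|p| ^+ N.
  have [|P [C HC]] := IH (partial i f); last by exists (P, C).
  by move=> k; have [_ /(_ i)[]] := Hf k.+1.
have [PC HPC] := choice IH.
pose Q := \sum_i pvar R i * (PC i).1.
pose P := mpolyC n.+1 (f 0) + \sum_(m <- msupp Q) ((mdeg m)%:R^-1 * mcoeff m Q) *: mpolyX R m.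
exists P, (\sum_i `|(PC i).2|).
have {}HPC : \forall p \near (0 : 'rV[R]_n.+1), U p /\ forall i,
    `|partial i f p - peval (PC i).1 p| <= (PC i).2 * `|p| ^+ N.
  have H := filter_forall _ HPC.
  exact: (filterI (open_near Uo U0) (H _)).
have [e /= e0 eP] := (nbhs_ballP _ _).1 HPC.
have : \forall p \near (0 : 'rV[R]_n.+1), ball 0 e p by exact: nbhsx_ballx.
apply: filterS => p; rewrite -ball_normE /= sub0r normrN => pe.
have {}eP (t : R) : 0 <= t <= 1 -> U (t *: p) /\ forall i,
    `|partial i f (t *: p) - peval (PC i).1 (t *: p)| <= (PC i).2 * `|t *: p| ^+ N.
  move=> /andP[t0 t1]; apply: eP.
  rewrite -ball_normE /= sub0r normrN normrZ (ger0_norm t0).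
  by apply: le_lt_trans pe; rewrite ler_piMl.
have Q0 m : m \in msupp Q -> (0 < mdeg m)%N.
  move=> mQ; rewrite lt0n mdeg_eq0; apply/eqP => m0; move: mQ.
  rewrite m0 mcoeff_msupp raddf_sum /= big1 ?eqxx // => i _.
  by rewrite /pvar rmorphM /= mcoeffX mnm1_eq0 mul0r.
pose hp : {poly R} := \sum_(m <- msupp Q)
   ((mdeg m)%:R^-1 * mcoeff m Q * \prod_i p 0 i ^+ m i) *: 'X^(mdeg m).
have PE t : peval P (t *: p) = f 0 + hp.[t].
  rewrite /peval mevalD mevalC raddf_sum horner_sum; congr (_ + _).
  apply: eq_bigr => m _ /=; rewrite mevalZ mevalX hornerZ hornerXn -!mulrA.
  do 2 congr (_ * _); rewrite mdegE expr_sum -big_split /=; apply: eq_bigr => i _.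
  by rewrite mxE exprMn mulrC.
have dhp (t : R) : t != 0 -> hp^`().[t] = \sum_i p 0 i * peval (PC i).1 (t *: p).
  move=> t0; apply: (mulfI t0).
  transitivity (peval Q (t *: p)).
    rewrite peval_ray /hp raddf_sum /= horner_sum mulr_sumr.
    rewrite big_seq [RHS]big_seq; apply: eq_bigr => m /Q0 m0.
    rewrite derivZ derivXn hornerZ hornerMn hornerXn.
    rewrite -[in RHS](prednK m0) exprS -mulr_natr.
    field.
    by rewrite pnatr_eq0 -lt0n.
  rewrite /Q /peval raddf_sum mulr_sumr; apply: eq_bigr => i _.
  by rewrite /= mevalM /pvar mevalXU mxE mulrA.
have C0 : 0 <= \sum_i `|(PC i).2| by rewrite sumr_ge0.
pose g (t : R) := f (t *: p) - hp.[t].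
pose dg (t : R) := \sum_i p 0 i * partial i f (t *: p) - hp^`().[t].
have Dg (t : R) : 0 <= t <= 1 -> is_derive t 1 g (dg t).
  move=> t01; have [Ut _] := eP t t01.
  have d1 := is_derive_ray Uo (Hf 1%N) Ut.
  have d2 : is_derive t 1 (horner hp) hp^`().[t].
    by split; [exact: derivable_horner | rewrite derivE derive1E].
  exact: is_deriveB.
have [||c c01 E] := @MVT R g dg 0 1 ltr01.
- by move=> x /[!in_itv]/= /andP[x0 x1]; apply: Dg; rewrite !ltW.
- apply: derivable_within_continuous => x /[!in_itv]/= x01.
  by apply: ex_derive; exact: Dg.
move: c01; rewrite in_itv /= => /andP[c0 c1].
have -> : f p - peval P p = g 1 - g 0.
  have := PE 1; rewrite scale1r => ->; rewrite /g scale1r scale0r.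
  have hp0 : hp.[0] = 0.
    have := PE 0; rewrite scale0r => H.
    rewrite /hp horner_sum big_seq big1 // => m /Q0 m0.
    by rewrite hornerZ hornerXn expr0n eqn0Ngt m0 mulr0.
  by rewrite hp0; ring.
rewrite E subr0 mulr1 /dg dhp ?gt_eqF // -sumrB.
apply: le_trans (ler_norm_sum _ _ _) _.
rewrite mulr_suml; apply: ler_sum => i _; rewrite -mulrBr normrM.
have [_ /(_ i) H] := eP c (introT andP (conj (ltW c0) (ltW c1))).
rewrite exprS mulrCA ler_pM ?coord_le_norm // (le_trans H) //.
rewrite normrZ (ger0_norm (ltW c0)).
apply: (@le_trans _ _ (`|(PC i).2| * (c * `|p|) ^+ N)).
  by rewrite ler_wpM2r ?ler_norm // exprn_ge0 // mulr_ge0 // ltW.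
rewrite ler_wpM2l // lerXn2r ?nnegrE ?mulr_ge0 ?(ltW c0) //.
by rewrite ler_piMl // ltW.
Qed.

Variable ws : seq nat.
Hypothesis ws_gt0 : forall i : 'I_n.+1, (0 < nth 0 ws i)%N.

Lemma norm_wdil_le (t : R) v : `|t| <= 1 -> (forall i, `|v 0 i| <= 1) ->
  `|wdil ws t v| <= `|t|.
Proof.
move=> t1 v1; apply: norm_le_coord => // i.
rewrite mxE normrM normrX -[leRHS]mulr1 ler_pM ?exprn_ge0 //.
by rewrite -[leRHS]expr1; apply: ler_wiXn2l => //; exact: ws_gt0.
Qed.

(** A weighted jet is a truncation of an ordinary Taylor polynomial: weights are
    at least 1, so a remainder of order [k] is also of weighted order [k]. *)
Lemma smooth_wjet f k : smooth_near0 f -> exists2 P : mpoly n.+1 R,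
  (forall m, m \in msupp P -> (weight ws m < k)%N) &
  wbigO ws k (fun p => f p - peval P p).
Proof.
move=> /smooth_near0P[U [Uo U0 Hf]]; have [P [C HC]] := taylor k Uo U0 Hf.
have H1 : wbigO ws k (fun p => f p - peval P p).
  have nA := wdil_near ws_gt0 HC.
  exists `|C|; near=> t => v v1.
  have t1 : `|t| <= 1 by apply: ltW; near: t; exact: near_abs_lt.
  have H : `|f (wdil ws t v) - peval P (wdil ws t v)| <= C * `|wdil ws t v| ^+ k.
    by move: v v1; near: t.
  apply: le_trans H _; apply: (@le_trans _ _ (`|C| * `|wdil ws t v| ^+ k)).
    by rewrite ler_wpM2r ?exprn_ge0 // ler_norm.
  by rewrite ler_wpM2l // lerXn2r ?nnegrE // norm_wdil_le.
pose A (m : multinom n.+1) := (weight ws m < k)%N.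
exists (mfilter A P) => [m|].
  by rewrite mcoeff_msupp mcoeff_mfilter /A; case: ifP => //; rewrite eqxx.
have H2 : wbigO ws k (peval (P - mfilter A P)).
  apply: wbigO_peval => // m; rewrite mcoeff_msupp mcoeffB mcoeff_mfilter /A.
  by case: ltnP => //; rewrite subrr eqxx.
apply: wbigO_ext (wbigOD H1 H2) => p; rewrite /peval mevalB; ring.
Unshelve. all: by end_near. Qed.

End Taylor.

Section WJet.
Variable R : realType.
Implicit Types (F : 'rV[R]_3 -> R) (P : mpoly 3 R).

Lemma abx_gt0 (i : 'I_3) : (0 < nth 0 w_abx i)%N.
Proof. by case: i => [[|[|[|]]]]. Qed.

(** The pointwise remainder of a jet is automatically uniform for a smooth
    function: the function has a jet with uniform remainder, and jets are
    unique. *)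
Lemma is_wjet_bigO l F P : smooth_near0 F ->
  is_wjet l F P <-> (forall m, m \in msupp P -> (weight w_abx m <= l)%N) /\
    wbigO w_abx l.+1 (fun p => F p - peval P p).
Proof.
move=> sF; split=> [[wP HP]|[wP HP]]; split=> //; last first.
  move=> v; apply/eqoP => e e0; near=> t.
  rewrite normrX; near: t; exact: (wbigO_small abx_gt0 v HP).
have [Q wQ HQ] := smooth_wjet abx_gt0 l.+1 sF.
suff -> : P = Q by [].
apply/subr0_eq/msuppnil0; case E: (msupp _) => [//|m s].
have mPQ : m \in msupp (P - Q) by rewrite E inE eqxx.
have : (l < weight w_abx m)%N.
  apply: (small_peval_weight _ mPQ) => v e e0.
  have e20 : 0 < e / 2 by rewrite divr_gt0.
  have H1 := wbigO_small abx_gt0 v HQ e20.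
  have H2 : \forall t \near (0 : R)^', `|F (wdil w_abx t v) - peval P (wdil w_abx t v)|
      <= e / 2 * `|t| ^+ l.
    by have /eqoP /(_ _ e20) := HP v; apply: filterS => t; rewrite normrX.
  apply: filterS2 H1 H2 => t H1 H2; rewrite /peval mevalB -!/(peval _ _).
  rewrite (_ : _ - _ = (F (wdil w_abx t v) - peval Q (wdil w_abx t v)) -
     (F (wdil w_abx t v) - peval P (wdil w_abx t v))); last by ring.
  apply: le_trans (ler_normB _ _) _; move: (`|t| ^+ l) H1 H2 => x; lra.
rewrite ltnNge; case/negP.
have := msuppB_le mPQ; rewrite mem_cat => /orP[/wP //|/wQ]; exact.
Unshelve. all: by end_near. Qed.

End WJet.

(** * Images of graphs under product maps *)
Section SmoothMaps.
Variable R : realType.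

Lemma smooth_map_cont n m (f : 'rV[R]_n.+1 -> 'rV[R]_m.+1) :
  smooth_map_near0 f -> {for (0 : 'rV[R]_n.+1), continuous f}.
Proof.
move=> /smooth_map_near0P[U [Uo U0 Hf]]; apply: continuous_rV => j.
by apply: (Ck_cont (Hf j 0%N)); rewrite inE.
Qed.

Lemma smooth_near0_comp n m (f : 'rV[R]_m.+1 -> R) (g : 'rV[R]_n.+1 -> 'rV[R]_m.+1) :
  smooth_near0 f -> smooth_map_near0 g -> g 0 = 0 -> smooth_near0 (f \o g).
Proof.
move=> /smooth_near0P[V [Vo V0 Hf]] /smooth_map_near0P[U [Uo U0 Hg]] g0.
have cg x : U x -> {for x, continuous g}.
  by move=> Ux; apply: continuous_rV => j; apply: (Ck_cont (Hg j 0%N)); rewrite inE.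
apply/smooth_near0P; pose W := interior (U `&` g @^-1` V).
have Wo : open W by exact: open_interior.
have WU : W `<=` U by move=> x /interior_subset[].
exists W; split=> //.
  apply: filterI; first exact: open_near.
  by apply: (cg 0 U0); rewrite g0; exact: open_near.
move=> k; apply: (Ck_comp Wo Vo) => //; first by move=> x /interior_subset[].
by move=> j; exact: Ck_sub WU _.
Qed.

Lemma smooth_map_comp n m k (f : 'rV[R]_m.+1 -> 'rV[R]_k) (g : 'rV[R]_n.+1 -> 'rV[R]_m.+1) :
  smooth_map_near0 f -> smooth_map_near0 g -> g 0 = 0 -> smooth_map_near0 (f \o g).
Proof. by move=> sf sg g0 j; exact: (smooth_near0_comp (sf j) sg g0). Qed.

Lemma smooth_peval n (P : mpoly n.+1 R) : smooth_near0 (peval P).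
Proof.
apply/smooth_near0P; exists setT; split=> //; first exact: openT.
by move=> k; apply: Ck_peval; exact: openT.
Qed.

Lemma smooth_coord n (j : 'I_n.+1) : smooth_near0 (fun v : 'rV[R]_n.+1 => v 0 j).
Proof.
apply/smooth_near0P; exists setT; split=> //; first exact: openT.
by move=> k; apply: Ck_coord; exact: openT.
Qed.

Lemma smooth_row2 n (f g : 'rV[R]_n.+1 -> R) : smooth_near0 f -> smooth_near0 g ->
  smooth_map_near0 (fun v => row2 (f v) (g v)).
Proof.
move=> sf sg j; have [j0|j0] := eqVneq j 0.
  by rewrite (_ : (fun _ => _) = f) //; apply/funext => v; rewrite mxE j0.
by rewrite (_ : (fun _ => _) = g) //; apply/funext => v; rewrite mxE (negPf j0).
Qed.

Lemma smooth_row3 n (f g h : 'rV[R]_n.+1 -> R) :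
  smooth_near0 f -> smooth_near0 g -> smooth_near0 h ->
  smooth_map_near0 (fun v => row3 (f v) (g v) (h v)).
Proof.
move=> sf sg sh j; have [j0|j0] := eqVneq j 0.
  by rewrite (_ : (fun _ => _) = f) //; apply/funext => v; rewrite mxE j0.
have [j1|j1] := eqVneq j 1.
  by rewrite (_ : (fun _ => _) = g) //; apply/funext => v; rewrite mxE j1.
by rewrite (_ : (fun _ => _) = h) //; apply/funext => v; rewrite mxE (negPf j0) (negPf j1).
Qed.

Lemma row2E (p : 'rV[R]_2) : row2 (p 0 0) (p 0 1) = p.
Proof.
by apply/rowP => -[[|[|]]] //= h; rewrite mxE /=; congr (p _ _); apply/val_inj.
Qed.

Lemma row3E (v : 'rV[R]_3) : row3 (v 0 0) (v 0 1) (v 0 (2 : 'I_3)) = v.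
Proof.
by apply/rowP => -[[|[|[|]]]] //= h; rewrite mxE /=; congr (v _ _); apply/val_inj.
Qed.

Lemma row2_0 (a b : R) : row2 a b 0 0 = a. Proof. by rewrite mxE. Qed.
Lemma row2_1 (a b : R) : row2 a b 0 1 = b. Proof. by rewrite mxE. Qed.
Lemma row3_0 (a b c : R) : row3 a b c 0 0 = a. Proof. by rewrite mxE. Qed.
Lemma row3_1 (a b c : R) : row3 a b c 0 1 = b. Proof. by rewrite mxE. Qed.
Lemma row3_2 (a b c : R) : row3 a b c 0 (2 : 'I_3) = c. Proof. by rewrite mxE. Qed.

Lemma row2_00 : row2 0 0 = 0 :> 'rV[R]_2.
Proof. by apply/rowP => i; rewrite !mxE; case: ifP. Qed.

Lemma row3_00 : row3 0 0 0 = 0 :> 'rV[R]_3.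
Proof. by apply/rowP => i; rewrite !mxE; case: ifP => // _; case: ifP. Qed.

Lemma row3_inj (a b c a' b' c' : R) : row3 a b c = row3 a' b' c' ->
  [/\ a = a', b = b' & c = c'].
Proof.
move=> E; have := (row3_0 a b c, row3_1 a b c, row3_2 a b c).
by rewrite E row3_0 row3_1 row3_2 => -[[-> ->] ->].
Qed.

Lemma norm_row2_lt (a b e : R) : `|a| < e -> `|b| < e -> `|row2 a b| < e.
Proof.
move=> ae be; apply: (@le_lt_trans _ _ (Num.max `|a| `|b|)); last by rewrite gt_max ae.
apply: norm_le_coord => [|i]; first by rewrite le_max normr_ge0.
by rewrite mxE; case: ifP => _; rewrite le_max lexx ?orbT.
Qed.

Lemma norm_row3_lt (a b c e : R) : `|a| < e -> `|b| < e -> `|c| < e -> `|row3 a b c| < e.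
Proof.
move=> ae be ce; apply: (@le_lt_trans _ _ (Num.max `|a| (Num.max `|b| `|c|))).
  apply: norm_le_coord => [|i]; first by rewrite le_max normr_ge0.
  by rewrite mxE; do 2?[case: ifP => _]; rewrite !le_max lexx ?orbT.
by rewrite !gt_max ae be.
Qed.

Lemma near0_ball n (A : set 'rV[R]_n.+1) : (\forall p \near (0 : 'rV[R]_n.+1), A p) ->
  exists2 e : R, 0 < e & forall p, `|p| < e -> A p.
Proof.
move=> /nbhs_ballP[e /= e0 eA]; exists e => // p pe.
by apply: eA; rewrite -ball_normE /= sub0r normrN.
Qed.

Lemma ball_near0 n (A : set 'rV[R]_n.+1) (e : R) : 0 < e ->
  (forall p, `|p| < e -> A p) -> \forall p \near (0 : 'rV[R]_n.+1), A p.
Proof.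
move=> e0 eA; have := nbhsx_ballx (0 : 'rV[R]_n.+1) _ e0; apply: filterS => p.
by rewrite -ball_normE /= sub0r normrN; exact: eA.
Qed.

Lemma cont0_small n m (h : 'rV[R]_n.+1 -> 'rV[R]_m.+1) (e : R) :
  {for (0 : 'rV[R]_n.+1), continuous h} -> h 0 = 0 -> 0 < e ->
  \forall p \near (0 : 'rV[R]_n.+1), `|h p| < e.
Proof.
move=> ch h0 e0; have H : \forall p \near (0 : 'rV[R]_n.+1), ball (h 0) e (h p).
  by apply: ch; exact: nbhsx_ballx.
apply: filterS H => p; rewrite h0.
by rewrite -ball_normE /= sub0r normrN.
Qed.

End SmoothMaps.

Section Image.
Variable R : realType.

Definition ab_part (v : 'rV[R]_3) : 'rV[R]_2 := row2 (v 0 0) (v 0 1).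

Definition xy_part (F : 'rV[R]_3 -> R) (v : 'rV[R]_3) : 'rV[R]_2 :=
  row2 (v 0 (2 : 'I_3)) (F v).

(** The map induced on hypersurfaces by the product map [f] x [g], in the charts
    [(a, b, x)]. *)
Definition chart_map F (f g : 'rV[R]_2 -> 'rV[R]_2) (v : 'rV[R]_3) : 'rV[R]_3 :=
  row3 (g (ab_part v) 0 0) (g (ab_part v) 0 1) (f (xy_part F v) 0 0).

Lemma smooth_xy_part F : smooth_near0 F -> smooth_map_near0 (xy_part F).
Proof. by move=> sF; apply: smooth_row2 sF; exact: smooth_coord. Qed.

Lemma smooth_ab_part : smooth_map_near0 ab_part.
Proof. by apply: smooth_row2; exact: smooth_coord. Qed.

Lemma xy_part0 F : F 0 = 0 -> xy_part F 0 = 0.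
Proof. by move=> F0; rewrite /xy_part F0 mxE row2_00. Qed.

Lemma ab_part0 : ab_part 0 = 0.
Proof. by rewrite /ab_part !mxE row2_00. Qed.

(** The equation [Y = Fs (A, B, X)] of the image is obtained by inverting
    [(a, b, x) |-> (A, B, X)], restricted to the graph, and reading off [Y].
    Injectivity of [f] and [g] gives the converse inclusion. *)
Lemma image_hypersurface (F : 'rV[R]_3 -> R) (f g : 'rV[R]_2 -> 'rV[R]_2) :
  smooth_near0 F -> F 0 = 0 -> local_diffeo0 f -> local_diffeo0 g ->
  local_diffeo0 (chart_map F f g) ->
  exists Fs, [/\ smooth_near0 Fs, Fs 0 = 0 & maps_onto f g F Fs].
Proof.
move=> sF F0 [sf f0 [f' [sf' f'0 f'f ff']]] [sg g0 [g' [sg' g'0 g'g gg']]].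
pose G := chart_map F f g; move=> [sG G0 [H [sH H0 HG GH]]].
pose lift := xy_part F.
have slift := smooth_xy_part sF; have lift0 := xy_part0 F0.
pose Fs w := f (lift (H w)) 0 1.
have slH : smooth_map_near0 (lift \o H) by exact: smooth_map_comp.
have lH0 : lift (H 0) = 0 by rewrite H0.
exists Fs; split.
- exact: (smooth_map_comp sf slH lH0).
- by rewrite /Fs lH0 f0 mxE.
have [e1 e1_0 {}HG] := near0_ball HG.
have [e2 e2_0 {}GH] := near0_ball GH.
have [e3 e3_0 {}f'f] := near0_ball f'f.
have [e4 e4_0 {}g'g] := near0_ball g'g.
have [e5 e5_0 cH] := near0_ball (cont0_small (smooth_map_cont sH) H0 e4_0).
have [e6 e6_0 cl] := near0_ball (cont0_small (smooth_map_cont slH) lH0 e3_0).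
pose e7 := Num.min e2 (Num.min e5 e6).
have e7_0 : 0 < e7 by rewrite !lt_min e2_0 e5_0 e6_0.
have nf := cont0_small (smooth_map_cont sf) f0 e7_0.
have ng := cont0_small (smooth_map_cont sg) g0 e7_0.
have [e8 e8_0 {}nf] := near0_ball nf.
have [e9 e9_0 {}ng] := near0_ball ng.
pose e := Num.min (Num.min e1 e3) (Num.min e4 (Num.min e8 e9)).
have e_0 : 0 < e by rewrite !lt_min e1_0 e3_0 e4_0 e8_0 e9_0.
exists ([set p | `|p| < e], [set q | `|q| < e]).
  by split; apply: (ball_near0 e_0).
case=> p q [/=]; rewrite /e !lt_min.
move=> /andP[/andP[p1 p3] /andP[p4 /andP[p8 p9]]] /andP[/andP[q1 q3] /andP[q4 /andP[q8 q9]]].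
have clt n (v : 'rV[R]_n.+1) i r : `|v| < r -> `|v 0 i| < r.
  exact: le_lt_trans (coord_le_norm _ _).
rewrite /on_hypersurface; split=> [E|E].
  set v := row3 (q 0 0) (q 0 1) (p 0 0) in E.
  have ve : `|v| < e1 by apply: norm_row3_lt; apply: clt.
  have Gv : G v = row3 (g q 0 0) (g q 0 1) (f p 0 0).
    by rewrite /G /chart_map /ab_part /xy_part -E row3_0 row3_1 row3_2 !row2E.
  by rewrite -Gv /Fs HG // /lift /xy_part -E row3_2 row2E.
set w := row3 _ _ _ in E.
have we : `|w| < e7 by apply: norm_row3_lt; apply: clt; [exact: ng|exact: ng|exact: nf].
move: we; rewrite /e7 !lt_min => /andP[w2 /andP[w5 w6]].
have := GH w w2; set v := H w; rewrite /chart_map => /row3_inj[gE0 gE1 fE0].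
have vE := cH w w5; rewrite -/v in vE.
have qE : row2 (v 0 0) (v 0 1) = q.
  rewrite -[RHS]g'g // -[LHS]g'g; last by apply: norm_row2_lt; exact: clt.
  by congr g'; rewrite -[LHS]row2E -[RHS]row2E gE0 gE1.
have pE : lift v = p.
  rewrite -[RHS]f'f // -[LHS]f'f; last exact: cl.
  by congr f'; rewrite -[LHS]row2E -[RHS]row2E fE0 E.
rewrite -qE -pE row2_0 row2_1 /lift /xy_part row2_0 row2_1.
by rewrite row3E.
Qed.

Lemma maps_onto_eq (F Fs : 'rV[R]_3 -> R) (f g : 'rV[R]_2 -> 'rV[R]_2) :
  smooth_near0 F -> F 0 = 0 -> maps_onto f g F Fs ->
  \forall v \near (0 : 'rV[R]_3),
    Fs (chart_map F f g v) = f (xy_part F v) 0 1.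
Proof.
move=> sF F0 [[A B] [/= nA nB] AB].
have [e1 e1_0 {}nA] := near0_ball nA; have [e2 e2_0 {}nB] := near0_ball nB.
have slift := smooth_xy_part sF; have lift0 := xy_part0 F0.
have n1 := cont0_small (smooth_map_cont slift) lift0 e1_0.
apply: filterS2 n1 (ball_near0 e2_0 (fun p h => h)) => v lv ve2.
set p := xy_part F v; set q := ab_part v.
have qB : `|q| < e2 by apply: norm_row2_lt; exact: le_lt_trans (coord_le_norm _ _) ve2.
have [H _] := AB (p, q) (conj (nA _ lv) (nB _ qB)).
rewrite /chart_map -/p -/q; apply: esym; apply/H; rewrite /on_hypersurface /= /p /q /xy_part /ab_part !row2_0 !row2_1.
by rewrite row3E.
Qed.

End Image.

Section WeightedDiffeo.
Variables (R : realType) (n : nat) (ws : seq nat).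
Hypothesis ws_gt0 : forall i : 'I_n.+1, (0 < nth 0 ws i)%N.

Lemma wbigO_at0 k (g : 'rV[R]_n.+1 -> R) : wbigO ws k.+1 g -> g 0 = 0.
Proof.
move=> [C HC]; have := nbhs_singleton HC => /(_ 0).
rewrite normr0 expr0n mulr0 normr_le0 (_ : wdil ws 0 0 = 0).
  by move=> H; apply/eqP; apply: H => i; rewrite mxE normr0.
by apply/rowP => i; rewrite !mxE mulr0.
Qed.

(** Along the i-th axis, dilation by [t] is multiplication by [t ^+ ws`_i]: a
    function of larger order has a vanishing difference quotient there. *)
Lemma wbigO_partial k (g : 'rV[R]_n.+1 -> R) (i : 'I_n.+1) :
  derivable g 0 (delta_mx 0 i) -> wbigO ws k g -> (nth 0%N ws i < k)%N ->
  partial i g 0 = 0.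
Proof.
move=> dg Hg; set w := nth 0%N ws i => wk.
have g0 : g 0 = 0 by case: k wk Hg => // k _; exact: wbigO_at0.
have {}Hg := wbigO_le wk Hg.
have {}dg : h^-1 *: (g (h *: delta_mx 0 i) - g 0) @[h --> (0:R)^'] --> partial i g 0.
  move: dg; rewrite /derivable /partial /derive => /cvg_ex[l dl].
  rewrite (cvg_lim _ dl) //; apply: cvg_trans dl; apply: near_eq_cvg.
  by apply: nearW => h /=; rewrite addr0.
have tw : t ^+ w @[t --> (0 : R)^'] --> (0 : R)^'.
  move=> A [e /= e0 eA]; suff: \forall t \near (0 : R)^', A (t ^+ w) by [].
  near=> t.
  have t0 : t != 0 by near: t; exact: nbhs_dnbhs_neq.
  have te : `|t| < e by near: t; apply: cvg_within; exact: near_abs_lt.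
  have t1 : `|t| < 1 by near: t; apply: cvg_within; exact: near_abs_lt.
  apply: eA; last by rewrite /= expf_neq0.
  rewrite /= sub0r normrN normrX; apply: le_lt_trans te.
  rewrite -[leRHS]expr1; apply: ler_wiXn2l => //; last exact: ws_gt0.
  exact: ltW.
have {}dg := cvg_comp _ _ tw dg.
apply/eqP/contraT => d0; have e0 : 0 < `|partial i g 0| / 2.
  by rewrite divr_gt0 // normr_gt0.
have n1 := wbigO_small ws_gt0 (delta_mx 0 i) Hg e0.
have n2 : \forall t \near (0 : R)^', `|partial i g 0 - (t ^+ w)^-1 * g (t ^+ w *: delta_mx 0 i)|
     < `|partial i g 0| / 2.
  move/cvgrPdist_lt: dg => /(_ _ e0); apply: filterS => t /=.
  by rewrite g0 subr0.
have : \forall t \near (0 : R)^', False.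
  near=> t.
  have t0 : t != 0 by near: t; exact: nbhs_dnbhs_neq.
  have H1 : `|g (wdil ws t (delta_mx 0 i))| <= `|partial i g 0| / 2 * `|t| ^+ w by near: t.
  have H2 : `|partial i g 0 - (t ^+ w)^-1 * g (t ^+ w *: delta_mx 0 i)|
     < `|partial i g 0| / 2 by near: t.
  have E : wdil ws t (delta_mx 0 i) = t ^+ w *: delta_mx 0 i.
    apply/rowP => j; rewrite !mxE; case: (eqVneq j i) => [->//|_].
    by rewrite andbF !mulr0.
  rewrite E in H1.
  have H3 : `|(t ^+ w)^-1 * g (t ^+ w *: delta_mx 0 i)| <= `|partial i g 0| / 2.
    rewrite normrM normfV normrX mulrC ler_pdivrMr //.
    by rewrite exprn_gt0 // normr_gt0.
  have := ler_normD (partial i g 0 - (t ^+ w)^-1 * g (t ^+ w *: delta_mx 0 i))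
    ((t ^+ w)^-1 * g (t ^+ w *: delta_mx 0 i)).
  by rewrite subrK; move: H2 H3; lra.
by move=> /filter_ex[].
Unshelve. all: by end_near. Qed.

(** The Jacobian matrix at 0 has the entries of the identity wherever the weight
    of the source variable does not exceed the one of the target.  Variables
    being listed by monotone weights, it is triangular with unit diagonal. *)
Lemma weighted_local_diffeo (f : 'rV[R]_n.+1 -> 'rV[R]_n.+1) :
  (forall i j : 'I_n.+1, (i < j)%N -> (nth 0 ws i <= nth 0 ws j)%N) \/
  (forall i j : 'I_n.+1, (i < j)%N -> (nth 0 ws j <= nth 0 ws i)%N) ->
  smooth_map_near0 f ->
  (forall i : 'I_n.+1, wbigO ws (nth 0%N ws i).+1 (fun p => f p 0 i - p 0 i)) ->
  local_diffeo0 f.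
Proof.
move=> ws_sorted sf Hf; have f0 : f 0 = 0.
  apply/rowP => i; have := wbigO_at0 (Hf i).
  by rewrite !mxE subr0.
apply: inverse_function => //.
have J (i j : 'I_n.+1) : (nth 0 ws i <= nth 0 ws j)%N -> partial_mx f 0 i j = (i == j)%:R.
  move=> wij; rewrite mxE.
  have [U [Uo U0 HU]] := (smooth_map_near0P f).1 sf.
  have df : derivable (fun x => f x 0 j) 0 (delta_mx 0 i).
    by have [_ /(_ i)[+ _]] := HU j 1%N; apply; rewrite inE.
  have [dc cE] := is_derive_coord 0 (delta_mx 0 i : 'rV[R]_n.+1) j.
  have dB := derivableB df dc.
  have := wbigO_partial dB (Hf j); rewrite ltnS => /(_ wij).
  rewrite /partial (deriveB df dc) cE mxE eqxx /= => /eqP; rewrite subr_eq0 => /eqP ->.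
  by rewrite eq_sym.
rewrite unitmxE.
case: ws_sorted => S.
  rewrite det_trig; last first.
    by apply/is_trig_mxP => i j ij; rewrite J ?S // -val_eqE /= ltn_eqF.
  by rewrite big1 ?unitr1 // => i _; rewrite J // eqxx.
rewrite -det_tr det_trig; last first.
  by apply/is_trig_mxP => i j ij; rewrite mxE J ?S // -val_eqE /= gtn_eqF.
by rewrite big1 ?unitr1 // => i _; rewrite mxE J // eqxx.
Qed.

End WeightedDiffeo.

(** * The action of elementary maps on jets *)
Section Transform.
Variable R : realType.
Implicit Types (F Fs : 'rV[R]_3 -> R) (P Q : mpoly 3 R) (xi eta al be p : mpoly 2 R).

Local Notation O := (@wbigO R 2 w_abx).

Lemma xy_gt0 (i : 'I_2) : (0 < nth 0 w_xy i)%N.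
Proof. by case: i => [[|[|]]]. Qed.

Lemma ab_gt0 (i : 'I_2) : (0 < nth 0 w_ab i)%N.
Proof. by case: i => [[|[|]]]. Qed.

Lemma ord2P (T : 'I_2 -> Prop) : T 0 -> T 1 -> forall i, T i.
Proof.
by move=> T0 T1 [[|[|]]] //= h; [rewrite (_ : Ordinal h = 0)|rewrite (_ : Ordinal h = 1)]
  => //; apply/val_inj.
Qed.

Lemma ord3P (T : 'I_3 -> Prop) : T 0 -> T 1 -> T 2 -> forall i, T i.
Proof.
by move=> T0 T1 T2 [[|[|[|]]]] //= h; [rewrite (_ : Ordinal h = 0)
  |rewrite (_ : Ordinal h = 1)|rewrite (_ : Ordinal h = 2)] => //; apply/val_inj.
Qed.

Definition bilin : mpoly 3 R := pvar R 0 + pvar R 1 * pvar R (2 : 'I_3).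

Definition sub_xy p : mpoly 3 R := comp_mpoly [tuple pvar R (2 : 'I_3); bilin] p.

Definition sub_ab p : mpoly 3 R := comp_mpoly [tuple pvar R 0; pvar R 1] p.

(** The first-order effect on the equation [y = a + b * x] of the elementary map
    with components [xi], [eta], [al], [be]. *)
Definition infinitesimal xi eta al be : mpoly 3 R :=
  sub_xy eta - sub_ab al - pvar R (2 : 'I_3) * sub_ab be - pvar R 1 * sub_xy xi.

Definition elementary_map xi eta al be : product_polymap R :=
  ProductPolymap (pvar R 0 + xi) (pvar R 1 + eta) (pvar R 0 + al) (pvar R 1 + be).

Lemma peval_pvar n (i : 'I_n) (v : 'rV[R]_n) : peval (pvar R i) v = v 0 i.
Proof. exact: mevalXU. Qed.

Lemma pevalD n (A B : mpoly n R) v : peval (A + B) v = peval A v + peval B v.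
Proof. exact: mevalD. Qed.

Lemma pevalB n (A B : mpoly n R) v : peval (A - B) v = peval A v - peval B v.
Proof. exact: mevalB. Qed.

Lemma pevalM n (A B : mpoly n R) v : peval (A * B) v = peval A v * peval B v.
Proof. exact: mevalM. Qed.

Lemma peval_bilin v : peval bilin v = v 0 0 + v 0 1 * v 0 (2 : 'I_3).
Proof. by rewrite pevalD pevalM !peval_pvar. Qed.

Lemma peval_sub_xy p v : peval (sub_xy p) v = peval p (xy_part (peval bilin) v).
Proof.
rewrite /peval comp_mpoly_meval; apply: meval_eq; apply: ord2P.
  by rewrite (tnth_nth 0) /= row2_0 mevalXU.
by rewrite (tnth_nth 0) /= row2_1.
Qed.

Lemma peval_sub_ab p v : peval (sub_ab p) v = peval p (ab_part v).
Proof.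
rewrite /peval comp_mpoly_meval; apply: meval_eq; apply: ord2P.
  by rewrite (tnth_nth 0) /= row2_0 mevalXU.
by rewrite (tnth_nth 0) /= row2_1 mevalXU.
Qed.

Lemma peval_infinitesimal xi eta al be v : peval (infinitesimal xi eta al be) v =
  peval eta (xy_part (peval bilin) v) - peval al (ab_part v)
  - v 0 (2 : 'I_3) * peval be (ab_part v) - v 0 1 * peval xi (xy_part (peval bilin) v).
Proof.
by rewrite /infinitesimal !pevalB !pevalM !peval_pvar !peval_sub_xy !peval_sub_ab.
Qed.

Lemma wbigO_xy_part F : O 2 F -> forall j : 'I_2, O (nth 0%N w_xy j) (fun v => xy_part F v 0 j).
Proof.
move=> HF; apply: ord2P.
  apply: (wbigO_ext (f := fun v => v 0 (2 : 'I_3))) => [v|]; first by rewrite row2_0.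
  exact: (wbigO_coord R w_abx (2 : 'I_3)).
by apply: wbigO_ext HF => v; rewrite row2_1.
Qed.

Lemma wbigO_ab_part (j : 'I_2) : O (nth 0%N w_ab j) (fun v => ab_part v 0 j).
Proof.
move: j; apply: ord2P.
  apply: (wbigO_ext (f := fun v => v 0 (0 : 'I_3))) => [v|]; first by rewrite row2_0.
  exact: (wbigO_coord R w_abx (0 : 'I_3)).
apply: (wbigO_ext (f := fun v => v 0 (1 : 'I_3))) => [v|]; first by rewrite row2_1.
  exact: (wbigO_coord R w_abx (1 : 'I_3)).
Qed.

Lemma whomog_bigO ws (n k : nat) (p : mpoly n.+1 R) : whomog ws k p -> wbigO ws k (peval p).
Proof. by move=> hp; apply: wbigO_peval => m /hp ->. Qed.

Lemma wbigO_peval_xy F p k : O 2 F -> whomog w_xy k p -> O k (fun v => peval p (xy_part F v)).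
Proof. by move=> HF /whomog_bigO hp; apply: wbigO_comp xy_gt0 hp _; exact: wbigO_xy_part. Qed.

Lemma wbigO_peval_ab p k : whomog w_ab k p -> O k (fun v => peval p (ab_part v)).
Proof. by move=> /whomog_bigO hp; apply: wbigO_comp ab_gt0 hp _; exact: wbigO_ab_part. Qed.

Lemma weight_abx (m : multinom 3) : weight w_abx m = (2 * m 0%R + m 1%R + m (2%R : 'I_3))%N.
Proof.
rewrite /weight !big_ord_recl big_ord0 /= addn0 !mul1n addnA.
by congr (2 * m _ + m _ + m _)%N; apply/val_inj.
Qed.

Lemma mcoeff_bilin (m : multinom 3) : mcoeff m bilin =
  (mnm1 0 == m)%:R + (mnm_add (mnm1 1) (mnm1 (2 : 'I_3)) == m)%:R.
Proof. by rewrite /bilin /pvar -mpolyXD mcoeffD !mcoeffX. Qed.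

Lemma mcoeff_bilin0 (m : multinom 3) : weight w_abx m != 2%N -> mcoeff m bilin = 0.
Proof.
move=> wm; rewrite mcoeff_bilin; case: eqP => [E|_].
  by rewrite -E weight_abx !mnm1E in wm.
case: eqP => [E|_]; last by rewrite addr0.
by rewrite -E weight_abx !mnmDE !mnm1E in wm.
Qed.

Section Elementary.
Variables (e : nat) (xi eta al be : mpoly 2 R).
Hypotheses (e_gt0 : (0 < e)%N)
  (hxi : whomog w_xy e.+1 xi) (heta : whomog w_xy e.+2 eta)
  (hal : whomog w_ab e.+2 al) (hbe : whomog w_ab e.+1 be).

Let Phi := elementary_map xi eta al be.
Let chart F := chart_map F (xy_map Phi) (ab_map Phi).

Lemma xy_mapE q : xy_map Phi q = row2 (q 0 0 + peval xi q) (q 0 1 + peval eta q).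
Proof. by rewrite /xy_map /= !pevalD !peval_pvar. Qed.

Lemma ab_mapE q : ab_map Phi q = row2 (q 0 0 + peval al q) (q 0 1 + peval be q).
Proof. by rewrite /ab_map /= !pevalD !peval_pvar. Qed.

Lemma chartE F v : chart F v =
  row3 (v 0 0 + peval al (ab_part v)) (v 0 1 + peval be (ab_part v))
       (v 0 (2 : 'I_3) + peval xi (xy_part F v)).
Proof. by rewrite /chart /chart_map ab_mapE xy_mapE !row2_0 !row2_1. Qed.

Lemma smooth_polymap (p1 p2 : mpoly 2 R) :
  smooth_map_near0 (fun q => row2 (peval p1 q) (peval p2 q)).
Proof. by apply: smooth_row2; exact: smooth_peval. Qed.

Lemma elementary_admissible : admissible Phi.
Proof.
split.
  apply: (weighted_local_diffeo xy_gt0); first by left; apply: ord2P; apply: ord2P.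
    exact: smooth_polymap.
  apply: ord2P.
    apply: wbigO_ext (wbigO_le _ (whomog_bigO hxi)) => [q|]; last by [].
    by rewrite xy_mapE row2_0 addrAC subrr add0r.
  apply: wbigO_ext (wbigO_le _ (whomog_bigO heta)) => [q|]; last by [].
  by rewrite xy_mapE row2_1 addrAC subrr add0r.
apply: (weighted_local_diffeo ab_gt0); first by right; apply: ord2P; apply: ord2P.
  exact: smooth_polymap.
apply: ord2P.
  apply: wbigO_ext (wbigO_le _ (whomog_bigO hal)) => [q|]; last by [].
  by rewrite ab_mapE row2_0 addrAC subrr add0r.
apply: wbigO_ext (wbigO_le _ (whomog_bigO hbe)) => [q|]; last by [].
by rewrite ab_mapE row2_1 addrAC subrr add0r.
Qed.

Lemma chart_diff F : O 2 F ->
  forall i : 'I_3, O (nth 0%N w_abx i + e) (fun v => chart F v 0 i - v 0 i).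
Proof.
move=> HF; apply: ord3P.
- apply: wbigO_ext (wbigO_peval_ab hal) => v.
  by rewrite chartE row3_0 addrAC subrr add0r.
- apply: wbigO_ext (wbigO_peval_ab hbe) => v.
  by rewrite chartE row3_1 addrAC subrr add0r.
- apply: wbigO_ext (wbigO_peval_xy HF hxi) => v.
  by rewrite chartE row3_2 addrAC subrr add0r.
Qed.

Lemma chart_local_diffeo F : smooth_near0 F -> F 0 = 0 -> O 2 F -> local_diffeo0 (chart F).
Proof.
move=> sF F0 HF; apply: (weighted_local_diffeo abx_gt0).
- by right; apply: ord3P; apply: ord3P.
- have sxy := smooth_xy_part sF; have xy0 := xy_part0 F0.
  have s1 := smooth_map_comp (smooth_polymap (polX Phi) (polY Phi)) sxy xy0.
  have s2 := smooth_map_comp (smooth_polymap (polA Phi) (polB Phi)) (@smooth_ab_part R) (ab_part0 R).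
  exact: (smooth_row3 (s2 0) (s2 1) (s1 0)).
- by move=> i; apply: wbigO_le (chart_diff HF i); rewrite -addn1 leq_add2l.
Qed.

(** The image satisfies [Fs (a + al, b + be, x + xi) = F + eta], where [xi] and
    [eta] are taken at [(x, F)].  Every variable moves by [e] more than its
    weight, so the terms of weight at least 3 of [Q] contribute nothing up to
    weight [e + 2].  The part [a + b * x] contributes [al + x * be + b * xi],
    and [F] may be replaced by [a + b * x] inside [xi] and [eta].  That [Q] has
    no terms of weight below 2 and agrees with [P] up to weight 2 comes from the
    same equation, first at lower orders: knowing that [Q] starts in weight [k]
    determines it up to weight [k + e - 1]. *)
Lemma transformed_jet F Fs P Q :
  O e.+3 (fun v => F v - peval P v) -> O e.+3 (fun v => Fs v - peval Q v) ->
  (forall m, (weight w_abx m <= 2)%N -> mcoeff m P = mcoeff m bilin) ->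
  (\forall v \near (0 : 'rV[R]_3), Fs (chart F v) = xy_map Phi (xy_part F v) 0 1) ->
  forall m, (weight w_abx m <= e.+2)%N ->
    mcoeff m Q = mcoeff m (P + infinitesimal xi eta al be).
Proof.
move=> HF HQ HP Heq.
have HPb : forall m, m \in msupp P -> (2 <= weight w_abx m)%N.
  move=> m; rewrite mcoeff_msupp; apply: contraNleq => wm.
  by rewrite HP ?(ltnW wm) // mcoeff_bilin0 // ltn_eqF.
have OS : O 2 (peval bilin).
  apply: wbigO_peval => m; rewrite mcoeff_msupp; apply: contraNleq => wm.
  by rewrite mcoeff_bilin0 // ltn_eqF.
have OF : O 2 F.
  have := wbigOD (wbigO_le (isT : (2 <= e.+3)%N) HF) (wbigO_peval HPb).
  by apply: wbigO_ext => v; rewrite subrK.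
have OFS : O 3 (fun v => F v - peval bilin v).
  have H1 : O 3 (peval (P - bilin)).
    apply: wbigO_peval => m; rewrite mcoeff_msupp mcoeffB; apply: contraNleq => wm.
    by rewrite HP // subrr.
  apply: wbigO_ext (wbigOD (wbigO_le (isT : (3 <= e.+3)%N) HF) H1) => v.
  by rewrite pevalB; ring.
have Gd := chart_diff OF.
have Oeta := wbigO_peval_xy OF heta.
have HQG : O e.+3 (fun v => peval Q (chart F v) - peval P v - peval eta (xy_part F v)).
  have OG (i : 'I_3) : O (nth 0%N w_abx i) (fun v => chart F v 0 i).
    have := wbigOD (wbigO_le (leq_addr e _) (Gd i)) (wbigO_coord R w_abx i).
    by apply: wbigO_ext => v; rewrite subrK.
  have H := wbigOB HF (wbigO_comp abx_gt0 HQ OG).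
  apply: (wbigO_near abx_gt0 _ H); apply: filterS Heq => v /= ->.
  by rewrite xy_mapE row2_1 /xy_part row2_1; ring.
(* The estimate is used with k = 0, 1, 2 in turn; each use raises the known
   initial weight of Q, since e is positive. *)
have step k : (k <= 2)%N -> (forall m, m \in msupp Q -> (k <= weight w_abx m)%N) ->
    forall m, m \in msupp (Q - P) -> (k + e <= weight w_abx m)%N.
  move=> k2 Hk; apply: (wbigO_peval_weight abx_gt0).
  have H1 := wbigO_peval_comp (wbigO_coord R w_abx) Gd Hk.
  have kee : (k + e <= e.+2)%N by rewrite addnC -addn2 leq_add2l.
  have H2 := wbigOB (wbigO_le (leq_trans kee (leqnSn _)) HQG) H1.
  apply: wbigO_ext (wbigOD H2 (wbigO_le kee Oeta)) => v.
  by rewrite pevalB; ring.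
have suppQ k : (k <= 2)%N -> (forall m, m \in msupp (Q - P) -> (k <= weight w_abx m)%N) ->
    forall m, m \in msupp Q -> (k <= weight w_abx m)%N.
  move=> k2 Hk m; rewrite -{1}(subrK P Q) => /msuppD_le; rewrite mem_cat => /orP[/Hk //|/HPb].
  exact: leq_trans.
have Q1 : forall m, m \in msupp Q -> (1 <= weight w_abx m)%N.
  by apply: suppQ => // m /(step 0%N isT (fun _ _ => leq0n _)); exact: leq_trans.
have Q2 : forall m, m \in msupp Q -> (2 <= weight w_abx m)%N.
  by apply: suppQ => // m /(step 1%N isT Q1); apply: leq_trans; rewrite addnC addn1 ltnS.
have Q3 := step 2%N isT Q2.
have HQ' : forall m, m \in msupp (Q - bilin) -> (3 <= weight w_abx m)%N.
  move=> m; rewrite mcoeff_msupp mcoeffB; apply: contraNleq => wm.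
  rewrite -HP // -mcoeffB mcoeff_eq0; apply/negP => /Q3.
  by rewrite leqNgt (leq_trans wm) // (leq_add2l 2 1).
have H1 := wbigO_peval_comp (wbigO_coord R w_abx) Gd HQ'; rewrite add3n in H1.
have Oxi := wbigO_peval_xy OF hxi.
have H2 : O e.+3 (fun v => peval be (ab_part v) * peval xi (xy_part F v)).
  apply: wbigO_le (wbigOM (wbigO_peval_ab hbe) Oxi).
  by rewrite addSn addnS !ltnS -[e.+1]addn1 leq_add2l.
have Oxy1 (j : 'I_2) : O (nth 0%N w_xy j + 1)
    (fun v => xy_part F v 0 j - xy_part (peval bilin) v 0 j).
  move: j; apply: ord2P.
    apply: (wbigO_ext (f := fun=> 0)) => [v|]; last exact: wbigO0.
    by rewrite /xy_part !row2_0 subrr.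
  apply: (wbigO_ext (f := fun v => F v - peval bilin v)) => [v|]; last exact: OFS.
  by rewrite /xy_part !row2_1.
have hx m : m \in msupp xi -> (e.+1 <= weight w_xy m)%N by move=> /hxi ->.
have H3 := wbigO_peval_comp (wbigO_xy_part OS) Oxy1 hx.
have he m : m \in msupp eta -> (e.+2 <= weight w_xy m)%N by move=> /heta ->.
have H4 := wbigO_peval_comp (wbigO_xy_part OS) Oxy1 he.
rewrite addn1 in H3; rewrite addn1 in H4.
have H5 := wbigOM (wbigO_coord R w_abx (1 : 'I_3)) H3.
(* H2 disposes of the only quadratic term, the product of be and xi. *)
have H : O e.+3 (peval (Q - (P + infinitesimal xi eta al be))).
  apply: wbigO_ext (wbigOB (wbigOB (wbigOB (wbigOD HQG H4) H1) H5) H2) => v.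
  rewrite !pevalB pevalD peval_infinitesimal !peval_bilin chartE row3_0 row3_1 row3_2.
  ring.
move=> m wm; apply/eqP; rewrite -subr_eq0 -mcoeffB mcoeff_eq0; apply/negP.
by move=> /(wbigO_peval_weight abx_gt0 H); rewrite leqNgt ltnS wm.
Qed.

End Elementary.
End Transform.

(** * Coefficients of the linearized action *)
Section Coefficients.
Variable R : realType.
Implicit Types (xi eta al be p : mpoly 2 R).

Definition mon2 (i j : nat) : multinom 2 := (Multinom [tuple (if k == 0%R then i else j)%N | k < 2]).

Definition coef2 p (i j : nat) : R := mcoeff (mon2 i j) p.

Lemma mon2P (m : multinom 2) i j : (m == mon2 i j) = (m 0 == i) && (m 1 == j).
Proof.
apply/eqP/andP => [->|[/eqP m0 /eqP m1]]; first by rewrite !mnmE.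
by apply/mnmP; apply: ord2P; rewrite mnmE.
Qed.

Lemma sum_msupp_pick n (p : mpoly n R) m :
  \sum_(k <- msupp p) mcoeff k p * (k == m)%:R = mcoeff m p.
Proof.
rewrite [in RHS](mpolyE p) raddf_sum /=; apply: eq_bigr => k _.
by rewrite mcoeffZ mcoeffX.
Qed.

Lemma mcoeff_var_mul n (p : mpoly n R) i m :
  mcoeff m (pvar R i * p) = if (0 < m i)%N then mcoeff (mnm_sub m (mnm1 i)) p else 0.
Proof.
have E : pvar R i * p = \sum_(k <- msupp p) mcoeff k p *: mpolyX R (mnm_add (mnm1 i) k).
  rewrite [in LHS](mpolyE p) mulr_sumr; apply: eq_bigr => k _.
  by rewrite /pvar -scalerAr -mpolyXD.
rewrite E raddf_sum /=; under eq_bigr do rewrite mcoeffZ mcoeffX.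
case: ifP => [mi|/negbT mi].
  rewrite -sum_msupp_pick; apply: eq_bigr => k _; congr (_ * (_ : bool)%:R).
  apply/eqP/eqP => [<-|->].
    by apply/mnmP => j; rewrite mnmBE mnmDE addKn.
  apply/mnmP => j; rewrite mnmDE mnmBE mnm1E subnKC //.
  by case: eqP => // <-.
rewrite big1 // => k _; case: eqP => [km|_]; last by rewrite mulr0.
by case/negP: mi; rewrite -km mnmDE mnm1E eqxx.
Qed.

Lemma mcoeff_sub_ab p (m : multinom 3) :
  mcoeff m (sub_ab p) = if m (2 : 'I_3) == 0%N then coef2 p (m 0) (m 1) else 0.
Proof.
rewrite /sub_ab comp_mpolyEX raddf_sum /=.
have E (k : multinom 2) : comp_mpoly [tuple pvar R (0 : 'I_3); pvar R 1] (mpolyX R k) =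
   mpolyX R (Multinom [tuple (if j == 0%R then k 0%R else if j == 1%R then k 1%R else 0)%N | j < 3]).
  rewrite comp_mpolyX big_ord_recl big_ord_recl big_ord0 mulr1 /= !(tnth_nth 0) /=.
  rewrite /pvar !mpolyXn -mpolyXD; congr (mpolyX R _); apply/mnmP; apply: ord3P.
  - by rewrite !(mnmDE, mulmnE, mnm1E) mnmE /= ?(mul0n, mul1n, addn0, add0n).
  - rewrite !(mnmDE, mulmnE, mnm1E) mnmE /= ?(mul0n, mul1n, addn0, add0n).
    by congr (fun_of_multinom k _); apply/val_inj.
  - by rewrite !(mnmDE, mulmnE, mnm1E) mnmE /= ?(mul0n, mul1n, addn0, add0n).
under eq_bigr do rewrite mcoeffZ E mcoeffX.
case: ifP => [/eqP m2|m2].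
  rewrite /coef2 -sum_msupp_pick; apply: eq_bigr => k _; congr (_ * (_ : bool)%:R).
  rewrite mon2P; apply/eqP/andP => [<-|[/eqP k0 /eqP k1]].
    by rewrite !mnmE.
  by apply/mnmP; apply: ord3P; rewrite mnmE.
rewrite big1 // => k _; case: eqP => [km|_]; last by rewrite mulr0.
by move: m2; rewrite -km mnmE.
Qed.

Lemma mcoeff_bilin_pow (i j : nat) (m : multinom 3) :
  mcoeff m (pvar R (2 : 'I_3) ^+ i * bilin R ^+ j) =
  if (j == m 0%R + m 1%R)%N && (i + m 1%R == m (2%R : 'I_3))%N then 'C(j, m 1%R)%:R else 0.
Proof.
rewrite /bilin exprDn mulr_sumr raddf_sum /=.
have E (k : 'I_j.+1) : pvar R (2 : 'I_3) ^+ i *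
    (pvar R (0 : 'I_3) ^+ (j - k) * (pvar R 1 * pvar R (2 : 'I_3)) ^+ k *+ 'C(j, k)) =
   'C(j, k)%:R *: mpolyX R (Multinom [tuple (if h == 0%R then j - k else if h == 1%R then (k : nat)
      else i + k)%N | h < 3]).
  rewrite mulrnAr -scaler_nat; congr (_ *: _).
  rewrite /pvar -mpolyXD !mpolyXn -!mpolyXD; congr (mpolyX R _); apply/mnmP; apply: ord3P.
  - by rewrite !(mnmDE, mulmnE, mnm1E) mnmE /= ?(mul0n, mul1n, addn0, add0n).
  - by rewrite !(mnmDE, mulmnE, mnm1E) mnmE /= ?(mul0n, mul1n, addn0, add0n).
  - by rewrite !(mnmDE, mulmnE, mnm1E) mnmE /= ?(mul0n, mul1n, addn0, add0n).
under eq_bigr do rewrite E mcoeffZ mcoeffX.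
case: ifP => [/andP[/eqP jE /eqP iE]|H].
  have kj : (m 1%R < j.+1)%N by rewrite jE ltnS leq_addl.
  rewrite (bigD1 (Ordinal kj)) //= big1 ?addr0 => [|k].
    rewrite (_ : _ == m) ?mulr1 //; apply/eqP/mnmP; apply: ord3P; rewrite mnmE //=.
    by rewrite jE addnK.
  rewrite -val_eqE /= => km; case: eqP => [kE|_]; last by rewrite mulr0.
  by case/eqP: km; rewrite -kE mnmE.
rewrite big1 // => k _; case: eqP => [kE|_]; last by rewrite mulr0.
move/negP: H => []; rewrite -kE !mnmE /= subnK ?eqxx //.
by rewrite -ltnS.
Qed.

Lemma mcoeff_sub_xy p (m : multinom 3) : mcoeff m (sub_xy p) =
  if (m 1%R <= m (2%R : 'I_3))%N then
    'C(m 0%R + m 1%R, m 1%R)%:R * coef2 p (m (2%R : 'I_3) - m 1%R)%N (m 0%R + m 1%R)%N else 0.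
Proof.
rewrite /sub_xy comp_mpolyEX raddf_sum /=.
have E (k : multinom 2) : comp_mpoly [tuple pvar R (2 : 'I_3); bilin R] (mpolyX R k) =
   pvar R (2 : 'I_3) ^+ k 0 * bilin R ^+ k 1.
  rewrite comp_mpolyX big_ord_recl big_ord_recl big_ord0 mulr1 /= !(tnth_nth 0) /=.
  by congr (_ * _ ^+ k _); apply/val_inj.
under eq_bigr do rewrite mcoeffZ E mcoeff_bilin_pow.
case: ifP => [m12|m12].
  rewrite /coef2 -sum_msupp_pick mulr_sumr; apply: eq_bigr => k _; rewrite mon2P.
  rewrite (_ : (k 0%R + m 1%R == m (2%R : 'I_3))%N = (k 0%R == (m (2%R : 'I_3) - m 1%R)%N)).
    rewrite andbC mulrCA; case: (_ == _) => /=; last by rewrite !mulr0.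
    by case: eqP => [->|_]; rewrite ?mulr1 ?mulr0.
  by rewrite -(eqn_add2r (m 1%R) (k 0%R)) subnK.
rewrite big1 // => k _; case: ifP => [/andP[_ /eqP H]|_]; last by rewrite mulr0.
by move: m12; rewrite -H leq_addl.
Qed.

(** The coefficient of [a^i b^k x^j] in the infinitesimal action, in terms of the
    coefficients of [eta], [xi] (of [x^p y^q]) and of [al], [be] (of [a^p b^q]).
    The binomials come from expanding powers of [a + b * x]. *)
Definition inf_coef (eta al be xi : nat -> nat -> R) (i k j : nat) : R :=
  (if (k <= j)%N then 'C(i + k, k)%:R * eta (j - k)%N (i + k)%N else 0)
  - (if j == 0%N then al i k else 0) - (if j == 1%N then be i k else 0)
  - (if (0 < k <= j.+1)%N then 'C((i + k).-1, k.-1)%:R * xi (j.+1 - k)%N (i + k).-1%N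
     else 0).

Lemma mcoeff_infinitesimal xi eta al be (m : multinom 3) :
  mcoeff m (infinitesimal xi eta al be) =
  inf_coef (coef2 eta) (coef2 al) (coef2 be) (coef2 xi) (m 0) (m 1) (m (2 : 'I_3)).
Proof.
rewrite /infinitesimal /inf_coef !mcoeffB !mcoeff_var_mul mcoeff_sub_xy !mcoeff_sub_ab.
rewrite mcoeff_sub_xy !mnmBE !mnm1E /= subn0.
congr (_ - _ - _ - _).
  by case: (m (2 : 'I_3)) => [|[|j]] //=; rewrite !subn0.
case: (m 1) => [|k]; first by [].
rewrite /= subn1 subn0 /= ltnS addnS /=.
by case: ifP => // _; rewrite subSS.
Qed.

End Coefficients.

(** * The linear system for the excluded monomials *)
Section Triangular.
Variable R : realType.

Definition excluded_kj (k j : nat) : bool :=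
  [|| k == 0, j == 0, k == 1, j == 1
    | (k, j) \in [:: (2, 2); (2, 3); (3, 2); (3, 3)]]%N.

Lemma natr_bin2 i : 'C(i.+2, 2)%:R = (i%:R + 2) * (i%:R + 1) / 2 :> R.
Proof.
have E : ('C(i.+2, 2) * 2 = i.+2 * i.+1)%N.
  by have := bin_ffact i.+2 2; rewrite !ffactnS ffactn0 muln1.
have := congr1 (fun m => m%:R : R) E.
rewrite /= !natrM ?(natrD R i 3, natrD R i 2, natrD R i 1, =^~ addn1 i, =^~ addn2 i, =^~ addn3 i).
move: ('C(_, _)%:R) (i%:R) => c x E'; rewrite [LHS](_ : _ = c * 2 / 2); first by rewrite E'; field.
by field.
Qed.

Lemma natr_bin3 i : 'C(i.+3, 3)%:R = (i%:R + 3) * (i%:R + 2) * (i%:R + 1) / 6 :> R.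
Proof.
have E : ('C(i.+3, 3) * 6 = i.+3 * (i.+2 * i.+1))%N.
  by have := bin_ffact i.+3 3; rewrite !ffactnS ffactn0 muln1.
have := congr1 (fun m => m%:R : R) E.
rewrite /= !natrM ?(natrD R i 3, natrD R i 2, natrD R i 1, =^~ addn1 i, =^~ addn2 i, =^~ addn3 i).
move: ('C(_, _)%:R) (i%:R) => c x E'; rewrite [LHS](_ : _ = c * 6 / 6); first by rewrite E'; field.
by field.
Qed.

Lemma natrS1 i : i.+1%:R = i%:R + 1 :> R. Proof. by rewrite -addn1 natrD. Qed.
Lemma natrS2 i : i.+2%:R = i%:R + 2 :> R. Proof. by rewrite -addn2 natrD. Qed.
Lemma natrS3 i : i.+3%:R = i%:R + 3 :> R. Proof. by rewrite -addn3 natrD. Qed.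

Section Shapes.
Variables (eta al be xi : nat -> nat -> R).
Local Notation L := (inf_coef eta al be xi).

Lemma inf_coef_00 i : L i 0%N 0%N = eta 0%N i - al i 0%N.
Proof. by rewrite /inf_coef /= !addn0 bin0; ring. Qed.

Lemma inf_coef_01 i : L i 0%N 1%N = eta 1%N i - be i 0%N.
Proof. by rewrite /inf_coef /= !addn0 bin0; ring. Qed.

Lemma inf_coef_02 i j : L i 0%N j.+2 = eta j.+2 i.
Proof. by rewrite /inf_coef /= !addn0 bin0; ring. Qed.

Lemma inf_coef_10 i : L i 1%N 0%N = - al i 1%N - xi 0%N i.
Proof. by rewrite /inf_coef /= !addn1 /= bin0; ring. Qed.

Lemma inf_coef_20 i k : L i k.+2 0%N = - al i k.+2.
Proof. by rewrite /inf_coef /=; ring. Qed.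

Lemma inf_coef_11 i : L i 1%N 1%N = i.+1%:R * eta 0%N i.+1 - be i 1%N - xi 1%N i.
Proof. by rewrite /inf_coef /= !addn1 /= bin1 bin0; ring. Qed.

Lemma inf_coef_12 i j : L i 1%N j.+2 = i.+1%:R * eta j.+1 i.+1 - xi j.+2 i.
Proof. by rewrite /inf_coef /= !addn1 /= bin1 bin0 subn1; ring. Qed.

Lemma inf_coef_21 i : L i 2%N 1%N = - be i 2%N - i.+1%:R * xi 0%N i.+1.
Proof. by rewrite /inf_coef /= !addn2 /= bin1; ring. Qed.

Lemma inf_coef_31 i k : L i k.+3 1%N = - be i k.+3.
Proof. by rewrite /inf_coef /=; ring. Qed.

Lemma inf_coef_22 i : L i 2%N 2%N = (i%:R + 2) * (i%:R + 1) / 2 * eta 0%N i.+2 - i.+1%:R * xi 1%N i.+1.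
Proof. by rewrite /inf_coef /= !addn2 /= bin1 natr_bin2; ring. Qed.

Lemma inf_coef_23 i : L i 2%N 3%N = (i%:R + 2) * (i%:R + 1) / 2 * eta 1%N i.+2 - i.+1%:R * xi 2%N i.+1.
Proof. by rewrite /inf_coef /= !addn2 /= bin1 natr_bin2; ring. Qed.

Lemma inf_coef_32 i : L i 3%N 2%N = - ((i%:R + 2) * (i%:R + 1) / 2 * xi 0%N i.+2).
Proof. by rewrite /inf_coef /= !addn3 /= natr_bin2; ring. Qed.

Lemma inf_coef_33 i : L i 3%N 3%N = (i%:R + 3) * (i%:R + 2) * (i%:R + 1) / 6 * eta 0%N i.+3
   - (i%:R + 2) * (i%:R + 1) / 2 * xi 1%N i.+2.
Proof. by rewrite /inf_coef /= !addn3 /= natr_bin2 natr_bin3; ring. Qed.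

End Shapes.

Lemma excluded_kj_ind (T : nat -> nat -> Prop) : T 0%N 0%N -> T 0%N 1%N -> (forall j, T 0%N j.+2) ->
  T 1%N 0%N -> (forall k, T k.+2 0) -> T 1%N 1%N -> (forall j, T 1%N j.+2) ->
  T 2%N 1%N -> (forall k, T k.+3 1) -> T 2%N 2%N -> T 2%N 3%N -> T 3%N 2%N -> T 3%N 3%N ->
  forall k j, excluded_kj k j -> T k j.
Proof.
by move=> T00 T01 T02 T10 T20 T11 T12 T21 T31 T22 T23 T32 T33
  [|[|[|[|k]]]] [|[|[|[|j]]]].
Qed.

(** The action preserves [d = j - k], and for given [d] and total degree the
    monomials are [a^(N-m) (b x)^m] times [x^d] or [b^(-d)].  There are at most
    four unknowns, one coefficient of each component, and as many excluded
    monomials.  For [|d| >= 2] the system is triangular; for [d = 1], [0], [-1]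
    the additional excluded monomials [b^2 x^3], [b^2 x^2] and [b^3 x^3],
    [b^3 x^2] give [eta] (for [d = 1]), [eta] and [xi] (for [d = 0]) and [xi]
    (for [d = -1]), the other unknowns following by back substitution. *)
Lemma inf_coef_solve (t : nat -> nat -> nat -> R) :
  exists eta al be xi : nat -> nat -> R,
  forall i k j, excluded_kj k j -> inf_coef eta al be xi i k j = t i k j.
Proof.
(* For small q the equations for b^2 x^2 and its three companions do not occur
   and the denominators vanish; the convention 1 / 0 = 0 then gives the value 0,
   and the remaining equations can still be solved. *)
pose c2 q : R := q%:R * (q%:R - 1) / 2.
pose eta p q : R := match p with
  | 0%N => ((q%:R - 2) / 2 * t (q - 2)%N 2%N 2%N - t (q - 3)%N 3%N 3%N) * 6 / ((q%:R - 2) * c2 q)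
  | 1%N => ((q%:R - 1) * t (q - 1)%N 1%N 2%N - t (q - 2)%N 2%N 3%N) / c2 q
  | _ => t q%N 0%N p%N
  end.
pose xi p q : R := match p with
  | 0%N => - t (q - 2)%N 3%N 2%N / c2 q
  | 1%N => (c2 q.+1 * eta 0%N q.+1 - t (q - 1)%N 2%N 2%N) / q%:R
  | _ => q.+1%:R * eta p.-1 q.+1 - t q%N 1%N p%N
  end.
pose be p q : R := match q with
  | 0%N => eta 1%N p - t p%N 0%N 1%N
  | 1%N => p.+1%:R * eta 0%N p.+1 - xi 1%N p - t p%N 1%N 1%N
  | 2%N => - t p%N 2%N 1%N - p.+1%:R * xi 0%N p.+1
  | _ => - t p%N q%N 1%N
  end.
pose al p q : R := match q with
  | 0%N => eta 0%N p - t p%N 0%N 0%N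
  | 1%N => - t p%N 1%N 0%N - xi 0%N p
  | _ => - t p%N q%N 0%N
  end.
exists eta, al, be, xi => i k j; move: k j; apply: excluded_kj_ind => [||j||k||j||k||||].
- by rewrite inf_coef_00 /al; ring.
- by rewrite inf_coef_01 /be; ring.
- by rewrite inf_coef_02.
- by rewrite inf_coef_10 /al; ring.
- by rewrite inf_coef_20 /al opprK.
- by rewrite inf_coef_11 /be; ring.
- by rewrite inf_coef_12 /xi /=; ring.
- by rewrite inf_coef_21 /be; ring.
- by rewrite inf_coef_31 /be opprK.
all: have i0 : 0 <= i%:R :> R by [].
- rewrite inf_coef_22 /xi subSS subn0; move: (eta 0%N i.+2) => a.
  by rewrite /c2 natrS2 natrS1; field; lra.
- rewrite inf_coef_23 /xi -[2.-1]/1%N /eta !subSS !subn0.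
  by rewrite /c2 natrS2; field; lra.
- rewrite inf_coef_32 /xi /c2 !subSS subn0 natrS2; field; lra.
- rewrite inf_coef_33 /xi /eta /c2 !subSS !subn0 natrS3 natrS2; field; lra.
Qed.

(** The same systems are nonsingular when all excluded monomials occur, that is
    for [N >= 2], and [N >= 3] if [d = 0].  With total weight [n = 2 N + |d|]
    this holds as soon as [n > 5]. *)
Lemma inf_coef_inj (eta al be xi : nat -> nat -> R) n : (5 < n)%N ->
  (forall i k j, (2 * i + k + j = n)%N -> excluded_kj k j -> inf_coef eta al be xi i k j = 0) ->
  [/\ forall p q, (p + 2 * q = n)%N -> eta p q = 0,
      forall p q, (2 * p + q = n)%N -> al p q = 0,
      forall p q, (2 * p + q).+1 = n -> be p q = 0 &
      forall p q, (p + 2 * q).+1 = n -> xi p q = 0].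
Proof.
move=> n5 H.
have eta2 p q : (p.+2 + 2 * q = n)%N -> eta p.+2 q = 0.
  by move=> E; rewrite -(H q 0%N p.+2) ?inf_coef_02 //; lia.
have xi3 p q : (p.+3 + 2 * q).+1 = n -> xi p.+3 q = 0.
  move=> E; have := H q 1%N p.+3; rewrite inf_coef_12 eta2; last by lia.
  by move=> /(_ _ isT) => F; have := F ltac:(lia); lra.
have eta1xi2 q : (1 + 2 * q = n)%N -> eta 1%N q = 0 /\ xi 2 q.-1 = 0.
  case: q => [|[|q]] E; try by lia.
  have := H q.+1 1%N 2%N ltac:(lia) isT; rewrite inf_coef_12.
  have := H q 2%N 3%N ltac:(lia) isT; rewrite inf_coef_23 /=.
  have q0 : 0 <= q%:R :> R by [].
  rewrite ?(natrS2 q) ?(natrS1 q); move: (eta _ _) (xi _ _) (q%:R) q0 => x y z z0 E1 E2.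
  have y_ : y = (z + 2) * x by lra.
  rewrite y_ in E1.
  have : (z + 2) * (z + 1) * x = 0 by move: E1; lra.
  move=> /eqP; rewrite !mulf_eq0; case/orP => [/orP[]|] /eqP; try by lra.
  by move=> x0; rewrite y_ x0 mulr0.
have eta0xi1 q : (2 * q = n)%N -> eta 0%N q = 0 /\ xi 1 q.-1 = 0.
  case: q => [|[|[|q]]] E; try by lia.
  have := H q.+1 2%N 2%N ltac:(lia) isT; rewrite inf_coef_22.
  have := H q 3%N 3%N ltac:(lia) isT; rewrite inf_coef_33 /=.
  have q0 : 0 <= q%:R :> R by [].
  rewrite ?(natrS2 q) ?(natrS1 q); move: (eta _ _) (xi _ _) (q%:R) q0 => x y z z0 E1 E2.
  have y_ : y = (z + 3) / 2 * x.
    have nz : z + 2 != 0 by rewrite gt_eqF //; lra.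
    by apply: (mulfI nz); lra.
  rewrite y_ in E1.
  have : (z + 3) * (z + 2) * (z + 1) * x = 0 by move: E1; lra.
  move=> /eqP; rewrite !mulf_eq0 => /orP[/orP[/orP[]|]|] /eqP; try by lra.
  by move=> x0; rewrite y_ x0 mulr0.
have xi0 q : (2 * q).+1 = n -> xi 0%N q = 0.
  case: q => [|[|q]] E; try by lia.
  have := H q 3%N 2%N ltac:(lia) isT; rewrite inf_coef_32.
  have q0 : 0 <= q%:R :> R by [].
  move: (xi _ _) (q%:R) q0 => y z z0 E1.
  have : (z + 2) * (z + 1) * y = 0 by move: E1; lra.
  by move=> /eqP; rewrite !mulf_eq0 => /orP[/orP[]|] /eqP //; lra.
have eta0 p q : (p + 2 * q = n)%N -> eta p q = 0.
  case: p => [|[|p]] E; last exact: eta2.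
    by have [] := eta0xi1 q E.
  by have [] := eta1xi2 q E.
have xi_0 p q : (p + 2 * q).+1 = n -> xi p q = 0.
  case: p => [|[|[|p]]] E; last exact: xi3.
  - exact: xi0.
  - by have [] := eta0xi1 q.+1 ltac:(lia).
  - by have [] := eta1xi2 q.+1 ltac:(lia).
split=> // p q E.
  case: q E => [|[|q]] E.
  - by have := H p 0%N 0%N ltac:(lia) isT; rewrite inf_coef_00 eta0 ?sub0r; [lra|lia].
  - by have := H p 1%N 0%N ltac:(lia) isT; rewrite inf_coef_10 xi_0; [lra|lia].
  - by have := H p q.+2 0%N ltac:(lia) isT; rewrite inf_coef_20; lra.
case: q E => [|[|[|q]]] E.
- by have := H p 0%N 1%N ltac:(lia) isT; rewrite inf_coef_01 eta0; [lra|lia].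
- by have := H p 1%N 1%N ltac:(lia) isT; rewrite inf_coef_11 eta0 ?xi_0; [lra|lia|lia].
- by have := H p 2%N 1%N ltac:(lia) isT; rewrite inf_coef_21 xi_0; [lra|lia].
- by have := H p q.+3 1%N ltac:(lia) isT; rewrite inf_coef_31; lra.
Qed.

End Triangular.

(** * Second order expansions and mixed partial derivatives *)
Section MixedPartials.
Variables (R : realType) (n : nat).
Implicit Types (f : 'rV[R]_n.+1 -> R) (p : 'rV[R]_n.+1).

Local Notation e_ := (@delta_mx R 1 n.+1 0).

Lemma is_derive_translate f p c v : derivable f (p + c) v ->
  is_derive p v (fun x => f (x + c)) ('D_v f (p + c)).
Proof.
move=> df; have E : (fun h : R => h^-1 *: (f (h *: v + p + c) - f (p + c)))
   = (fun h : R => h^-1 *: (f (h *: v + (p + c)) - f (p + c))).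
  by apply/funext => h; rewrite addrA.
by split; rewrite /derivable /derive /= E.
Qed.

Lemma norm_delta_le i (s : R) : `|s *: e_ i| <= `|s|.
Proof.
apply: norm_le_coord => // k; rewrite !mxE eqxx /=.
by case: eqP => _; rewrite ?mulr1 ?mulr0 ?normr0.
Qed.

(** Two applications of the mean value theorem turn the second difference of [f]
    into [s ^+ 2] times the mixed partial derivative at a nearby point. *)
Lemma mixed_difference f i j (eps : R) : smooth_near0 f -> 0 < eps ->
  \forall s \near (0 : R),
    `|f (s *: e_ i + s *: e_ j) - f (s *: e_ i) - f (s *: e_ j) + f 0
      - s ^+ 2 * partial j (partial i f) 0| <= eps * `|s| ^+ 2.
Proof.
move=> /smooth_near0P[U [Uo U0 Hf]] e0.
have [_ /(_ i)[df Hi]] := Hf 2%N; have [_ /(_ j)[dfi Hij]] := Hi.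
have cij : {for (0 : 'rV[R]_n.+1), continuous (partial j (partial i f))}.
  by apply: (@Ck_cont _ _ U 0 _ Hij); rewrite inE.
have n1 : \forall x \near (0 : 'rV[R]_n.+1),
    U x /\ `|partial j (partial i f) 0 - partial j (partial i f) x| <= eps.
  apply: filterI; first exact: open_near.
  by move/cvgrPdist_le: cij; apply.
have [r r0 rP] := near0_ball n1.
have r20 : 0 < r / 2 by rewrite divr_gt0.
apply: filterS (near_abs_lt r20) => s sr.
have two k1 k2 (a b : R) : `|a| <= `|s| -> `|b| <= `|s| -> `|a *: e_ k1 + b *: e_ k2| < r.
  move=> a1 b1; apply: le_lt_trans (ler_normD _ _) _.
  have := norm_delta_le k1 a; have := norm_delta_le k2 b; lra.
have scale1 (t : R) : 0 <= t <= 1 -> `|t * s| <= `|s|.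
  by move=> /andP[t0 t1]; rewrite normrM ler_piMl // ger0_norm.
pose phi x := f (x + s *: e_ j) - f x.
have Uin (a b : R) : `|a| <= `|s| -> `|b| <= `|s| -> a *: e_ i + b *: e_ j \in U.
  by move=> a1 b1; rewrite inE; have [] := rP _ (two i j a b a1 b1).
have dphi (t : R) : 0 <= t <= 1 -> is_derive (0 + (t * s) *: e_ i) (e_ i) phi
   (partial i f ((t * s) *: e_ i + s *: e_ j) - partial i f ((t * s) *: e_ i)).
  move=> t01; rewrite add0r.
  have d1 := is_derive_translate (df _ (Uin _ _ (scale1 t t01) (lexx _))).
  have := Uin _ 0 (scale1 t t01); rewrite normr0 scale0r addr0 => /(_ (normr_ge0 _)) Ut.
  have d2 := derivableP (df _ Ut).
  exact: is_deriveB.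
have [|t t01] := @mean_value_line R n phi 0 i s.
  by move=> t t01; apply: ex_derive; exact: dphi.
have [_ dE] := dphi t t01.
rewrite (dE : partial i phi (0 + (t * s) *: e_ i) = _) !add0r /phi add0r => E.
have [|u u01] := @mean_value_line R n (partial i f) ((t * s) *: e_ i) j s.
  by move=> u u01; apply: dfi; apply: Uin; exact: scale1.
move=> E2; rewrite E2 in E.
have -> : f (s *: e_ i + s *: e_ j) - f (s *: e_ i) - f (s *: e_ j) + f 0 =
   s * (s * partial j (partial i f) ((t * s) *: e_ i + (u * s) *: e_ j)).
  by rewrite -E; ring.
have [_ le1] := rP _ (two i j _ _ (scale1 t t01) (scale1 u u01)).
rewrite mulrA -expr2 -mulrBr normrM normrX mulrC distrC.
by rewrite ler_wpM2r // exprn_ge0.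
Qed.

End MixedPartials.

Section SecondOrder.
Variable R : realType.

Local Notation w_abx1 := [:: 1; 1; 1]%N.

Lemma abx1_gt0 (i : 'I_3) : (0 < nth 0 w_abx1 i)%N.
Proof. by case: i => [[|[|[|]]]]. Qed.

Definition mon3 (t : nat * nat * nat) : multinom 3 :=
  Multinom [tuple (if h == 0%R then t.1.1 else if h == 1%R then t.1.2 else t.2)%N | h < 3].

Lemma mon3_inj : injective mon3.
Proof.
move=> [[a b] c] [[a' b'] c'] /mnmP E.
have := E 0; have := E 1; have := E (2 : 'I_3).
by rewrite !mnmE /= => -> -> ->.
Qed.

Lemma mon3E (m : multinom 3) : mon3 (m 0, m 1, m (2 : 'I_3)) = m.
Proof. by apply/mnmP; apply: ord3P; rewrite mnmE. Qed.

Lemma weight_abx1 (m : multinom 3) : weight w_abx1 m = (m 0%R + m 1%R + m (2%R : 'I_3))%N.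
Proof.
rewrite /weight !big_ord_recl big_ord0 /= addn0 !mul1n addnA.
by congr (m _ + m _ + m _)%N; apply/val_inj.
Qed.

Lemma mpoly_supp_sum n (P : mpoly n R) (s : seq (multinom n)) : uniq s ->
  {subset msupp P <= s} -> P = \sum_(m <- s) mcoeff m P *: mpolyX R m.
Proof.
move=> us Ps; apply/mpolyP => m; rewrite raddf_sum /=.
under eq_bigr do rewrite mcoeffZ mcoeffX.
have [ms|ms] := boolP (m \in s).
  rewrite (big_rem m ms) /= eqxx mulr1 big_seq big1 ?addr0 // => k.
  by rewrite mem_rem_uniq // => /andP[/= /negPf -> _]; rewrite mulr0.
rewrite big_seq big1 => [|k ks].
  by apply/eqP; rewrite mcoeff_eq0; apply: contra ms; exact: Ps.
by case: eqP => [km|_]; [rewrite -km ks in ms|rewrite mulr0].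
Qed.

Lemma quadratic_taylor (F : 'rV[R]_3 -> R) : smooth_near0 F -> F 0 = 0 ->
  exists pa pb px paa pab pbb pax pbx pxx : R,
  wbigO w_abx1 3 (fun v => F v - (pa * v 0 0 + pb * v 0 1 + px * v 0 (2 : 'I_3)
    + paa * v 0 0 ^+ 2 + pab * v 0 0 * v 0 1 + pbb * v 0 1 ^+ 2
    + pax * v 0 0 * v 0 (2 : 'I_3) + pbx * v 0 1 * v 0 (2 : 'I_3)
    + pxx * v 0 (2 : 'I_3) ^+ 2)).
Proof.
move=> sF F0; have [P wP HP] := smooth_wjet abx1_gt0 3 sF.
pose ts : seq (nat * nat * nat) := [:: (0,0,0); (1,0,0); (0,1,0); (0,0,1); (2,0,0);
  (1,1,0); (0,2,0); (1,0,1); (0,1,1); (0,0,2)]%N.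
have PE : P = \sum_(m <- map mon3 ts) mcoeff m P *: mpolyX R m.
  apply: mpoly_supp_sum; first by rewrite (map_inj_uniq mon3_inj).
  move=> m /wP wm; rewrite -(mon3E m) (mem_map mon3_inj); move: wm; rewrite weight_abx1.
  by rewrite /ts; move: (m 0) (m 1) (m (2%R : 'I_3)) => [|[|[|i]]] [|[|[|k]]] [|[|[|j]]].
exists (mcoeff (mon3 (1,0,0)%N) P), (mcoeff (mon3 (0,1,0)%N) P), (mcoeff (mon3 (0,0,1)%N) P),
  (mcoeff (mon3 (2,0,0)%N) P), (mcoeff (mon3 (1,1,0)%N) P), (mcoeff (mon3 (0,2,0)%N) P),
  (mcoeff (mon3 (1,0,1)%N) P), (mcoeff (mon3 (0,1,1)%N) P), (mcoeff (mon3 (0,0,2)%N) P).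
have pE v : peval P v = mcoeff (mon3 (0,0,0)%N) P + (mcoeff (mon3 (1,0,0)%N) P * v 0 0
    + mcoeff (mon3 (0,1,0)%N) P * v 0 1 + mcoeff (mon3 (0,0,1)%N) P * v 0 (2 : 'I_3)
    + mcoeff (mon3 (2,0,0)%N) P * v 0 0 ^+ 2 + mcoeff (mon3 (1,1,0)%N) P * v 0 0 * v 0 1
    + mcoeff (mon3 (0,2,0)%N) P * v 0 1 ^+ 2
    + mcoeff (mon3 (1,0,1)%N) P * v 0 0 * v 0 (2 : 'I_3)
    + mcoeff (mon3 (0,1,1)%N) P * v 0 1 * v 0 (2 : 'I_3)
    + mcoeff (mon3 (0,0,2)%N) P * v 0 (2 : 'I_3) ^+ 2).
  have ev i k j : meval (fun h => v 0 h) (mpolyX R (mon3 (i, k, j))) =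
      v 0 0 ^+ i * v 0 1 ^+ k * v 0 (2 : 'I_3) ^+ j.
    rewrite mevalX !big_ord_recl big_ord0 !mnmE /= mulr1 mulrA.
    by congr (v _ _ ^+ _ * v _ _ ^+ _ * v _ _ ^+ _); apply/val_inj.
  rewrite {1}PE /peval /ts /= !big_cons big_nil !mevalD !mevalZ !ev meval0.
  move: (v 0 0) (v 0 1) (v 0 (2 : 'I_3)) => a b x.
  do 10!move: (mcoeff (mon3 _) P) => ?.
  ring.
have p0 : mcoeff (mon3 (0,0,0)%N) P = 0.
  have z i : (0 : 'rV[R]_3) 0 i = 0 by rewrite mxE.
  have := wbigO_at0 HP; rewrite F0 pE !z expr0n !mulr0 !addr0 sub0r.
  by move/eqP; rewrite oppr_eq0 => /eqP.
by apply: wbigO_ext HP => v; rewrite pE p0 add0r.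
Qed.

End SecondOrder.

(** * Nondegeneracy of regular hypersurfaces *)
Section SmoothAlgebra.
Variables (R : realType) (n : nat).
Implicit Types (f g : 'rV[R]_n.+1 -> R).

Lemma smooth_op f g (op : R -> R -> R) :
  (forall U k, open U -> Ck U k f -> Ck U k g -> Ck U k (fun x => op (f x) (g x))) ->
  smooth_near0 f -> smooth_near0 g -> smooth_near0 (fun x => op (f x) (g x)).
Proof.
move=> Hop /smooth_near0P[U [Uo U0 Hf]] /smooth_near0P[V [Vo V0 Hg]].
apply/smooth_near0P; exists (U `&` V); split=> [||k]; first exact: openI.
  by split.
apply: Hop; first exact: openI.
  by apply: Ck_sub (Hf k) => x [].
by apply: Ck_sub (Hg k) => x [].
Qed.

Lemma smoothD f g : smooth_near0 f -> smooth_near0 g -> smooth_near0 (fun x => f x + g x).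
Proof. by apply: smooth_op => U k Uo; exact: CkD. Qed.

Lemma smoothM f g : smooth_near0 f -> smooth_near0 g -> smooth_near0 (fun x => f x * g x).
Proof. by apply: smooth_op => U k Uo; exact: CkM. Qed.

Lemma smoothB f g : smooth_near0 f -> smooth_near0 g -> smooth_near0 (fun x => f x - g x).
Proof.
apply: (@smooth_op f g (fun a b => a - b)) => U k Uo Hf Hg.
by apply: CkD => //; exact: CkN.
Qed.

Lemma smooth_cst (c : R) : smooth_near0 (fun=> c : R) (n := n).
Proof.
apply/smooth_near0P; exists setT; split=> [||k] //; first exact: openT.
by apply: Ck_cst; exact: openT.
Qed.

End SmoothAlgebra.

Section Base.
Variable R : realType.
Implicit Type F : 'rV[R]_3 -> R.

Local Notation w_abx1 := [:: 1; 1; 1]%N.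
Local Notation e_ := (@delta_mx R 1 3 0).

Lemma wdil_abx1 (s : R) (v : 'rV[R]_3) : wdil w_abx1 s v = s *: v.
Proof. by apply/rowP; apply: ord3P; rewrite !mxE. Qed.

(** The second difference isolates the mixed term of a quadratic polynomial, so
    it identifies the corresponding Taylor coefficient. *)
Lemma mixed_partial_coef F G i j (c : R) : smooth_near0 F ->
  wbigO w_abx1 3 (fun v => F v - G v) ->
  (forall s : R, G (s *: e_ i + s *: e_ j) - G (s *: e_ i) - G (s *: e_ j) + G 0 = c * s ^+ 2) ->
  partial j (partial i F) 0 = c.
Proof.
move=> sF HFG HG; apply/eqP; rewrite -subr_eq0 -normr_le0 leNgt; apply/negP => d0.
set d := `|_| in d0.
have eps0 : 0 < d / 5 by rewrite divr_gt0.
have sm v := wbigO_small (@abx1_gt0) v HFG eps0.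
have md : \forall s \near (0 : R)^', `|F (s *: e_ i + s *: e_ j) - F (s *: e_ i) - F (s *: e_ j)
   + F 0 - s ^+ 2 * partial j (partial i F) 0| <= d / 5 * `|s| ^+ 2.
  by apply: cvg_within; exact: mixed_difference.
have : \forall s \near (0 : R)^', False.
  near=> s.
  have s0 : s != 0 by near: s; exact: nbhs_dnbhs_neq.
  have s2 : 0 < `|s| ^+ 2 by rewrite exprn_gt0 // normr_gt0.
  have h1 : `|F (wdil w_abx1 s (e_ i + e_ j)) - G (wdil w_abx1 s (e_ i + e_ j))| <= d / 5 * `|s| ^+ 2.
    by near: s; exact: sm.
  have h2 : `|F (wdil w_abx1 s (e_ i)) - G (wdil w_abx1 s (e_ i))| <= d / 5 * `|s| ^+ 2.
    by near: s; exact: sm.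
  have h3 : `|F (wdil w_abx1 s (e_ j)) - G (wdil w_abx1 s (e_ j))| <= d / 5 * `|s| ^+ 2.
    by near: s; exact: sm.
  have h4 : `|F (s *: e_ i + s *: e_ j) - F (s *: e_ i) - F (s *: e_ j)
   + F 0 - s ^+ 2 * partial j (partial i F) 0| <= d / 5 * `|s| ^+ 2 by near: s.
  have h5 : F 0 - G 0 = 0 := wbigO_at0 HFG.
  rewrite !wdil_abx1 scalerDr in h1 h2 h3.
  have key : d * `|s| ^+ 2 <= 4 * (d / 5 * `|s| ^+ 2).
    rewrite (_ : d * `|s| ^+ 2 = `|(partial j (partial i F) 0 - c) * s ^+ 2|); last first.
      by rewrite normrM normrX.
    set x1 := F (_ + _) - _ in h1; set x2 := F (s *: e_ i) - _ in h2.
    set x3 := F (s *: e_ j) - _ in h3; set x4 := _ - s ^+ 2 * _ in h4.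
    have -> : (partial j (partial i F) 0 - c) * s ^+ 2 = x1 - x2 - x3 - x4.
      rewrite mulrBl -HG /x1 /x2 /x3 /x4.
      by rewrite (_ : F 0 = G 0); [ring | apply/eqP; rewrite -subr_eq0 h5].
    have := ler_normB (x1 - x2 - x3) x4; have := ler_normB (x1 - x2) x3.
    by have := ler_normB x1 x2; lra.
  have dp : 0 < d * `|s| ^+ 2 by rewrite mulr_gt0.
  by move: key dp; rewrite mulrAC; lra.
by move=> /filter_ex[].
Unshelve. all: by end_near. Qed.

Lemma partial_coef F (c : 'I_3 -> R) i : smooth_near0 F ->
  wbigO w_abx1 2 (fun v => F v - \sum_j c j * v 0 j) -> partial i F 0 = c i.
Proof.
move=> sF HF; have [U [Uo U0 HU]] := (smooth_near0P F).1 sF.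
have dF : derivable F 0 (e_ i).
  by have [_ /(_ i)[+ _]] := HU 1%N; apply; rewrite inE.
have dL : is_derive (0 : 'rV[R]_3) (e_ i) (\sum_j c j \*: (fun v : 'rV[R]_3 => v 0 j)) (\sum_j c j *: (e_ i) 0 j).
  by apply: is_derive_sum => j; apply: is_deriveZ; exact: is_derive_coord.
have LE : (fun v : 'rV[R]_3 => \sum_j c j * v 0 j) = \sum_j c j \*: (fun v : 'rV[R]_3 => v 0 j).
  by apply/funext => v; rewrite fct_sumE.
have [d1 d2] := dL; rewrite -LE in d1 d2.
have := wbigO_partial (@abx1_gt0) (derivableB dF d1) HF.
have w : (nth 0%N w_abx1 i < 2)%N by move: i {dF dL d1 d2}; apply: ord3P.
move=> /(_ w); rewrite /partial (deriveB dF d1) d2 (bigD1 i) //= big1 => [|j ji].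
  by rewrite mxE !eqxx addr0 /GRing.scale /= mulr1 => /eqP; rewrite subr_eq0 => /eqP.
by rewrite mxE (negPf ji) andbF scaler0.
Qed.

(** If the determinant vanishes, the covector [F_a da + F_b db] annihilates the
    two fields and their bracket at the origin. *)
Lemma regular_nondegenerate F : smooth_near0 F -> partial 0 F 0 != 0 -> regular F ->
  partial 0 F 0 * partial 2 (partial 1 F) 0 - partial 1 F 0 * partial 2 (partial 0 F) 0 != 0.
Proof.
move=> sF Fa /nbhs_singleton reg; apply/eqP => D0.
have [U [Uo U0 HU]] := (smooth_near0P F).1 sF.
have dd i : derivable (partial i F) 0 (e_ 2).
  have [_ /(_ i)[_ Hi]] := HU 2%N; have [_ /(_ 2)[+ _]] := Hi.
  by apply; rewrite inE.
pose w : 'cV[R]_3 := \col_i (if i == 0 then partial 0 F 0 else if i == 1 then partial 1 F 0 else 0).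
have mulw (u : 'rV[R]_3) : u *m w = (u 0 0 * partial 0 F 0 + u 0 1 * partial 1 F 0)%:M.
  apply/rowP => i; rewrite !mxE ord1 eqxx mulr1n !big_ord_recl big_ord0 !mxE /= mulr0 !addr0.
  by congr (_ + u _ _ * _); apply/val_inj.
suff /eqP : w = 0.
  apply/negP; apply: contra Fa => /eqP /(congr1 (fun z : 'cV[R]_3 => z 0 0)).
  by rewrite !mxE /= => ->.
have : (1%:M <= kermx w)%MS.
  apply: (submx_trans (submx_full 1%:M reg)).
  rewrite !addsmx_sub !sub_kermx !mulw /xy_field /ab_field.
  rewrite row3_0 row3_1 !mul0r addr0 row3_0 row3_1.
  have lie : lie_bracket (@xy_field R) (ab_field F) 0 =
     row3 (- partial 2 (partial 1 F) 0) (partial 2 (partial 0 F) 0) 0.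
    rewrite /lie_bracket /xy_field derive_cst subr0.
    rewrite (_ : row3 0 0 1 = e_ 2); last first.
      by apply/rowP; apply: ord3P; rewrite !mxE.
    have dm (j : 'I_3) : is_derive (0 : 'rV[R]_3) (e_ 2) (fun v => ab_field F v 0 j)
       (row3 (- partial 2 (partial 1 F) 0) (partial 2 (partial 0 F) 0) 0 0 j).
      move: j; apply: ord3P.
      - rewrite row3_0 (_ : (fun _ => _) = - partial 1 F); last first.
          by apply/funext => v; rewrite row3_0.
        by apply: is_deriveN; exact: derivableP.
      - rewrite row3_1 (_ : (fun _ => _) = partial 0 F); last first.
          by apply/funext => v; rewrite row3_1.
        exact: derivableP.
      - rewrite row3_2 (_ : (fun _ => _) = cst 0); last first.
          by apply/funext => v; rewrite row3_2.
        exact: is_derive_cst.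
    have dM : derivable (ab_field F) 0 (e_ 2).
      by apply/derivable_mxP => i j; rewrite ord1; apply: ex_derive; exact: dm.
    by rewrite (derive_mx dM); apply/rowP => j; rewrite mxE; have [_ ->] := dm j.
  rewrite lie row3_0 row3_1.
  move: D0; clear; move: (partial 2 (partial 1 F) 0) (partial 2 (partial 0 F) 0)
    (partial 0 F 0) (partial 1 F 0) => x y a b D0.
  have z1 : - b * a + a * b = 0 by ring.
  have z2 : - x * a + y * b = 0 by rewrite -(oppr0 R) -D0; ring.
  by rewrite z1 z2 !raddf0 eqxx.
by rewrite sub_kermx mul1mx => /eqP.
Qed.

End Base.

(** * Normalization of the weight-two jet *)
Section NormalForms.
Variable R : realType.
Implicit Types (F : 'rV[R]_3 -> R) (P Q : mpoly 3 R).

Local Notation O := (@wbigO R 2 w_abx).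
Local Notation bilin := (bilin R).

Lemma bilin_weight m : m \in msupp bilin -> weight w_abx m = 2%N.
Proof. by rewrite mcoeff_msupp; apply: contra_neq_eq => H; exact: mcoeff_bilin0. Qed.

Lemma jet_normal_formE l P : (2 <= l)%N -> jet_normal_form l P <->
  (forall m, (weight w_abx m <= 2)%N -> mcoeff m P = mcoeff m bilin) /\
  (forall m, (2 < weight w_abx m <= l)%N -> excluded_kj (m 1) (m (2 : 'I_3)) -> mcoeff m P = 0).
Proof.
move=> l2; split=> [[H1 H2 H3]|[H1 H2]].
  split=> m wm; last first.
    move=> em; have := H3 _ wm m em; rewrite -mcoeff_eq0 mcoeff_wcomp eqxx.
    by move/eqP.
  have := congr1 (mcoeff m) H1; rewrite H2 mcoeff_wtrunc wm => ->.
  by [].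
have wc2 : wcomp w_abx 2 P = bilin.
  apply/mpolyP => m; rewrite mcoeff_wcomp; case: eqP => [E|/eqP E].
    by rewrite H1 // E.
  by rewrite mcoeff_bilin0.
split=> //.
  rewrite wc2; apply/mpolyP => m; rewrite mcoeff_wtrunc; case: leqP => [wm|wm].
    exact: H1.
  by rewrite mcoeff_bilin0 // gtn_eqF.
move=> nu nul m em; rewrite -mcoeff_eq0 mcoeff_wcomp; case: (weight w_abx m =P nu) => [E|_]; last by rewrite eqxx.
by rewrite H2 ?eqxx // E.
Qed.

Lemma bilin_normal_form : jet_normal_form 2 bilin.
Proof.
by apply/jet_normal_formE => //; split=> // m; rewrite ltnNge; case: (_ <= _)%N.
Qed.

Lemma para_CR_of_jet F : smooth_near0 F -> F 0 = 0 ->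
  O 3 (fun v => F v - peval bilin v) -> para_CR F.
Proof.
move=> sF F0 HF; split=> //; have [U [Uo U0 HU]] := (smooth_near0P F).1 sF.
have dF : derivable F 0 (delta_mx 0 0).
  by have [_ /(_ 0)[+ _]] := HU 1%N; apply; rewrite inE.
have dB : is_derive (0 : 'rV[R]_3) (delta_mx 0 0) (peval bilin) 1.
  have -> : peval bilin = (fun v : 'rV[R]_3 => v 0 0) +
      (fun v : 'rV[R]_3 => v 0 1) * (fun v : 'rV[R]_3 => v 0 (2 : 'I_3)).
    by apply/funext => v; rewrite peval_bilin.
  have c j := is_derive_coord (0 : 'rV[R]_3) (delta_mx 0 0) j.
  apply: is_derive_eq (is_deriveD (c 0) (is_deriveM (c 1) (c 2))) _.
  by rewrite !mxE !eqxx /= /GRing.scale /= !mulr0 !addr0.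
have [d1 d2] := dB.
have := wbigO_partial abx_gt0 (derivableB dF d1) HF isT.
rewrite /partial (deriveB dF d1) d2 => /eqP; rewrite subr_eq0 => /eqP ->.
exact: oner_neq0.
Qed.

(** The jet of the image starts with [a + b * x], so the derivative of [Fs] with
    respect to [a] at 0 is 1: the image is again a para-CR hypersurface. *)
Lemma takes_to_normal_form_bigO l F Fs (Phi : product_polymap R) Q :
  admissible Phi -> smooth_near0 Fs -> Fs 0 = 0 -> (2 <= l)%N ->
  maps_onto (xy_map Phi) (ab_map Phi) F Fs ->
  (forall m, m \in msupp Q -> (weight w_abx m <= l)%N) ->
  O l.+1 (fun v => Fs v - peval Q v) -> jet_normal_form l Q ->
  takes_to_normal_form l F Phi.
Proof.
move=> aPhi sFs Fs0 l2 FFs wQ HQ nQ; split=> //; exists Fs; split=> //; last first.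
  by exists Q => //; apply/is_wjet_bigO.
apply: para_CR_of_jet => //.
have [Q2 _] := (jet_normal_formE Q l2).1 nQ.
have H1 : O 3 (peval (Q - bilin)).
  apply: wbigO_peval => m; rewrite mcoeff_msupp mcoeffB; apply: contraNleq => wm.
  by rewrite Q2 // subrr.
have l3 : (3 <= l.+1)%N by [].
apply: wbigO_ext (wbigOD (wbigO_le l3 HQ) H1) => v.
by rewrite pevalB; ring.
Qed.

(** The linear term in [b] has weight 1 and is absorbed in [A], so the new
    weights only apply after this linear change; the ordinary second-order
    Taylor polynomial of [F] is therefore the starting point.  On the
    kernel direction [a = - (pb / pa) b] of the linear part, the term [a * x]
    contributes to [b * x], whose new coefficient [r] is nonzero precisely by
    regularity.  It is normalized by [B = r * b]; the pure powers of [x] are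
    absorbed in [Y] and those of [b] in [A]. *)
Lemma quadratic_normalization F : para_CR F -> regular F ->
  exists Phi : product_polymap R, takes_to_normal_form 2 F Phi.
Proof.
move=> [sF F0 Fa] reg; have nondeg := regular_nondegenerate sF Fa reg.
have [pa [pb [px [paa [pab [pbb [pax [pbx [pxx HF]]]]]]]]] := quadratic_taylor sF F0.
pose quad (v : 'rV[R]_3) := pa * v 0 0 + pb * v 0 1 + px * v 0 (2 : 'I_3)
    + paa * v 0 0 ^+ 2 + pab * v 0 0 * v 0 1 + pbb * v 0 1 ^+ 2
    + pax * v 0 0 * v 0 (2 : 'I_3) + pbx * v 0 1 * v 0 (2 : 'I_3)
    + pxx * v 0 (2 : 'I_3) ^+ 2.
have {}HF : wbigO [:: 1; 1; 1]%N 3 (fun v => F v - quad v) by exact: HF.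
have cw1 i : wbigO [:: 1; 1; 1]%N 1 (fun v : 'rV[R]_3 => v 0 i).
  by have := wbigO_coord R [:: 1; 1; 1]%N i; move: i; apply: ord3P.
have HL : wbigO [:: 1; 1; 1]%N 2 (fun v => F v -
    \sum_(j < 3) (row3 pa pb px 0 j) * v 0 j).
  have t2 (i j : 'I_3) (c : R) := wbigOM (wbigOM (wbigO_cst 2 _ c) (cw1 i)) (cw1 j).
  have t := wbigOD (wbigOD (wbigOD (wbigOD (wbigOD (t2 0 0 paa) (t2 0 1 pab)) (t2 1 1 pbb))
    (t2 0 2 pax)) (t2 1 2 pbx)) (t2 2 2 pxx).
  apply: wbigO_ext (wbigOD (wbigO_le (isT : (2 <= 3)%N) HF) t) => v.
  rewrite !big_ord_recl big_ord0 /= !mxE /= /quad.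
  rewrite (_ : lift ord0 ord0 = 1); last exact/val_inj.
  rewrite (_ : lift ord0 _ = 2); last exact/val_inj.
  ring.
have Ea : partial 0 F 0 = pa by rewrite (partial_coef 0 sF HL) row3_0.
have Eb : partial 1 F 0 = pb by rewrite (partial_coef 1 sF HL) row3_1.
have Eax : partial 2 (partial 0 F) 0 = pax.
  apply: (mixed_partial_coef sF HF) => s; rewrite /quad !mxE /= !(mulr0, mulr1, addr0, add0r).
  ring.
have Ebx : partial 2 (partial 1 F) 0 = pbx.
  apply: (mixed_partial_coef sF HF) => s; rewrite /quad !mxE /= !(mulr0, mulr1, addr0, add0r).
  ring.
rewrite Ea Eb Eax Ebx in Fa nondeg.
pose r := (pa * pbx - pb * pax) / pa.
have r0 : r != 0 by rewrite mulf_neq0 ?invr_eq0.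
(* In the new coordinates a = kap * B + rho with rho of weight 2; q is the
   coefficient of B^2 that the quadratic terms in a and b produce. *)
pose kap := - pb / (pa * r).
pose q := paa * kap ^+ 2 + pab * kap / r + pbb / r ^+ 2.
pose X0 := pvar R (0 : 'I_2); pose X1 := pvar R (1 : 'I_2).
pose Phi := ProductPolymap X0 (X1 - (px *: X0 + pxx *: (X0 * X0)))
   (pa *: X0 + pb *: X1 + (q * r ^+ 2) *: (X1 * X1)) (r *: X1).
have pevalZ n (c : R) (p : mpoly n R) v : peval (c *: p) v = c * peval p v.
  exact: mevalZ.
have fE p : xy_map Phi p = row2 (p 0 0) (p 0 1 - (px * p 0 0 + pxx * (p 0 0 * p 0 0))).
  by rewrite /xy_map /= pevalB pevalD !pevalZ pevalM !peval_pvar.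
have gE p : ab_map Phi p =
    row2 (pa * p 0 0 + pb * p 0 1 + q * r ^+ 2 * (p 0 1 * p 0 1)) (r * p 0 1).
  by rewrite /ab_map /= !pevalD !pevalZ pevalM !peval_pvar.
pose ginv A B : R := (A - pb / r * B - q * (B * B)) / pa.
have smooth_ginv n (f g : 'rV[R]_n.+1 -> R) : smooth_near0 f -> smooth_near0 g ->
    smooth_near0 (fun v => ginv (f v) (g v)).
  move=> sf sg; have c := @smooth_cst R n.
  exact: (smoothM (smoothB (smoothB sf (smoothM (c _) sg)) (smoothM (c _) (smoothM sg sg))) (c _)).
have gK a b : ginv (pa * a + pb * b + q * r ^+ 2 * (b * b)) (r * b) = a.
  by rewrite /ginv; field; rewrite r0 Fa.
pose f' (p : 'rV[R]_2) : 'rV[R]_2 :=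
  row2 (p 0 0) (p 0 1 + (px * p 0 0 + pxx * (p 0 0 * p 0 0))).
pose g' (p : 'rV[R]_2) : 'rV[R]_2 := row2 (ginv (p 0 0) (p 0 1)) (r^-1 * p 0 1).
have cs := @smooth_coord R 1; have cst := @smooth_cst R 1.
have aPhi : admissible Phi.
  split.
    split; first exact: smooth_polymap.
      by rewrite fE !mxE !mulr0 !addr0 subr0 row2_00.
    exists f'; split.
    - apply: smooth_row2 (cs 0) _.
      exact: (smoothD (cs 1) (smoothD (smoothM (cst px) (cs 0))
        (smoothM (cst pxx) (smoothM (cs 0) (cs 0))))).
    - by rewrite /f' !mxE !mulr0 !addr0 row2_00.
    - by apply: (ball_near0 ltr01) => p _; rewrite fE /f' !row2_0 !row2_1 subrK row2E.
    - by apply: (ball_near0 ltr01) => p _; rewrite fE /f' !row2_0 !row2_1 addrK row2E.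
  split; first exact: smooth_polymap.
    by rewrite gE !mxE !mulr0 !addr0 row2_00.
  exists g'; split.
  - exact: (smooth_row2 (smooth_ginv _ _ _ (cs 0) (cs 1)) (smoothM (cst _) (cs 1))).
  - by rewrite /g' /ginv !mxE !mulr0 !subr0 mul0r row2_00.
  - apply: (ball_near0 ltr01) => p _; rewrite gE /g' !row2_0 !row2_1 gK.
    by rewrite mulrA mulVf // mul1r row2E.
  - apply: (ball_near0 ltr01) => p _; rewrite gE /g' !row2_0 !row2_1 -[RHS]row2E.
    congr (row2 _ _); last by rewrite mulrA mulfV // mul1r.
    by rewrite /ginv; field; rewrite r0 Fa.
pose h (w : 'rV[R]_3) : 'rV[R]_3 :=
  row3 (ginv (w 0 0) (w 0 1)) (r^-1 * w 0 1) (w 0 (2 : 'I_3)).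
pose X (w : 'rV[R]_3) := w 0 (2 : 'I_3).
pose Fs w := F (h w) - (px * X w + pxx * (X w * X w)).
have cs3 := @smooth_coord R 2; have cst3 := @smooth_cst R 2.
have h0 : h 0 = 0 by rewrite /h /ginv !mxE !mulr0 !subr0 mul0r row3_00.
have sh : smooth_map_near0 h.
  exact: (smooth_row3 (smooth_ginv _ _ _ (cs3 0) (cs3 1)) (smoothM (cst3 _) (cs3 1)) (cs3 2)).
exists Phi; apply: (@takes_to_normal_form_bigO 2 F Fs _ bilin aPhi _ _ (leqnn 2) _ _ _ bilin_normal_form).
- apply: smoothB; first exact: (smooth_near0_comp sF sh h0).
  exact: (smoothD (smoothM (cst3 px) (cs3 2)) (smoothM (cst3 pxx) (smoothM (cs3 2) (cs3 2)))).
- by rewrite /Fs h0 F0 /X !mxE !mulr0 addr0 subrr.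
- exists (setT, setT); first by split; exact: filterT.
  move=> [p s] _ /=; rewrite /on_hypersurface /Fs /X !fE !gE row3_2 !row2_0 !row2_1.
  rewrite /h !row3_0 !row3_1 row3_2 gK (mulKf r0).
  by split=> [->//|/addIr].
- by move=> m /bilin_weight ->.
pose B (w : 'rV[R]_3) := w 0 1; pose rho (w : 'rV[R]_3) := (w 0 0 - q * (B w * B w)) / pa.
have OB : O 1 B by exact: (wbigO_coord R w_abx (1 : 'I_3)).
have OX : O 1 X by exact: (wbigO_coord R w_abx (2 : 'I_3)).
have OA : O 2 (fun w : 'rV[R]_3 => w 0 0) by exact: (wbigO_coord R w_abx (0 : 'I_3)).
have cO c := wbigO_cst 2 w_abx (c : R).
have Orho : O 2 rho.
  apply: (wbigOM (k' := 0) (wbigOB OA (wbigOM (cO q) (wbigOM OB OB))) (cO pa^-1)).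
have ginvE (w : 'rV[R]_3) : ginv (w 0 0) (w 0 1) = kap * B w + rho w.
  by rewrite /ginv /kap /rho /B; field; rewrite r0 Fa.
have Oh (i : 'I_3) : O (nth 0%N [:: 1; 1; 1]%N i) (fun w => h w 0 i).
  move: i; apply: ord3P.
  - apply: wbigO_ext (wbigOD (wbigOM (cO kap) OB) (wbigO_le (isT : (1 <= 2)%N) Orho)) => w.
    by rewrite row3_0 ginvE.
  - by apply: wbigO_ext (wbigOM (cO r^-1) OB) => w; rewrite row3_1.
  - by apply: wbigO_ext OX => w; rewrite row3_2.
have Oe := wbigO_comp abx1_gt0 HF Oh.
have e1 := wbigOM (cO (paa * 2 * kap + pab / r)) (wbigOM OB Orho).
have e2 := wbigO_le (isT : (3 <= 4)%N) (wbigOM (cO paa) (wbigOM Orho Orho)).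
have e3 := wbigOM (cO pax) (wbigOM Orho OX).
apply: wbigO_ext (wbigOD (wbigOD (wbigOD Oe e1) e2) e3) => w.
rewrite /Fs peval_bilin /= /quad /h row3_0 row3_1 row3_2 ginvE -/(X w) -/(B w).
have wA : w 0 0 = pa * rho w + q * (B w * B w) by rewrite /rho mulrC divfK // subrK.
have qE : q * (B w * B w) = paa * (kap * B w) ^+ 2 + pab * (kap * B w) * (r^-1 * B w) +
   pbb * (r^-1 * B w) ^+ 2.
  by rewrite /q; field.
have kE : pa * kap = - pb / r by rewrite /kap; field; rewrite r0 Fa.
have rE : pax * kap + pbx * r^-1 = 1.
  have rr : r * pa = pa * pbx - pb * pax by rewrite /r divfK.
  by apply: (mulIf r0); apply: (mulIf Fa); rewrite /kap mul1r rr; field; rewrite r0 Fa.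
have -> : paa * (kap * B w + rho w) ^+ 2 = paa * (kap * B w) ^+ 2 +
   paa * (2 * kap * (B w * rho w)) + paa * (rho w * rho w) by ring.
rewrite wA qE.
have -> : pa * (kap * B w + rho w) = - pb / r * B w + pa * rho w.
  by rewrite mulrDr mulrA kE.
have -> : pax * (kap * B w + rho w) * X w =
    (1 - pbx * r^-1) * (B w * X w) + pax * (rho w * X w) by rewrite -rE; ring.
ring.
Qed.

End NormalForms.

(** * Normalization in all orders *)
Section HomogeneousPolynomials.
Variable R : realType.
Implicit Types p : mpoly 2 R.

Lemma mon2E (m : multinom 2) : mon2 (m 0) (m 1) = m.
Proof. by apply/eqP; rewrite eq_sym mon2P !eqxx. Qed.

Lemma weight_2 (a b : nat) (m : multinom 2) : weight [:: a; b] m = (a * m 0%R + b * m 1%R)%N.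
Proof.
rewrite /weight !big_ord_recl big_ord0 /= addn0.
by congr (_ + b * m _)%N; apply/val_inj.
Qed.

Lemma weight_mon2 a b i j : weight [:: a; b] (mon2 i j) = (a * i + b * j)%N.
Proof. by rewrite weight_2 !mnmE. Qed.

Lemma homog_poly (a b k : nat) (c : nat -> nat -> R) : (0 < a)%N -> (0 < b)%N ->
  exists p, whomog [:: a; b] k p /\
    forall i j, coef2 p i j = if (a * i + b * j == k)%N then c i j else 0.
Proof.
move=> a0 b0; pose E (m : multinom 2) := c (m 0) (m 1).
pose q : mpoly 2 R := \sum_(m : bmultinom 2 k.+1) E m *: mpolyX R m.
exists (wcomp [:: a; b] k q); split=> [m|i j].
  by rewrite mcoeff_msupp mcoeff_wcomp; case: ifP => [/eqP //|_]; rewrite eqxx.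
rewrite /coef2 mcoeff_wcomp weight_mon2; case: eqP => // E1.
rewrite /q mcoeff_mpoly /E ?mnmE //.
rewrite mdegE !big_ord_recl big_ord0 !mnmE /= addn0 ltnS -E1.
by apply: leq_add; [rewrite -[leqLHS]mul1n leq_mul2r a0 orbT | rewrite -[leqLHS]mul1n leq_mul2r b0 orbT].
Qed.

Lemma whomog_co0 (a b k : nat) p : whomog [:: a; b] k p ->
  forall i j, (a * i + b * j != k)%N -> coef2 p i j = 0.
Proof.
move=> hp i j ij; apply/eqP; rewrite mcoeff_eq0; apply/negP => /hp.
by rewrite weight_mon2 => /eqP; rewrite (negPf ij).
Qed.

Lemma whomog_eq0 (a b k : nat) p : whomog [:: a; b] k p ->
  (forall i j, (a * i + b * j = k)%N -> coef2 p i j = 0) -> p = 0.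
Proof.
move=> hp H; apply/mpolyP => m; rewrite mcoeff0 -(mon2E m).
have [E|E] := eqVneq (a * m 0%R + b * m 1%R)%N k; first exact: H.
exact: (whomog_co0 hp).
Qed.

Lemma whomogB ws n k (p q : mpoly n R) :
  whomog ws k p -> whomog ws k q -> whomog ws k (p - q).
Proof.
by move=> hp hq m /msuppB_le; rewrite mem_cat => /orP[/hp|/hq].
Qed.

Lemma infinitesimalB (xi eta al be xi' eta' al' be' : mpoly 2 R) :
  infinitesimal (xi - xi') (eta - eta') (al - al') (be - be') =
  infinitesimal xi eta al be - infinitesimal xi' eta' al' be'.
Proof.
rewrite /infinitesimal /sub_xy /sub_ab !comp_mpolyB.
do 8!move: (comp_mpoly _ _) => ?.
ring.
Qed.

End HomogeneousPolynomials.

Section Main.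
Variable R : realType.
Implicit Types (F : 'rV[R]_3 -> R) (P Q : mpoly 3 R).

Local Notation O := (@wbigO R 2 w_abx).

(** The jets of order [e + 1] and [e + 2] of [F] agree up to weight [e + 1], so the
    normal form of the former is inherited by the latter. *)
Lemma normal_form_jet F e : (0 < e)%N -> para_CR F -> jet_in_normal_form e.+1 F ->
  exists P, O e.+3 (fun v => F v - peval P v) /\ jet_normal_form e.+1 P.
Proof.
move=> e0 [sF F0 _] [P0 HP0 nP0].
have [wP0 OP0] := (is_wjet_bigO _ _ sF).1 HP0.
have [P wP OP] := smooth_wjet abx_gt0 e.+3 sF; exists P; split=> //.
have D : forall m, m \in msupp (P - P0) -> (e.+2 <= weight w_abx m)%N.
  apply: (wbigO_peval_weight abx_gt0).
  apply: wbigO_ext (wbigOB OP0 (wbigO_le (leqnSn e.+2) OP)) => v.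
  by rewrite pevalB; ring.
have PP0 m : (weight w_abx m <= e.+1)%N -> mcoeff m P = mcoeff m P0.
  move=> wm; apply/eqP; rewrite -subr_eq0 -mcoeffB mcoeff_eq0; apply/negP => /D.
  by rewrite leqNgt ltnS wm.
have e2 : (2 <= e.+1)%N by [].
have [N1 N2] := (jet_normal_formE P0 e2).1 nP0.
apply/(jet_normal_formE P e2); split=> m wm.
  by rewrite PP0 ?N1 // (leq_trans wm).
by move=> em; rewrite PP0 ?N2 //; case/andP: wm.
Qed.

Lemma elementary_jet F Fs e (xi eta al be : mpoly 2 R) P Q : (0 < e)%N ->
  whomog w_xy e.+1 xi -> whomog w_xy e.+2 eta ->
  whomog w_ab e.+2 al -> whomog w_ab e.+1 be ->
  smooth_near0 F -> F 0 = 0 ->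
  O e.+3 (fun v => F v - peval P v) -> jet_normal_form e.+1 P ->
  maps_onto (xy_map (elementary_map xi eta al be)) (ab_map (elementary_map xi eta al be)) F Fs ->
  O e.+3 (fun v => Fs v - peval Q v) ->
  forall m, (weight w_abx m <= e.+2)%N ->
    mcoeff m Q = mcoeff m (P + infinitesimal xi eta al be).
Proof.
move=> e0 hxi heta hal hbe sF F0 OP nP FFs OQ.
have [N1 _] := (jet_normal_formE P (e0 : (2 <= e.+1)%N)).1 nP.
exact: (transformed_jet e0 hxi heta hal hbe OP OQ N1 (maps_onto_eq sF F0 FFs)).
Qed.

Lemma infinitesimal_low e (xi eta al be : mpoly 2 R) m :
  whomog w_xy e.+1 xi -> whomog w_xy e.+2 eta ->
  whomog w_ab e.+2 al -> whomog w_ab e.+1 be ->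
  (weight w_abx m <= e.+1)%N -> mcoeff m (infinitesimal xi eta al be) = 0.
Proof.
move=> hxi heta hal hbe wm; apply/eqP; rewrite mcoeff_eq0; apply/negP => mI.
suff H : O e.+2 (peval (infinitesimal xi eta al be)).
  by have := wbigO_peval_weight abx_gt0 H mI; rewrite leqNgt ltnS wm.
have OS : O 2 (peval (bilin R)) by apply: wbigO_peval => k /bilin_weight ->.
have h1 := wbigO_peval_xy OS heta; have h2 := wbigO_peval_ab hal.
have h3 := wbigOM (wbigO_coord R w_abx (2 : 'I_3)) (wbigO_peval_ab hbe).
have h4 := wbigOM (wbigO_coord R w_abx (1 : 'I_3)) (wbigO_peval_xy OS hxi).
apply: wbigO_ext (wbigOB (wbigOB (wbigOB h1 h2) h3) h4) => v.
by rewrite peval_infinitesimal.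
Qed.

(** By [elementary_jet] the coefficients of weight [e + 2] of the new jet are the
    old ones plus those of the infinitesimal action; the system
    [inf_coef_solve] makes the excluded ones vanish. *)
Lemma normal_form_step F e : (0 < e)%N -> para_CR F -> jet_in_normal_form e.+1 F ->
  exists Phi : product_polymap R, elementary e.+1 Phi /\ takes_to_normal_form e.+2 F Phi.
Proof.
move=> e0 pF /(normal_form_jet e0 pF)[P [OP nP]]; have [sF F0 _] := pF.
have e2 : (2 <= e.+1)%N by [].
have [N1 N2] := (jet_normal_formE P e2).1 nP.
have [eta [al [be [xi Hs]]]] := inf_coef_solve (fun i k j => - mcoeff (mon3 (i, k, j)) P).
have [Eta [heta coEta]] := homog_poly e.+2 eta (isT : (0 < 1)%N) (isT : (0 < 2)%N).
have [Xi [hxi coXi]] := homog_poly e.+1 xi (isT : (0 < 1)%N) (isT : (0 < 2)%N).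
have [Al [hal coAl]] := homog_poly e.+2 al (isT : (0 < 2)%N) (isT : (0 < 1)%N).
have [Be [hbe coBe]] := homog_poly e.+1 be (isT : (0 < 2)%N) (isT : (0 < 1)%N).
pose Phi := elementary_map Xi Eta Al Be.
exists Phi; split; first by exists Xi, Eta, Al, Be.
have aPhi := elementary_admissible e0 hxi heta hal hbe.
have OF : O 2 F.
  have OPP : O 2 (peval P).
    apply: wbigO_peval => m; rewrite mcoeff_msupp; apply: contraNleq => wm.
    by rewrite N1 ?(ltnW wm) // mcoeff_bilin0 // ltn_eqF.
  by apply: wbigO_ext (wbigOD (wbigO_le (isT : (2 <= e.+3)%N) OP) OPP) => v; rewrite subrK.
have lG := chart_local_diffeo Eta e0 hxi hal hbe sF F0 OF.
have [Fs [sFs Fs0 FFs]] := image_hypersurface sF F0 aPhi.1 aPhi.2 lG.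
have [Q wQ OQ] := smooth_wjet abx_gt0 e.+3 sFs.
have QE := elementary_jet e0 hxi heta hal hbe sF F0 OP nP FFs OQ.
apply: (@takes_to_normal_form_bigO R e.+2 F Fs Phi Q aPhi) => //.
apply/jet_normal_formE => //; split=> m wm.
  rewrite QE; last by rewrite (leq_trans wm).
  by rewrite mcoeffD (infinitesimal_low hxi heta hal hbe) ?addr0 ?N1 // (leq_trans wm).
move=> em; rewrite QE; last by case/andP: wm.
rewrite mcoeffD; case/andP: wm => w2; rewrite leq_eqVlt => /orP[/eqP wE|we]; last first.
  by rewrite (infinitesimal_low hxi heta hal hbe) ?addr0 ?N2 ?w2.
rewrite mcoeff_infinitesimal.
rewrite (_ : inf_coef _ _ _ _ _ _ _ = inf_coef eta al be xi (m 0) (m 1) (m (2 : 'I_3))).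
  by rewrite Hs // mon3E subrr.
move: wE; rewrite weight_abx /inf_coef.
move: (m 0%R) (m 1%R) (m (2%R : 'I_3)) => i k j wE.
congr (_ - _ - _ - _).
- case: leqP => // kj; rewrite coEta ifT //; apply/eqP; lia.
- case: eqP => // j0; rewrite coAl ifT //; apply/eqP; lia.
- case: eqP => // j0; rewrite coBe ifT //; apply/eqP; lia.
- case: ifP => // /andP[k0 kj]; rewrite coXi ifT //; apply/eqP; lia.
Qed.

(** Two normalizing elementary maps have the same infinitesimal action on the
    excluded monomials of weight [e + 2]; the action is linear, and injective
    on this range by [inf_coef_inj]. *)
Lemma elementary_unique F e (Phi Psi : product_polymap R) : (3 < e)%N ->
  para_CR F -> jet_in_normal_form e.+1 F ->
  elementary e.+1 Phi -> takes_to_normal_form e.+2 F Phi ->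
  elementary e.+1 Psi -> takes_to_normal_form e.+2 F Psi -> Phi = Psi.
Proof.
move=> e4 pF nF; have e0 : (0 < e)%N by apply: leq_trans e4.
have [P [OP nP]] := normal_form_jet e0 pF nF; have [sF F0 _] := pF.
have excluded_coef xi eta al be :
    whomog w_xy e.+1 xi -> whomog w_xy e.+2 eta -> whomog w_ab e.+2 al -> whomog w_ab e.+1 be ->
    takes_to_normal_form e.+2 F (elementary_map xi eta al be) ->
    forall m, weight w_abx m = e.+2 -> excluded_kj (m 1) (m (2 : 'I_3)) ->
      mcoeff m (infinitesimal xi eta al be) = - mcoeff m P.
  move=> hxi heta hal hbe [_ [Fs [[sFs Fs0 _] FFs [Q jQ nQ]]]] m wm em.
  have [_ OQ] := (is_wjet_bigO _ _ sFs).1 jQ.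
  have := elementary_jet e0 hxi heta hal hbe sF F0 OP nP FFs OQ.
  move=> /(_ m (eq_leq wm)); have [_ ->] := (jet_normal_formE Q (isT : (2 <= e.+2)%N)).1 nQ => //.
    by rewrite mcoeffD => /esym/eqP; rewrite addrC addr_eq0 => /eqP.
  by rewrite wm leqnn andbT; lia.
move=> [xi [eta [al [be [[hxi heta] [hal hbe] ->]]]]] nPhi.
move=> [xi' [eta' [al' [be' [[hxi' heta'] [hal' hbe'] ->]]]]] nPsi.
have E := excluded_coef xi eta al be hxi heta hal hbe nPhi.
have E' := excluded_coef xi' eta' al' be' hxi' heta' hal' hbe' nPsi.
have [|i k j wE em|Ze Za Zb Zx] :=
  @inf_coef_inj R (coef2 (eta - eta')) (coef2 (al - al')) (coef2 (be - be')) (coef2 (xi - xi')) e.+2.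
- by [].
- have := mcoeff_infinitesimal (xi - xi') (eta - eta') (al - al') (be - be') (mon3 (i, k, j)).
  rewrite !mnmE /= => <-; rewrite infinitesimalB mcoeffB E ?E' ?mnmE ?subrr //.
    by rewrite weight_abx !mnmE.
  by rewrite weight_abx !mnmE.
have eqz (a b k : nat) (p p' : mpoly 2 R) : whomog [:: a; b] k p -> whomog [:: a; b] k p' ->
    (forall i j, (a * i + b * j = k)%N -> coef2 (p - p') i j = 0) -> p = p'.
  by move=> hp hp' H; apply/subr0_eq; apply: whomog_eq0 (whomogB hp hp') H.
have -> : xi = xi'.
  by apply: (eqz _ _ _ _ _ hxi hxi') => i j ij; apply: Zx; lia.
have -> : eta = eta'.
  by apply: (eqz _ _ _ _ _ heta heta') => i j ij; apply: Ze; lia.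
have -> : al = al'.
  by apply: (eqz _ _ _ _ _ hal hal') => i j ij; apply: Za; lia.
have -> : be = be'.
  by apply: (eqz _ _ _ _ _ hbe hbe') => i j ij; apply: Zb; lia.
by [].
Qed.

Definition comp_polymap (Psi Phi : product_polymap R) : product_polymap R :=
  let xy := [tuple polX Phi; polY Phi] in let ab := [tuple polA Phi; polB Phi] in
  ProductPolymap (comp_mpoly xy (polX Psi)) (comp_mpoly xy (polY Psi))
                 (comp_mpoly ab (polA Psi)) (comp_mpoly ab (polB Psi)).

Lemma peval_comp2 (p q r : mpoly 2 R) v :
  peval (comp_mpoly [tuple q; r] p) v = peval p (row2 (peval q v) (peval r v)).
Proof.
rewrite /peval comp_mpoly_meval; apply: meval_eq; apply: ord2P.
  by rewrite (tnth_nth 0) /= row2_0.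
by rewrite (tnth_nth 0) /= row2_1.
Qed.

Lemma xy_map_comp Psi Phi : xy_map (comp_polymap Psi Phi) = xy_map Psi \o xy_map Phi.
Proof. by apply/funext => p; rewrite /xy_map /= !peval_comp2. Qed.

Lemma ab_map_comp Psi Phi : ab_map (comp_polymap Psi Phi) = ab_map Psi \o ab_map Phi.
Proof. by apply/funext => p; rewrite /ab_map /= !peval_comp2. Qed.

Lemma local_diffeo0_cont n (f : 'rV[R]_n.+1 -> 'rV[R]_n.+1) : local_diffeo0 f ->
  forall A : set 'rV[R]_n.+1, (\forall p \near (0 : 'rV[R]_n.+1), A p) ->
  \forall p \near (0 : 'rV[R]_n.+1), A (f p).
Proof.
move=> [sf f0 _] A nA; have [r r0 rA] := near0_ball nA.
by apply: filterS (cont0_small (smooth_map_cont sf) f0 r0) => p; exact: rA.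
Qed.

Lemma local_diffeo0_comp n (f g : 'rV[R]_n.+1 -> 'rV[R]_n.+1) :
  local_diffeo0 f -> local_diffeo0 g -> local_diffeo0 (f \o g).
Proof.
move=> df dg; have [sf f0 [f' [sf' f'0 f'f ff']]] := df.
have [sg g0 [g' [sg' g'0 g'g gg']]] := dg.
have df' : local_diffeo0 f' by split=> //; exists f.
split; [exact: smooth_map_comp | by rewrite /= g0 | exists (g' \o f'); split].
- exact: smooth_map_comp.
- by rewrite /= f'0.
- by apply: filterS2 (local_diffeo0_cont dg f'f) g'g => p /= -> ->.
- by apply: filterS2 (local_diffeo0_cont df' gg') ff' => p /= -> ->.
Qed.

Lemma maps_onto_comp (f g f' g' : 'rV[R]_2 -> 'rV[R]_2) F1 F2 F3 :
  local_diffeo0 f -> local_diffeo0 g ->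
  maps_onto f g F1 F2 -> maps_onto f' g' F2 F3 ->
  maps_onto (f' \o f) (g' \o g) F1 F3.
Proof.
move=> df dg [[A1 B1] [/= nA1 nB1] AB1] [[A2 B2] [/= nA2 nB2] AB2].
exists (A1 `&` f @^-1` A2, B1 `&` g @^-1` B2).
  split; apply: filterI => //; first exact: (local_diffeo0_cont df nA2).
  exact: (local_diffeo0_cont dg nB2).
move=> [p q] [/= [pA1 pA2] [qB1 qB2]].
have := AB1 (p, q) (conj pA1 qB1); have := AB2 (f p, g q) (conj pA2 qB2).
by move=> /= -> ->.
Qed.

Lemma takes_to_normal_form_comp l F F1 (Phi Psi : product_polymap R) :
  admissible Phi -> maps_onto (xy_map Phi) (ab_map Phi) F F1 ->
  takes_to_normal_form l F1 Psi -> takes_to_normal_form l F (comp_polymap Psi Phi).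
Proof.
move=> [dx da] FF1 [[dx' da'] [F2 [pF2 F1F2 nF2]]].
rewrite /takes_to_normal_form /admissible xy_map_comp ab_map_comp; split.
  by split; exact: local_diffeo0_comp.
by exists F2; split=> //; exact: maps_onto_comp F1F2.
Qed.

Lemma normalization F : para_CR F -> regular F -> forall l, (2 <= l)%N ->
  exists Phi : product_polymap R, takes_to_normal_form l F Phi.
Proof.
move=> pF rF; elim=> [//|l IH]; rewrite leq_eqVlt => /orP[/eqP <-|l2].
  exact: quadratic_normalization.
have [Phi [aPhi [F1 [pF1 FF1 nF1]]]] := IH l2.
case: l l2 IH nF1 => [//|e] e0 _ nF1.
have [Psi [_ nPsi]] := normal_form_step e0 pF1 nF1.
by exists (comp_polymap Psi Phi); exact: takes_to_normal_form_comp FF1 nPsi.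
Qed.

End Main.

Theorem theorem1 (R : realType) (F : 'rV[R]_3 -> R)
    (F_para_CR : para_CR F) (F_regular : regular F) (l : nat)
    (l_ge2 : (2 <= l)%N) :
  (exists Phi : product_polymap R, takes_to_normal_form l F Phi) /\
  (jet_in_normal_form l F ->
    (exists Phi : product_polymap R,
       elementary l Phi /\ takes_to_normal_form l.+1 F Phi) /\
    ((4 < l)%N -> forall Phi Psi : product_polymap R,
       elementary l Phi -> takes_to_normal_form l.+1 F Phi ->
       elementary l Psi -> takes_to_normal_form l.+1 F Psi ->
       Phi = Psi)).
Proof.
split; first exact: normalization.
case: l l_ge2 => [//|e] e0 nF; split; first exact: normal_form_step.
by move=> e4 Phi Psi; exact: elementary_unique.
Qed.
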